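(* Let $c:[0,L]\to\mathbb{R}^3$ be a rectifiable curve of class $C^3$ parameterized by arc-length with $\ddot c(s)\ne0$ for each $s\in[0,L]$, so that $L=\mathcal{L}(c)$, $C=\mathrm{TC}(c)$ and $T=\mathrm{TAT}(c)$ are finite. Let $s:[0,C+T]\to[0,L]$ be the inverse of the increasing and bijective function $t:[0,L]\to[0,C+T]$ given by $$t(s):=\int_0^s\big(\mathbf{k}(\lambda)+|\boldsymbol{\tau}(\lambda)|\big)\,d\lambda,\qquad s\in[0,L],$$ where $\mathbf{k}(\lambda)$ and $\boldsymbol{\tau}(\lambda)$ are the curvature and torsion of $c$ at the point $c(\lambda)$. Then the principal normal $\mathfrak{n}$ of $c$, with values in $\mathbb{S}^2$, and the weak principal normal $\mathfrak{n}_c:[0,C+T]\to\mathbb{RP}^2$ of $c$ are linked by the formula $$[\mathfrak{n}(s(t))]=\mathfrak{n}_c(t)\in\mathbb{RP}^2\qquad\forall\,t\in[0,C+T].$$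
   Context: Frenet frame: $\mathfrak{t}=\dot c$, $\mathfrak{n}=\ddot c/\|\ddot c\|$, $\mathfrak{b}=\mathfrak{t}\times\mathfrak{n}$; curvature $\mathbf{k}=\|\ddot c\|$; torsion $\boldsymbol{\tau}$ defined by $\dot{\mathfrak{b}}=-\boldsymbol{\tau}\,\mathfrak{n}$. $\mathbb{S}^2\subset\mathbb{R}^3$ is the unit sphere with geodesic distance $d_{\mathbb{S}^2}$; $\mathbb{RP}^2=\mathbb{S}^2/\{\pm1\}$ has elements $[y]$ and metric $d_{\mathbb{RP}^2}([y],[z])=\min\{d_{\mathbb{S}^2}(y,z),d_{\mathbb{S}^2}(y,-z)\}$; $\Pi:\mathbb{S}^2\to\mathbb{RP}^2$ is the projection; $\mathcal{L}_{\mathbb{S}^2},\mathcal{L}_{\mathbb{RP}^2}$ are lengths with respect to these metrics. For orthogonal unit vectors $u,v$ set $[u]\times[v]:=[u\times v]\in\mathbb{RP}^2$. Polygonals. A polygonal $P$ in $\mathbb{R}^3$ has consecutive vertices $v_0,\dots,v_n$ and oriented segments $\sigma_i=[v_{i-1},v_i]$, identified with the vectors $v_i-v_{i-1}$, all of positive length (repeated consecutive vertices are discarded). The total curvature $\mathrm{TC}(P)$ is the sum of the turning angles (in $[0,\pi]$) between $\sigma_i$ and $\sigma_{i+1}$ at the interior vertices $v_i$, $i=1,\dots,n-1$. The discrete binormals are $b_i:=\frac{\sigma_i\times\sigma_{i+1}}{\|\sigma_i\times\sigma_{i+1}\|}\in\mathbb{S}^2$, $i=1,\dots,n-1$. If $\sigma_i\times\sigma_{i+1}=0$,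 then in this formula $\sigma_{i+1}$ is replaced by $[v_i,v_{j+1}]$, where $j$ is the first index greater than $i$ with $\sigma_j\times\sigma_{j+1}\ne0$; if no such $j$ exists, $b_i:=b_{i-1}$. The total absolute torsion is $\mathrm{TAT}(P):=\sum_{i=2}^{n-1}d_{\mathbb{RP}^2}([b_{i-1}],[b_i])$ and the complete torsion (Alexandrov–Reshetnyak) is $\mathrm{CT}(P):=\sum_{i=2}^{n-1}d_{\mathbb{S}^2}(b_{i-1},b_i)$. If $P$ is closed ($v_0=v_n$), indices are taken cyclically and the sums run over all $n$ vertices, respectively all $n$ segments. Normal indicatrix. Let $t_i:=\sigma_i/\|\sigma_i\|$; let $\gamma_i$ ($1\le i\le n-1$) be a minimal geodesic arc in $\mathbb{S}^2$ from $t_i$ to $t_{i+1}$ (trivial if $t_{i+1}=t_i$; if $t_{i+1}=-t_i$, taken in the great circle orthogonal to $b_i$), and $[\gamma_i]:=\Pi(\gamma_i)$; let $\Gamma_i$ ($2\le i\le n-1$) be the minimal geodesic arc in $\mathbb{RP}^2$ from $[b_{i-1}]$ to $[b_i]$ (trivial if $b_i=\pm b_{i-1}$). Put $C_P:=\mathrm{TC}(P)$, $T_P:=\mathrm{TAT}(P)$, $C_0:=0$, $T_1:=0$, $C_i:=\sum_{j=1}^i\mathcal{L}_{\mathbb{S}^2}(\gamma_j)$ for $1\le i\le n-1$, $T_i:=\sum_{j=2}^i\mathcal{L}_{\mathbb{RP}^2}(\Gamma_j)$ for $2\le i\le n-1$. Define continuous curves $\widetilde{\mathfrak{t}}_P,\widetilde{\mathfrak{b}}_P:[0,C_P+T_P]\to\mathbb{RP}^2$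 by: on $[C_{i-1}+T_i,C_i+T_i]$, $i=1,\dots,n-1$, $\widetilde{\mathfrak{t}}_P$ parameterizes the oriented arc $[\gamma_i]$ with velocity one and $\widetilde{\mathfrak{b}}_P\equiv[b_i]$; on $[C_{i-1}+T_{i-1},C_{i-1}+T_i]$, $i=2,\dots,n-1$, $\widetilde{\mathfrak{t}}_P\equiv[t_i]$ and $\widetilde{\mathfrak{b}}_P$ parameterizes the oriented arc $\Gamma_i$ with velocity one. These are pointwise orthogonal, and the normal indicatrix of $P$ is $\mathfrak{n}_P(s):=\widetilde{\mathfrak{b}}_P(s)\times\widetilde{\mathfrak{t}}_P(s)$, $s\in[0,C_P+T_P]$. (For closed polygonals the construction is modified cyclically.) Inscribed polygonals. For $c:[a,b]\to\mathbb{R}^3$, $P\ll c$ ($P$ inscribed in $c$) means that there is a partition $a=\lambda_0<\dots<\lambda_n=b$ such that $P$ has vertices $v_i=c(\lambda_i)$. The modulus $\mu_c(P)$ is the maximum of the diameters of the arcs $c([\lambda_{i-1},\lambda_i])$. Define $\mathrm{TC}(c):=\sup\{\mathrm{TC}(P):P\ll c\}$, $\mathrm{CT}(c):=\sup\{\mathrm{CT}(P):P\ll c\}$ and $\mathrm{TAT}(c):=\lim_{\varepsilon\to0^+}\sup\{\mathrm{TAT}(P):P\ll c,\ \mu_c(P)<\varepsilon\}$. Weak principal normal. For a curve $c$ with finite $C=\mathrm{TC}(c)$, $\mathrm{CT}(c)$ and $T=\mathrm{TAT}(c)$, there is a unique curve $\mathfrak{n}_c:[0,C+T]\to\mathbb{RP}^2$,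 parameterized by arc-length, such that for every sequence $\{P_h\}$ of polygonals inscribed in $c$ with $\mu_c(P_h)\to0$, the constant-velocity parameterizations $s\mapsto\mathfrak{n}_{P_h}\big((\mathrm{TC}(P_h)+\mathrm{TAT}(P_h))s/(C+T)\big)$ converge to $\mathfrak{n}_c$ uniformly on $[0,C+T]$; $\mathfrak{n}_c$ is called the weak principal normal of $c$.
   Formalization: If c(0)=c(L), c is required to be C^3 as a closed curve (derivatives up to order 3 agree at 0 and L); otherwise a corner there adds to TC(c) and t is not onto [0,C+T]. Arc-length parameterization of n_c is not assumed, which only strengthens the claim. *)

(* Defs.v *)
From HB Require Import structures.
From mathcomp Require Export all_boot all_order all_algebra.
From mathcomp Require Export generic_quotient.
From mathcomp Require Export all_classical all_reals all_analysis.

Set Implicit Arguments.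
Unset Strict Implicit.
Unset Printing Implicit Defensive.

Export Order.TTheory GRing.Theory Num.Theory.
Export numFieldNormedType.Exports.

Local Open Scope classical_set_scope.
Local Open Scope ring_scope.

Section Euclidean.
Context {R : realType}.
Implicit Types u v w : 'rV[R]_3.

Definition dot u v : R := \sum_(i < 3) u 0 i * v 0 i.

(* The normed-space structure of 'rV[R]_3 in the library is the max norm; it
   is only used here for its topology, lengths being measured by enorm. *)
Definition enorm u : R := Num.sqrt (dot u u).

Definition edist u v : R := enorm (u - v).

Definition cross u v : 'rV[R]_3 :=
  \row_(i < 3) (u 0 (inord ((i + 1) %% 3)) * v 0 (inord ((i + 2) %% 3))
              - u 0 (inord ((i + 2) %% 3)) * v 0 (inord ((i + 1) %% 3))).

Definition diam (A : set 'rV[R]_3) : R :=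
  sup [set edist p q | p in A & q in A].

Lemma dotC u v : dot u v = dot v u.
Proof. by apply: eq_bigr => i _; rewrite mulrC. Qed.

Lemma dotNr u v : dot u (- v) = - dot u v.
Proof. by rewrite -sumrN; apply: eq_bigr => i _; rewrite mxE mulrN. Qed.

Lemma dotNl u v : dot (- u) v = - dot u v.
Proof. by rewrite dotC dotNr dotC. Qed.

Lemma enormN u : enorm (- u) = enorm u.
Proof. by rewrite /enorm dotNl dotNr opprK. Qed.

Lemma enormZ (a : R) u : enorm (a *: u) = `|a| * enorm u.
Proof.
rewrite /enorm; have -> : dot (a *: u) (a *: u) = a ^+ 2 * dot u u.
  by rewrite mulr_sumr; apply: eq_bigr => i _; rewrite !mxE mulrACA -expr2.
by rewrite sqrtrM ?sqr_ge0// sqrtr_sqr.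
Qed.

Lemma enorm_gt0 u : u != 0 -> 0 < enorm u.
Proof.
move=> u0; rewrite sqrtr_gt0 lt_neqAle sumr_ge0 ?andbT; last first.
  by move=> i _; rewrite -expr2 sqr_ge0.
apply: contra u0; rewrite eq_sym psumr_eq0; last first.
  by move=> i _; rewrite -expr2 sqr_ge0.
move=> /allP u0; apply/eqP/rowP => i; rewrite mxE.
by have := u0 i (mem_index_enum i); rewrite mulf_eq0 orbb => /eqP.
Qed.

Lemma crossNl u v : cross (- u) v = - cross u v.
Proof. by apply/rowP => i; rewrite !mxE !mulNr opprB opprK addrC. Qed.

Lemma crossNr u v : cross u (- v) = - cross u v.
Proof. by apply/rowP => i; rewrite !mxE !mulrN opprB opprK addrC. Qed.

End Euclidean.

Section Sphere.
Context {R : realType}.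

Record S2 := MkS2 { S2val :> 'rV[R]_3; S2valP : enorm S2val == 1 }.

HB.instance Definition _ := [isSub for S2val].
HB.instance Definition _ := [Choice of S2 by <:].

Definition geodS2 (y z : S2) : R := acos (dot y z).

Fact antipode_subproof (y : S2) : enorm (- (y : 'rV[R]_3)) == 1.
Proof. by rewrite enormN S2valP. Qed.
Definition antipode (y : S2) : S2 := MkS2 (antipode_subproof y).

Fact pole_subproof : enorm (delta_mx 0 0 : 'rV[R]_3) == 1.
Proof.
rewrite /enorm /dot (bigD1 0)//= big1 ?mxE//= ?mulr1 ?addr0 ?sqrtr1// => i i0.
by rewrite mxE (negbTE i0) andbF mulr0.
Qed.
Definition pole : S2 := MkS2 pole_subproof.

(* u / ||u||, with the junk value pole at u = 0. *)
Definition unitv (u : 'rV[R]_3) : S2 := insubd pole ((enorm u)^-1 *: u).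

Lemma unitvE (u : 'rV[R]_3) :
  u != 0 -> unitv u = (enorm u)^-1 *: u :> 'rV[R]_3.
Proof.
move=> u0; have u_gt0 := enorm_gt0 u0.
have u1 : enorm ((enorm u)^-1 *: u) == 1.
  by rewrite enormZ ger0_norm ?invr_ge0 ?(ltW u_gt0)// mulVf ?(gt_eqF u_gt0).
by have := val_insubd pole ((enorm u)^-1 *: u); rewrite u1.
Qed.

End Sphere.
Arguments S2 : clear implicits.

Section ProjectivePlane.
Context {R : realType}.

Definition antipodal (y z : S2 R) : bool := (y == z) || (y == antipode z).

Lemma antipodeK : involutive (@antipode R).
Proof. by move=> y; apply: val_inj; rewrite /= opprK. Qed.

Fact antipodal_refl : reflexive antipodal.
Proof. by move=> y; rewrite /antipodal eqxx. Qed.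

Fact antipodal_sym : symmetric antipodal.
Proof.
move=> y z; rewrite /antipodal eq_sym; congr (_ || _).
by rewrite -(inj_eq (inv_inj antipodeK)) antipodeK eq_sym.
Qed.

Fact antipodal_trans : transitive antipodal.
Proof.
move=> y x z /orP[] /eqP-> //; rewrite /antipodal => /orP[] /eqP->.
  by rewrite eqxx orbT.
by rewrite antipodeK eqxx.
Qed.

Canonical antipodal_equiv :=
  EquivRel antipodal antipodal_refl antipodal_sym antipodal_trans.

Definition RP2 := {eq_quot antipodal_equiv}%qT.

HB.instance Definition _ := Choice.on RP2.
HB.instance Definition _ := EqQuotient.on RP2.

Definition cls (y : S2 R) : RP2 := (\pi_RP2 y)%qT.

Definition geodRP2 (p q : RP2) : R :=
  Num.min (geodS2 (repr p) (repr q)) (geodS2 (repr p) (antipode (repr q))).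

(* Meaningful for orthogonal lines only. *)
Definition crossRP2 (p q : RP2) : RP2 :=
  cls (unitv (cross (repr p) (repr q))).

Lemma clsP (y z : S2 R) : (cls y = cls z) <-> (y = z \/ y = antipode z).
Proof.
split=> [/eqmodP/orP[]/eqP ->|yz]; [by left|by right|].
by apply/eqmodP/orP; case: yz => ->; [left|right].
Qed.

Lemma repr_cls (y : S2 R) : repr (cls y) = y \/ repr (cls y) = antipode y.
Proof. by apply/clsP; rewrite /cls reprK. Qed.

Lemma geodRP2_cls (y z : S2 R) :
  geodRP2 (cls y) (cls z) = Num.min (geodS2 y z) (geodS2 y (antipode z)).
Proof.
have gN (a b : S2 R) : geodS2 (antipode a) b = geodS2 a (antipode b).
  by rewrite /geodS2 /= dotNl dotNr.
rewrite /geodRP2; case: (repr_cls y) => ->; case: (repr_cls z) => -> //.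
- by rewrite antipodeK minC.
- by rewrite !gN antipodeK minC.
- by rewrite !gN !antipodeK.
Qed.

Lemma crossRP2_cls (y z : S2 R) : cross y z != 0 ->
  crossRP2 (cls y) (cls z) = cls (unitv (cross y z)).
Proof.
move=> yz0.
have uN (u : 'rV[R]_3) : u != 0 -> unitv (- u) = antipode (unitv u).
  move=> u0; apply: val_inj; rewrite /= !unitvE ?oppr_eq0//.
  by rewrite enormN scalerN.
apply/clsP; case: (repr_cls y) => ->; case: (repr_cls z) => -> /=.
- by left.
- by right; rewrite crossNr uN.
- by right; rewrite crossNl uN.
- by left; rewrite crossNl crossNr opprK.
Qed.

End ProjectivePlane.
Arguments RP2 : clear implicits.

Section Polygonals.
Context {R : realType}.
Implicit Types v : seq 'rV[R]_3.

(* A polygonal is the sequence v_0, ..., v_n of its vertices, with distinct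
   consecutive entries; n = nseg v.  Segments, turning angles and binormals
   are numbered from 1. *)
Fixpoint discard v : seq 'rV[R]_3 :=
  if v is x :: v' then
    if v' is y :: _ then if x == y then discard v' else x :: discard v'
    else v
  else [::].

Definition nseg v : nat := (size v).-1.

Definition closed_poly v : bool := nth 0 v 0 == last 0 v.

(* For a closed polygonal the vertices, hence also sg, tg and bin below, are
   indexed cyclically modulo n. *)
Definition vtx v (i : nat) : 'rV[R]_3 :=
  nth 0 v (if closed_poly v then (i %% nseg v)%N else i).

Definition sg v (i : nat) : 'rV[R]_3 := vtx v i - vtx v i.-1.

Definition tg v (i : nat) : S2 R := unitv (sg v i).

Definition nturn v : nat := if closed_poly v then nseg v else (nseg v).-1.

Definition next_turns v (i : nat) : seq nat :=
  [seq j <- index_iota i.+1 (if closed_poly v then i + nseg v else nseg v)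
     | cross (sg v j) (sg v j.+1) != 0].

(* The junk value pole is only reached when all segments are parallel. *)
Fixpoint bin v (i : nat) : S2 R :=
  if i is i'.+1 then
    if cross (sg v i) (sg v i.+1) != 0 then
      unitv (cross (sg v i) (sg v i.+1))
    else if next_turns v i is j :: _ then
      unitv (cross (sg v i) (vtx v j.+1 - vtx v i))
    else bin v i'
  else pole.

Definition turn_sum v (i : nat) : R :=
  \sum_(1 <= j < i.+1) geodS2 (tg v j) (tg v j.+1).

Definition twist_sum v (i : nat) : R :=
  \sum_(2 <= j < i.+1) geodRP2 (cls (bin v j.-1)) (cls (bin v j)).

(* Index of the last term of the torsion sums: n - 1, or n + 1 when the
   polygonal is closed, b_(n+1) being b_1. *)
Definition ntwist v : nat := nturn v + closed_poly v.

Definition TC v : R := turn_sum v (nturn v).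

Definition TAT v : R := twist_sum v (ntwist v).

Definition CT v : R :=
  \sum_(2 <= j < (ntwist v).+1) geodS2 (bin v j.-1) (bin v j).

(* g restricted to [0, d u w] is a minimal geodesic arc from u to w,
   parameterized with velocity one. *)
Definition min_geodesic {T : Type} (d : T -> T -> R) (u w : T) (g : R -> T) :=
  [/\ g 0 = u, g (d u w) = w &
      {in `[0, d u w] &, forall x y, d (g x) (g y) = `|x - y|}].

(* A relation, since the minimal arcs need not be unique.  In the closed case
   the last piece is the arc from [b_n] to [b_(n+1)] = [b_1], along which tt
   is constantly [t_(n+1)] = [t_1]. *)
Definition normal_indicatrix v (n : R -> RP2 R) : Prop :=
  let C := turn_sum v in let T := twist_sum v in
  exists tt bb : R -> RP2 R, [/\
    forall i : nat, (1 <= i <= nturn v)%N ->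
      exists g : R -> S2 R,
        [/\ min_geodesic geodS2 (tg v i) (tg v i.+1) g,
            tg v i.+1 = antipode (tg v i) ->
              {in `[0, geodS2 (tg v i) (tg v i.+1)],
                forall x, dot (g x) (bin v i) = 0} &
            {in `[C i.-1 + T i, C i + T i], forall s,
              tt s = cls (g (s - (C i.-1 + T i))) /\ bb s = cls (bin v i)}],
    forall i : nat, (2 <= i <= ntwist v)%N ->
      exists G : R -> RP2 R,
        min_geodesic geodRP2 (cls (bin v i.-1)) (cls (bin v i)) G /\
        {in `[C i.-1 + T i.-1, C i.-1 + T i], forall s,
          tt s = cls (tg v i) /\ bb s = G (s - (C i.-1 + T i.-1))} &
    {in `[0, TC v + TAT v], forall s, n s = crossRP2 (bb s) (tt s)}].

End Polygonals.

Section Curves.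
Context {R : realType}.
Variables (a b : R) (c : R -> 'rV[R]_3).

(* Partitions follow itv_partition: lam lists lambda_1 < ... < lambda_n = b,
   the first node lambda_0 = a being left out. *)
Definition inscribed (lam : seq R) : seq 'rV[R]_3 :=
  discard [seq c x | x <- a :: lam].

Definition modulus (lam : seq R) : R :=
  \big[Num.max/0]_(i < size lam)
     diam (c @` `[nth b (a :: lam) i, nth b (a :: lam) i.+1]).

Definition curve_length : \bar R :=
  ereal_sup [set (\sum_(i < size lam)
      edist (c (nth b (a :: lam) i)) (c (nth b (a :: lam) i.+1)))%:E
    | lam in itv_partition a b].

Definition curve_TC : \bar R :=
  ereal_sup [set (TC (inscribed lam))%:E | lam in itv_partition a b].

Definition curve_CT : \bar R :=
  ereal_sup [set (CT (inscribed lam))%:E | lam in itv_partition a b].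

Definition curve_TAT : \bar R :=
  lim (ereal_sup [set (TAT (inscribed lam))%:E
    | lam in [set lam | itv_partition a b lam /\ modulus lam < e]]
      @[e --> 0^'+]).

(* Arc-length parameterization of nc is deliberately not required: each n_P has
   velocity one, but the uniform limit is in general only 1-Lipschitz (for a
   smooth curve its speed is sqrt(k^2 + tau^2) / (k + |tau|)). *)
Definition is_weak_principal_normal (nc : R -> RP2 R) : Prop :=
  let C := fine curve_TC in let T := fine curve_TAT in
  [/\ curve_TC \is a fin_num, curve_CT \is a fin_num,
      curve_TAT \is a fin_num &
      forall (lam : nat -> seq R) (n : nat -> R -> RP2 R),
        (forall h, itv_partition a b (lam h)) ->
        (modulus (lam h) @[h --> \oo] --> (0 : R)) ->
        (forall h, normal_indicatrix (inscribed (lam h)) (n h)) ->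
        forall e : R, 0 < e -> \forall h \near \oo,
          {in `[0, C + T], forall s,
            geodRP2
              (n h ((TC (inscribed (lam h)) + TAT (inscribed (lam h)))
                      * s / (C + T)))
              (nc s) < e}].

End Curves.

Section Smooth.
Context {R : realType}.
Variables (a b : R).

(* Derivatives are taken relative to [a, b], hence one-sided at a and b. *)
Definition diff_quot (f : R -> 'rV[R]_3) (x y : R) : 'rV[R]_3 :=
  (y - x)^-1 *: (f y - f x).

Definition derivable_in (f : R -> 'rV[R]_3) (x : R) : Prop :=
  cvg (diff_quot f x y @[y --> within `[a, b] x^']).

Definition deriv_in (f : R -> 'rV[R]_3) (x : R) : 'rV[R]_3 :=
  lim (diff_quot f x y @[y --> within `[a, b] x^']).

Definition derivn_in (k : nat) (f : R -> 'rV[R]_3) : R -> 'rV[R]_3 :=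
  iter k deriv_in f.

Variable c : R -> 'rV[R]_3.

(* A curve with c a = c b is a closed curve (its inscribed polygonals are
   closed, and treated cyclically): class C^m then means C^m as a periodic
   function. *)
Definition class_C (m : nat) : Prop :=
  [/\ forall k, (k < m)%N -> {in `[a, b], forall x, derivable_in (derivn_in k c) x},
      {within `[a, b], continuous (derivn_in m c)} &
      c a = c b -> forall k, (k <= m)%N -> derivn_in k c a = derivn_in k c b].

Definition arclength_param : Prop :=
  forall x y, a <= x -> x <= y -> y <= b -> curve_length x y c = (y - x)%:E.

Definition tangent : R -> 'rV[R]_3 := derivn_in 1 c.

Definition principal_normal (x : R) : S2 R := unitv (derivn_in 2 c x).

Definition binormal (x : R) : 'rV[R]_3 := cross (tangent x) (principal_normal x).

Definition curvature (x : R) : R := enorm (derivn_in 2 c x).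

Definition torsion (x : R) : R :=
  get [set tau : R | deriv_in binormal x
                     = - tau *: (principal_normal x : 'rV[R]_3)].

End Smooth.

(* Main.v *)
Require Import Defs.
From mathcomp Require Import ring lra.

Set Implicit Arguments.
Unset Strict Implicit.
Unset Printing Implicit Defensive.

Local Open Scope classical_set_scope.
Local Open Scope ring_scope.

(** Let [t], [n], [b] be the Frenet frame of [c], [k] its curvature and [tau] its torsion.
    The proof compares the discrete frame of an inscribed polygonal with the Frenet
    frame, with errors that remain small after summation.

    For a partition with nodes [x_0 < x_1 < ...] and small mesh, Taylor expansion gives
    two estimates.  The direction of the i-th segment is [t] at the midpoint of its
    interval, up to an error small compared with the length of the interval
    ([chord_tangent]).  The i-th discrete binormal is [b] at the centroid of the three
    nodes involved, up to an error small compared with the length of the two intervals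
    ([binormal_dir]); this is where three derivatives are used.  Since [t] and [b] move on
    the sphere with speeds [k] and [|tau|] ([spherical_speed]), the partial sums of the
    turning angles and of the distances of consecutive binormals follow the integrals
    of [k] and of [|tau|] uniformly ([frame_close_fine]).  For closed curves the additional
    terms at the closing vertex are finitely many and small.

    Consequently the total absolute torsion of [c], a limit over fine polygonals, is the
    integral of [|tau|] ([curve_TATE]).  The total curvature is a supremum over all inscribed
    polygonals, so a bound for coarse ones is required as well.  It follows from the
    subadditivity of the angle between the tangent at the start of an arc and its chord
    plus the angle between the chord and the tangent at its end ([tiltD]), which holds
    because the direction of a sum of two vectors lies on the arc between their
    directions; localized, this quantity is bounded by the integral of [k]
    ([TC_le_total_curvature], [curve_TCE]).

    The parameter of the normal indicatrix of a polygonal at stage i is the turning plus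
    the twisting accumulated so far, which is close to the integral of [k + |tau|] up to
    [x_i], while both components of the moving frame are close to [t] and [b] at [x_i]
    ([indicatrix_stage], [indicatrix_near_normal]).  Fine polygonals do have normal indicatrices
    ([normal_indicatrix_exists]), and these converge both to the weak principal normal, by
    its definition, and to the class of [n] composed with the inverse of the integral;
    the two limits agree ([weak_normal_eq]). *)

(** * Vector algebra in three-space *)

Section Vectors.
Context {R : realType}.
Implicit Types (u v w p q : 'rV[R]_3) (a : R).

Local Notation i0 := (inord 0 : 'I_3).
Local Notation i1 := (inord 1 : 'I_3).
Local Notation i2 := (inord 2 : 'I_3).

Lemma dotE u v : dot u v = u 0 i0 * v 0 i0 + u 0 i1 * v 0 i1 + u 0 i2 * v 0 i2.
Proof.
rewrite /dot !big_ord_recr big_ord0 /= add0r.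
by congr (_ * _ + _ * _ + _ * _); congr (_ _ _); apply: val_inj; rewrite /= inordK.
Qed.

Lemma row3P u v :
  [/\ u 0 i0 = v 0 i0, u 0 i1 = v 0 i1 & u 0 i2 = v 0 i2] -> u = v.
Proof.
move=> [h0 h1 h2]; apply/rowP => -[[|[|[|//]]] i].
- by rewrite (_ : Ordinal i = i0) //; apply: val_inj; rewrite /= inordK.
- by rewrite (_ : Ordinal i = i1) //; apply: val_inj; rewrite /= inordK.
- by rewrite (_ : Ordinal i = i2) //; apply: val_inj; rewrite /= inordK.
Qed.

Lemma crossE u v :
  (cross u v 0 i0 = u 0 i1 * v 0 i2 - u 0 i2 * v 0 i1) *
  (cross u v 0 i1 = u 0 i2 * v 0 i0 - u 0 i0 * v 0 i2) *
  (cross u v 0 i2 = u 0 i0 * v 0 i1 - u 0 i1 * v 0 i0).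
Proof. by rewrite /cross !mxE !inordK. Qed.

Ltac vring := by rewrite ?dotE ?(crossE, mxE); ring.
Ltac vvring := by apply: row3P; split; rewrite ?dotE !(crossE, mxE); ring.

Lemma dotDl u v w : dot (u + v) w = dot u w + dot v w. Proof. vring. Qed.
Lemma dotDr u v w : dot w (u + v) = dot w u + dot w v. Proof. vring. Qed.
Lemma dotBl u v w : dot (u - v) w = dot u w - dot v w. Proof. vring. Qed.
Lemma dotBr u v w : dot w (u - v) = dot w u - dot w v. Proof. vring. Qed.
Lemma dotZl a u v : dot (a *: u) v = a * dot u v. Proof. vring. Qed.
Lemma dotZr a u v : dot u (a *: v) = a * dot u v. Proof. vring. Qed.
Lemma dot0l u : dot 0 u = 0. Proof. vring. Qed.

Lemma crossDl u v w : cross (u + v) w = cross u w + cross v w. Proof. vvring. Qed.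
Lemma crossDr u v w : cross w (u + v) = cross w u + cross w v. Proof. vvring. Qed.
Lemma crossBl u v w : cross (u - v) w = cross u w - cross v w. Proof. vvring. Qed.
Lemma crossBr u v w : cross w (u - v) = cross w u - cross w v. Proof. vvring. Qed.
Lemma crossZl a u v : cross (a *: u) v = a *: cross u v. Proof. vvring. Qed.
Lemma crossZr a u v : cross u (a *: v) = a *: cross u v. Proof. vvring. Qed.
Lemma crossC u v : cross u v = - cross v u. Proof. vvring. Qed.
Lemma crossvv u : cross u u = 0. Proof. vvring. Qed.

Lemma dot_cross_l u v : dot u (cross u v) = 0. Proof. vring. Qed.

Lemma binet_cauchy u v w p :
  dot (cross u v) (cross w p) = dot u w * dot v p - dot u p * dot v w.
Proof. vring. Qed.

Lemma double_cross u v w : cross u (cross v w) = dot u w *: v - dot u v *: w.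
Proof. vvring. Qed.

Lemma dotvv_ge0 u : 0 <= dot u u.
Proof. by rewrite dotE -!expr2 !addr_ge0 ?sqr_ge0. Qed.

Lemma sqr_enorm u : enorm u ^+ 2 = dot u u.
Proof. by rewrite /enorm sqr_sqrtr ?dotvv_ge0. Qed.

Lemma enorm_ge0 u : 0 <= enorm u. Proof. exact: sqrtr_ge0. Qed.
#[local] Hint Resolve enorm_ge0 : core.

Lemma enorm0 : enorm (0 : 'rV[R]_3) = 0.
Proof. by rewrite /enorm dot0l sqrtr0. Qed.

Lemma enorm0_eq0 u : enorm u = 0 -> u = 0.
Proof. by move=> u0; apply/eqP; apply: contra_eqT u0 => /enorm_gt0 /gt_eqF ->. Qed.

Lemma enorm1_neq0 u : enorm u = 1 -> u != 0.
Proof. by apply: contra_eqN => /eqP ->; rewrite enorm0 eq_sym oner_eq0. Qed.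

Lemma enorm1_dot u : enorm u = 1 -> dot u u = 1.
Proof. by move=> u1; rewrite -sqr_enorm u1 expr1n. Qed.

Lemma sqr_dot_le u v : dot u v ^+ 2 <= dot u u * dot v v.
Proof.
have := binet_cauchy u v u v; have := dotvv_ge0 (cross u v).
by rewrite [dot v u]dotC -expr2 => h e; rewrite -subr_ge0 -e.
Qed.

Lemma dot_le u v : dot u v <= enorm u * enorm v.
Proof.
rewrite /enorm -sqrtrM ?dotvv_ge0// (le_trans (ler_norm _))// -sqrtr_sqr.
by rewrite ler_sqrt ?sqr_dot_le// mulr_ge0 ?dotvv_ge0.
Qed.

Lemma norm_dot_le u v : `|dot u v| <= enorm u * enorm v.
Proof. by rewrite ler_norml dot_le andbT lerNl -dotNr -[enorm v]enormN dot_le. Qed.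

Lemma enormD u v : enorm (u + v) <= enorm u + enorm v.
Proof.
rewrite -(@ler_pXn2r _ 2)// ?nnegrE ?addr_ge0//.
rewrite sqr_enorm sqrrD !sqr_enorm dotDl !dotDr [dot v u]dotC.
by have := dot_le u v; lra.
Qed.

Lemma enormB u v : enorm (u - v) <= enorm u + enorm v.
Proof. by rewrite -[enorm v]enormN enormD. Qed.

Lemma edistC u v : enorm (u - v) = enorm (v - u).
Proof. by rewrite -enormN opprB. Qed.

Lemma enorm_le_dist u v : enorm u <= enorm v + enorm (u - v).
Proof. by have := enormD v (u - v); rewrite subrKC. Qed.

Lemma edist_trans v u w : enorm (u - w) <= enorm (u - v) + enorm (v - w).
Proof. by have := enormD (u - v) (v - w); rewrite addrA subrK. Qed.

Lemma norm_enormB u v : `|enorm u - enorm v| <= enorm (u - v).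
Proof.
have := enorm_le_dist u v; have := enorm_le_dist v u; rewrite (edistC v).
by move=> h1 h2; rewrite ler_norml; apply/andP; split; lra.
Qed.

Lemma enorm_cross u v : enorm (cross u v) <= enorm u * enorm v.
Proof.
rewrite {2 3}/enorm -sqrtrM ?dotvv_ge0// /enorm ler_sqrt ?mulr_ge0 ?dotvv_ge0//.
by rewrite binet_cauchy [dot v u]dotC -expr2 lerBlDr lerDl sqr_ge0.
Qed.

Lemma enorm_coord u i : `|u 0 i| <= enorm u.
Proof.
rewrite -sqrtr_sqr /enorm ler_sqrt ?dotvv_ge0// /dot (bigD1 i)//= -expr2.
by rewrite lerDl sumr_ge0// => j _; rewrite -expr2 sqr_ge0.
Qed.

Lemma enorm_le_coord u a : (forall i, `|u 0 i| <= a) -> enorm u <= 2 * a.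
Proof.
move=> h; have a0 : 0 <= a by apply: le_trans (h 0); rewrite normr_ge0.
rewrite -(@ler_pXn2r _ 2)// ?nnegrE ?mulr_ge0//.
rewrite sqr_enorm dotE -!expr2.
have hi i : u 0 i ^+ 2 <= a ^+ 2.
  by rewrite -real_normK ?num_real// ler_pXn2r// nnegrE.
by have := hi i0; have := hi i1; have := hi i2; have := sqr_ge0 a; lra.
Qed.

Lemma S2_enorm (y : S2 R) : enorm y = 1. Proof. exact/eqP/S2valP. Qed.
Lemma S2_dot (y : S2 R) : dot y y = 1. Proof. exact/enorm1_dot/S2_enorm. Qed.

Lemma unitvZ a u : 0 < a -> unitv (a *: u) = unitv u.
Proof.
move=> a0; have [->|u0] := eqVneq u 0; first by rewrite scaler0.
apply: val_inj; rewrite /= !unitvE ?scaler_eq0 ?negb_or ?u0 ?gt_eqF//.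
by rewrite enormZ gtr0_norm// scalerA invfM mulrAC mulVf ?gt_eqF// mul1r.
Qed.

Lemma unitv_unit u : enorm u = 1 -> (unitv u : 'rV[R]_3) = u.
Proof. by move=> u1; rewrite unitvE ?enorm1_neq0// u1 invr1 scale1r. Qed.

Lemma unitv_S2 (y : S2 R) : unitv y = y.
Proof. by apply: val_inj; rewrite /= unitv_unit ?S2_enorm. Qed.

Lemma scale_unitv u : u != 0 -> enorm u *: (unitv u : 'rV[R]_3) = u.
Proof. by move=> u0; rewrite unitvE// scalerA mulfV ?scale1r// gt_eqF ?enorm_gt0. Qed.

Local Notation hat u := (S2val (unitv u)).

(** The constant 2 pays once for the displacement and once for the change of
    length. *)
Lemma unitv_lip p q : p != 0 -> q != 0 ->
  enorm (hat q - hat p) <= 2 * enorm (q - p) / enorm p.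
Proof.
move=> p0 q0; have pp := enorm_gt0 p0; have qp := enorm_gt0 q0.
have -> : hat q - hat p =
    (enorm p)^-1 *: ((q - p) + (enorm p - enorm q) *: hat q).
  apply: (@scalerI _ _ (enorm p)); first by rewrite gt_eqF.
  rewrite scalerA mulfV ?gt_eqF// scale1r.
  rewrite -{2}(scale_unitv q0) -{3}(scale_unitv p0).
  apply: row3P; split; rewrite !mxE; ring.
rewrite enormZ ger0_norm ?invr_ge0// mulrC ler_pM2r ?invr_gt0//.
apply: le_trans (enormD _ _) _; rewrite enormZ S2_enorm mulr1.
by have := norm_enormB p q; rewrite edistC; lra.
Qed.

(** The derivative of normalization at [p] removes from an increment its component
    along [p]; the error is quadratic because [enorm q - dot q (unitv p)] is
    half of [enorm q] times the squared distance of the directions. *)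
Lemma unitv_taylor p q : p != 0 -> q != 0 ->
  enorm (hat q - hat p - (enorm p)^-1 *:
     ((q - p) - dot (q - p) (hat p) *: hat p))
    <= 4 * enorm (q - p) ^+ 2 / enorm p ^+ 2.
Proof.
move=> p0 q0; have pp := enorm_gt0 p0; have qp := enorm_gt0 q0.
set P := hat p; set Q := hat q.
have PP : dot P P = 1 by exact: S2_dot.
have QQ : dot Q Q = 1 by exact: S2_dot.
have pE : p = enorm p *: P by rewrite scale_unitv.
have qE : q = enorm q *: Q by rewrite scale_unitv.
have dpq : enorm q - enorm p - dot (q - p) P = enorm q * enorm (Q - P) ^+ 2 / 2.
  rewrite sqr_enorm {2}qE {2}pE !(dotBl, dotBr, dotZl) PP QQ [dot P Q]dotC.
  by field.
have -> : Q - P - (enorm p)^-1 *: ((q - p) - dot (q - p) P *: P) =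
   - (enorm p)^-1 *: ((enorm q - enorm p) *: (Q - P)
        + (enorm q - enorm p - dot (q - p) P) *: P).
  apply: (@scalerI _ _ (enorm p)); first by rewrite gt_eqF.
  rewrite scalerBr !scalerA mulrN mulfV ?gt_eqF// !scaleN1r scale1r.
  rewrite {1}qE {2}pE.
  apply: row3P; split; rewrite !mxE; ring.
rewrite enormZ normrN ger0_norm ?invr_ge0//.
have L1 := unitv_lip p0 q0; rewrite -/P -/Q in L1.
have L2 := unitv_lip q0 p0; rewrite -/P -/Q [enorm (p - q)]edistC [enorm (P - Q)]edistC in L2.
apply: (@le_trans _ _ ((enorm p)^-1 * (enorm (q - p) * enorm (Q - P)
     + enorm (q - p) * enorm (Q - P)))).
  rewrite ler_pM2l ?invr_gt0//; apply: le_trans (enormD _ _) _.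
  rewrite !enormZ S2_enorm mulr1 lerD//.
    by rewrite ler_wpM2r// -[X in _ <= X]edistC edistC norm_enormB.
  rewrite dpq ger0_norm; last by rewrite !mulr_ge0// exprn_ge0.
  rewrite expr2 mulrA mulrAC ler_wpM2r//.
  have := L2; rewrite ler_pdivlMr// => h; lra.
have -> : 4 * enorm (q - p) ^+ 2 / enorm p ^+ 2 = (enorm p)^-1 *
    (enorm (q - p) * (2 * enorm (q - p) / enorm p)
     + enorm (q - p) * (2 * enorm (q - p) / enorm p)).
  by field; rewrite gt_eqF.
by rewrite ler_pM2l ?invr_gt0// lerD// ler_wpM2l.
Qed.

End Vectors.
#[global] Hint Extern 0 (is_true (0 <= enorm _)) => exact: enorm_ge0 : core.

(** * Geodesic distances on the sphere and on the projective plane *)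

Section Geodesic.
Context {R : realType}.
Implicit Types (x y z w : S2 R) (p q : RP2 R).

Lemma ler_cos (a b : R) : 0 <= a <= pi -> 0 <= b <= pi -> (cos a <= cos b) = (b <= a).
Proof. by move=> ha hb; rewrite leNgt ltr_cos ?in_itv// -leNgt. Qed.

Lemma dotS2_itv y z : -1 <= dot y z <= 1.
Proof. by rewrite -ler_norml (le_trans (norm_dot_le _ _))// !S2_enorm mulr1. Qed.

Lemma cos_geodS2 y z : cos (geodS2 y z) = dot y z.
Proof. by rewrite acosK// in_itv/= dotS2_itv. Qed.

Lemma geodS2_itv y z : 0 <= geodS2 y z <= pi.
Proof. by rewrite acos_ge0 ?acos_lepi ?dotS2_itv. Qed.

Lemma geodS2_ge0 y z : 0 <= geodS2 y z.
Proof. by case/andP: (geodS2_itv y z). Qed.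

Lemma geodS2C y z : geodS2 y z = geodS2 z y.
Proof. by rewrite /geodS2 dotC. Qed.

Lemma geodS2xx y : geodS2 y y = 0.
Proof. by rewrite /geodS2 S2_dot acos1. Qed.

Lemma geodS2_antipode y z : geodS2 y (antipode z) = pi - geodS2 y z.
Proof. by rewrite /geodS2 /= dotNr acosN ?dotS2_itv. Qed.

Lemma sin_geodS2 y z : sin (geodS2 y z) = enorm (cross y z).
Proof.
apply/eqP; rewrite -(@eqrXn2 _ 2)// ?sin_ge0_pi ?geodS2_itv//.
by rewrite sin2cos2 cos_geodS2 sqr_enorm binet_cauchy !S2_dot [dot z y]dotC mulr1 expr2.
Qed.

Lemma dot_via y x z : dot y z = dot y x * dot x z - dot (cross y x) (cross x z).
Proof. by rewrite binet_cauchy S2_dot mulr1 opprB addrC subrK. Qed.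

(** Expand the cosine of the sum and compare with the identity of Binet and Cauchy:
    the sines are the norms of the two cross products, so the inequality is that of
    Cauchy and Schwarz. *)
Lemma geodS2_triangle x y z : geodS2 y z <= geodS2 y x + geodS2 x z.
Proof.
have [h|/ltW h] := leP (geodS2 y x + geodS2 x z) pi; last first.
  by apply: le_trans h; case/andP: (geodS2_itv y z).
rewrite -ler_cos ?geodS2_itv ?h ?addr_ge0 ?geodS2_ge0//.
rewrite cosD !cos_geodS2 !sin_geodS2 (dot_via y x z).
by rewrite lerD2l lerN2 dot_le.
Qed.

(** Distances add along the great circle through [y] and [z]: the cross
    products of the three consecutive directions are parallel. *)
Lemma geodS2_between (a b : R) y x z : 0 <= a -> 0 <= b ->
  (x : 'rV[R]_3) = a *: (y : 'rV[R]_3) + b *: (z : 'rV[R]_3) ->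
  geodS2 y x + geodS2 x z = geodS2 y z.
Proof.
move=> a0 b0 xE.
have yx : cross y x = b *: cross y z.
  by rewrite xE crossDr !crossZr crossvv scaler0 add0r.
have xz : cross x z = a *: cross y z.
  by rewrite xE crossDl !crossZl crossvv scaler0 addr0.
have cE : cos (geodS2 y x + geodS2 x z) = dot y z.
  rewrite cosD !cos_geodS2 !sin_geodS2 (dot_via y x z) yx xz dotZl dotZr.
  by rewrite !enormZ !ger0_norm// -sqr_enorm; ring.
have s_le : geodS2 y x + geodS2 x z <= pi.
  suff : geodS2 y x <= pi - geodS2 x z by lra.
  rewrite -geodS2_antipode -ler_cos ?geodS2_itv// !cos_geodS2 /= dotNr.
  suff : 0 <= dot y x + dot x z by lra.
  rewrite [dot x z]dotC xE !dotDr !dotZr !S2_dot [dot z y]dotC !mulr1.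
  have -> : a + b * dot y z + (a * dot y z + b) = (a + b) * (1 + dot y z) by ring.
  by rewrite mulr_ge0 ?(addr_ge0 a0)//; have /andP[h _] := dotS2_itv y z; lra.
by rewrite [RHS]/geodS2 -cE cosK// in_itv/= s_le addr_ge0 ?geodS2_ge0.
Qed.

Lemma geodS2_unitvD (u v : 'rV[R]_3) : u != 0 -> v != 0 -> u + v != 0 ->
  geodS2 (unitv u) (unitv (u + v)) + geodS2 (unitv (u + v)) (unitv v)
    = geodS2 (unitv u) (unitv v).
Proof.
move=> u0 v0 uv0.
apply: (@geodS2_between (enorm u / enorm (u + v)) (enorm v / enorm (u + v)));
  rewrite ?divr_ge0//.
rewrite [_ / _]mulrC [X in _ + X *: _]mulrC -!scalerA !scale_unitv//.
by rewrite unitvE// scalerDr.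
Qed.

Lemma sin_le_id (a : R) : 0 <= a -> sin a <= a.
Proof.
move=> a0.
have [|b _] := @MVT_segment R sin cos 0 a a0.
  by apply: continuous_subspaceT => b; exact: continuous_sin.
rewrite sin0 !subr0 => ->; rewrite ler_piMl//; exact: cos_le1.
Qed.

Lemma mulr_cos_le_sin (a : R) : 0 <= a <= pi -> a * cos a <= sin a.
Proof.
move=> /andP[a0 api].
have [|b] := @MVT_segment R sin cos 0 a a0.
  by apply: continuous_subspaceT => b; exact: continuous_sin.
rewrite sin0 !subr0 in_itv/= => /andP[b0 ba] ->; rewrite mulrC ler_wpM2r//.
by rewrite ler_cos ?a0 ?api ?b0 ?ba ?(le_trans ba).
Qed.

Lemma cos_ge_quadratic (a : R) : 0 <= a -> 1 - a ^+ 2 / 2 <= cos a.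
Proof.
move=> a0; have aE : a = a / 2 + a / 2 by lra.
have -> : cos a = 1 - 2 * sin (a / 2) ^+ 2.
  by rewrite {1}aE cosD -!expr2 cos2sin2; ring.
have h1 : `|sin (a / 2)| <= a / 2.
  have := sin_le_id (_ : 0 <= a / 2); rewrite divr_ge0// => /(_ isT) h.
  rewrite ler_norml h andbT.
  have [a4|a4] := leP (a / 2) 2.
    have [->|a2] := eqVneq (a / 2) 0; first by rewrite sin0 oppr0.
    have := @sin2_gt0 R (a / 2).
    case: (ltgtP (a / 2) 2) a4 => // [a4 _|a4 _]; last first.
      by move=> _; rewrite a4; have := sin_geN1 (2:R); lra.
    have -> : 0 < a / 2 by rewrite lt_neqAle eq_sym a2 divr_ge0.
    by move=> /(_ isT) h'; apply: le_trans (ltW h'); lra.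
  by have := sin_geN1 (a/2); lra.
have : sin (a / 2) ^+ 2 <= (a / 2) ^+ 2.
  by rewrite -[X in X <= _]real_normK ?num_real// ler_pXn2r// nnegrE divr_ge0.
by rewrite expr2 expr2; nra.
Qed.

Lemma chord_geodS2 y z : enorm (S2val y - S2val z) = 2 * sin (geodS2 y z / 2).
Proof.
have /andP[d0 dpi] := geodS2_itv y z.
have s0 : 0 <= sin (geodS2 y z / 2) by apply: sin_ge0_pi; lra.
apply/eqP; rewrite -(@eqrXn2 _ 2)// ?mulr_ge0// sqr_enorm; apply/eqP.
rewrite !(dotBl, dotBr) !S2_dot [dot z y]dotC -cos_geodS2.
have dE : geodS2 y z = geodS2 y z / 2 + geodS2 y z / 2 by lra.
by rewrite {1 2}dE cosD -!expr2 cos2sin2; ring.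
Qed.

Lemma chord_le_geodS2 y z : enorm (S2val y - S2val z) <= geodS2 y z.
Proof.
rewrite chord_geodS2; have d0 := geodS2_ge0 y z.
by have := @sin_le_id (geodS2 y z / 2); rewrite divr_ge0// => /(_ isT); lra.
Qed.

(** Jordan's inequality with a crude constant; it only serves to convert closeness
    of vectors into closeness of directions. *)
Lemma geodS2_le_chord y z : geodS2 y z <= 4 * enorm (S2val y - S2val z).
Proof.
rewrite chord_geodS2; have /andP[d0 dpi] := geodS2_itv y z.
set a := geodS2 y z / 2; have -> : geodS2 y z = 2 * a by rewrite /a; lra.
have p2 : pi / 2 <= 2 :> R := ltW (pihalf_lt2 R).
have a0 : 0 <= a by rewrite /a divr_ge0.
have api : a <= pi / 2 by rewrite /a; lra.
have s0 : 0 <= sin a by apply: sin_ge0_pi; have := @pi_gt0 R; lra.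
have [c2|c2] := leP (1 / 2) (cos a).
  have : a * cos a <= sin a by apply: mulr_cos_le_sin; have := @pi_gt0 R; lra.
  by nra.
have c0 : 0 <= cos a by apply: cos_ge0_pihalf; have := @pi_gt0 R; lra.
have := cos2Dsin2 a; rewrite !expr2; nra.
Qed.

Lemma geodS2_unitv_le y (v : 'rV[R]_3) : enorm v = 1 ->
  geodS2 y (unitv v) <= 4 * enorm (S2val y - v).
Proof. by move=> v1; apply: le_trans (geodS2_le_chord _ _) _; rewrite unitv_unit. Qed.

Lemma geodS2_unitv2_le (u v : 'rV[R]_3) : enorm u = 1 -> enorm v = 1 ->
  geodS2 (unitv u) (unitv v) <= 4 * enorm (u - v).
Proof. by move=> u1 v1; apply: le_trans (geodS2_unitv_le _ v1) _; rewrite unitv_unit. Qed.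

(** The cubic error makes chords and arcs interchangeable in sums over fine
    partitions. *)
Lemma geodS2_le_chord_cube y z :
  geodS2 y z <= enorm (S2val y - S2val z) + 8 * enorm (S2val y - S2val z) ^+ 3.
Proof.
have h4 := geodS2_le_chord y z; have /andP[d0 dpi] := geodS2_itv y z.
set d := geodS2 y z in h4 d0 dpi *; set r := enorm _ in h4 *.
have h : d - d ^+ 3 / 8 <= r.
  rewrite /r chord_geodS2 -/d.
  have d20 : 0 <= d / 2 by lra.
  have := @cos_ge_quadratic (d / 2) d20.
  have : d / 2 * cos (d / 2) <= sin (d / 2) by apply: mulr_cos_le_sin; lra.
  have -> : (d / 2) ^+ 2 / 2 = d ^+ 2 / 8 by field.
  move=> h1 h2; have : d / 2 * (1 - d ^+ 2 / 8) <= d / 2 * cos (d / 2) by rewrite ler_wpM2l.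
  have -> : d / 2 * (1 - d ^+ 2 / 8) = (d - d ^+ 3 / 8) / 2 by field.
  by lra.
have : d ^+ 3 <= (4 * r) ^+ 3 by rewrite ler_pXn2r// nnegrE// (le_trans d0).
by rewrite exprMn; lra.
Qed.

Lemma geodS2_eq0 y z : geodS2 y z = 0 -> y = z.
Proof.
move=> yz; apply: val_inj; apply/eqP; rewrite -subr_eq0; apply/eqP/enorm0_eq0.
by apply/eqP; rewrite eq_le enorm_ge0 andbT -yz chord_le_geodS2.
Qed.

Lemma RP2P p : exists y, p = cls y.
Proof. by exists (repr p); rewrite /cls reprK. Qed.

Lemma cls_antipode y : cls (antipode y) = cls y.
Proof. by apply/clsP; right. Qed.

Lemma geodRP2_le y z : geodRP2 (cls y) (cls z) <= geodS2 y z.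
Proof. by rewrite geodRP2_cls ge_min lexx. Qed.

Lemma geodRP2E y z : geodRP2 (cls y) (cls z) = Num.min (geodS2 y z) (pi - geodS2 y z).
Proof. by rewrite geodRP2_cls geodS2_antipode. Qed.

Lemma geodRP2_small y z : geodS2 y z <= pi / 2 ->
  geodRP2 (cls y) (cls z) = geodS2 y z.
Proof. by move=> h; rewrite geodRP2E min_l//; lra. Qed.

Lemma geodRP2_le_pihalf p q : geodRP2 p q <= pi / 2.
Proof.
have [y ->] := RP2P p; have [z ->] := RP2P q; rewrite geodRP2E ge_min.
by have [//|/ltW h] := leP (geodS2 y z) (pi / 2); apply/orP; right; lra.
Qed.

(** Of the two unit vectors on a line, one realizes the distance; the metric of the
    projective plane is thereby reduced to that of the sphere. *)
Lemma geodRP2_lift y q : exists2 z, q = cls z & geodRP2 (cls y) q = geodS2 y z.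
Proof.
have [z ->] := RP2P q; rewrite geodRP2_cls.
by case: (leP (geodS2 y z)) => h; [exists z|exists (antipode z); rewrite ?cls_antipode].
Qed.

Lemma geodRP2_ge0 p q : 0 <= geodRP2 p q.
Proof.
have [y ->] := RP2P p; have [z _ ->] := geodRP2_lift y q; exact: geodS2_ge0.
Qed.

Lemma geodRP2C p q : geodRP2 p q = geodRP2 q p.
Proof.
have [y ->] := RP2P p; have [z ->] := RP2P q.
by rewrite !geodRP2E geodS2C.
Qed.

Lemma geodRP2xx p : geodRP2 p p = 0.
Proof.
apply/eqP; rewrite eq_le geodRP2_ge0 andbT; have [y ->] := RP2P p.
by rewrite (le_trans (geodRP2_le _ _))// geodS2xx.
Qed.

Lemma geodRP2_triangle q p r : geodRP2 p r <= geodRP2 p q + geodRP2 q r.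
Proof.
have [x ->] := RP2P q; have [y -> e1] := geodRP2_lift x p; have [z -> ->] := geodRP2_lift x r.
rewrite geodRP2C in e1; rewrite e1 (le_trans (geodRP2_le _ _))// [geodS2 x y]geodS2C.
exact: geodS2_triangle.
Qed.

Lemma geodRP2_eq0 p q : geodRP2 p q = 0 -> p = q.
Proof.
have [y ->] := RP2P p; have [z -> ->] := geodRP2_lift y q.
by move=> /geodS2_eq0 ->.
Qed.

(** Choose representatives close to [y] and [z]; the cross product is bilinear and
    normalization at most doubles distances to a unit vector. *)
Lemma crossRP2_near p q y z (e : R) : dot y z = 0 -> e <= 1 / 16 ->
  geodRP2 (cls y) p <= e -> geodRP2 (cls z) q <= e ->
  geodRP2 (cls (unitv (cross y z))) (crossRP2 p q) <= 16 * e.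
Proof.
move=> yz0 e16; have [y' -> ->] := geodRP2_lift y p; have [z' -> ->] := geodRP2_lift z q.
move=> /(le_trans (chord_le_geodS2 _ _)) hy /(le_trans (chord_le_geodS2 _ _)) hz.
have n1 : enorm (cross y z) = 1.
  by apply/eqP; rewrite -(@eqrXn2 _ 2)// sqr_enorm binet_cauchy !S2_dot yz0; apply/eqP; ring.
have dE : enorm (cross y' z' - cross y z) <= 2 * e.
  have -> : cross y' z' - cross y z = cross (S2val y' - S2val y) z' + cross y (S2val z' - S2val z).
    by rewrite crossBl crossBr addrA subrK.
  apply: le_trans (enormD _ _) _.
  rewrite mulr_natl mulr2n lerD// (le_trans (enorm_cross _ _))// S2_enorm ?mulr1 ?mul1r edistC//.
have yz'0 : cross y' z' != 0.
  apply/eqP => h; move: dE; rewrite h sub0r enormN n1; lra.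
rewrite crossRP2_cls// (le_trans (geodRP2_le _ _))// (le_trans (geodS2_le_chord _ _))//.
rewrite edistC; have := unitv_lip (enorm1_neq0 n1) yz'0; rewrite n1 divr1; lra.
Qed.

End Geodesic.

(** * Uniform differentiability on a segment *)

Section UniformCalculus.
Context {R : realType}.
Variable L : R.
Hypothesis L_gt0 : 0 < L.
Local Notation I := `[0, L].
Local Notation J := `[0, L]%classic.

(** Thresholds are quantified with the filter [0^'+], so that several of them combine
    by intersection. *)
Definition ucont (f : R -> 'rV[R]_3) := forall e : R, 0 < e ->
  \forall d \near 0^'+, {in I &, forall x y, `|y - x| <= d -> enorm (f y - f x) <= e}.

(** The remainder is uniform in both points, in either order: this covers one-sided
    derivatives at the end points and makes the continuity of the derivative
    automatic. *)
Definition udiff (f f' : R -> 'rV[R]_3) := forall e : R, 0 < e ->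
  \forall d \near 0^'+, {in I &, forall x y, `|y - x| <= d ->
    enorm (f y - f x - (y - x) *: f' x) <= e * `|y - x|}.

Definition pdiff (f f' : R -> 'rV[R]_3) := forall e : R, 0 < e ->
  {in I, forall x, \forall d \near 0^'+, {in I, forall y, `|y - x| <= d ->
    enorm (f y - f x - (y - x) *: f' x) <= e * `|y - x|}}.

Definition sucont (f : R -> R) := forall e : R, 0 < e ->
  \forall d \near 0^'+, {in I &, forall x y, `|y - x| <= d -> `|f y - f x| <= e}.

Definition sudiff (f f' : R -> R) := forall e : R, 0 < e ->
  \forall d \near 0^'+, {in I &, forall x y, `|y - x| <= d ->
    `|f y - f x - (y - x) * f' x| <= e * `|y - x|}.

Lemma near0_witness (P : R -> Prop) : (\forall d \near 0^'+, P d) -> exists2 d, 0 < d & P d.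
Proof.
move=> h; near (0 : R)^'+ => d; exists d; near: d => //; exact: nbhs_right_gt.
Unshelve. all: by end_near. Qed.

Lemma near0_le (d : R) (P : R -> Prop) : 0 < d -> (forall e, 0 < e -> e <= d -> P e) ->
  \forall e \near 0^'+, P e.
Proof.
move=> d0 h; near=> e; apply: h; near: e; [exact: nbhs_right_gt|exact: nbhs_right_le].
Unshelve. all: by end_near. Qed.

Lemma cvg_within_eps (U : pseudoMetricNormedZmodType R) (f : R -> U) x : x \in I ->
  {within J, continuous f} -> forall e : R, 0 < e ->
  \forall d \near 0^'+, {in I, forall y, `|y - x| <= d -> `|f y - f x| <= e}.
Proof.
move=> xI /subspace_continuousP cf e e0; have := cf x xI.
move=> /cvgrPdist_le /(_ e e0) h.
have {h} : \forall y \near x, y \in I -> `|f x - f y| <= e by exact: h.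
move=> /nbhs_ballP [d /= d0 h]; apply: (@near0_le (d / 2)); first by rewrite divr_gt0.
move=> d' d'0 d'd y yI yx; rewrite distrC; apply: h => //.
rewrite /ball /= distrC; lra.
Qed.

Lemma eps_within_cvg (U : pseudoMetricNormedZmodType R) (f : R -> U) :
  (forall x, x \in I -> forall e : R, 0 < e ->
    \forall d \near 0^'+, {in I, forall y, `|y - x| <= d -> `|f y - f x| <= e}) ->
  {within J, continuous f}.
Proof.
move=> h; apply/subspace_continuousP => x Ix.
apply/cvgrPdist_le => e e0.
have [d d0 hd] := near0_witness (h x Ix e e0).
suff : \forall y \near x, y \in I -> `|f x - f y| <= e by [].
apply/nbhs_ballP; exists d => //= y xy yI.
by rewrite distrC; apply: hd => //; rewrite distrC ltW.
Qed.

(** Compactness of the segment, in its near-covering form, makes a local threshold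
    uniform. *)
Lemma heine_near (P : R -> R -> Prop) :
  (forall x, x \in I -> \forall d \near 0^'+, forall x' y, x' \in I -> y \in I ->
     `|x' - x| <= d -> `|y - x| <= d -> P x' y) ->
  \forall d \near 0^'+, {in I &, forall x y, `|y - x| <= d -> P x y}.
Proof.
move=> h; have /compact_near_coveringP cpt := @segment_compact R 0 L.
have := cpt R (0 : R)^'+ (fun d x => {in I, forall y, `|y - x| <= d -> x \in I -> P x y}) _.
move=> /(_ _) H; apply: filterS (H _) => [d Hd x y xI yI xy|x Ix]; first exact: Hd.
have [d d0 hd] := near0_witness (h x Ix).
exists ([set x' | `|x' - x| <= d / 2], [set d' | d' <= d / 2]) => /=.
  split; last by apply: nbhs_right_le; rewrite divr_gt0.
  apply/nbhs_ballP; exists (d / 2); rewrite /= ?divr_gt0// => y.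
  by rewrite /ball /= distrC => /ltW.
move=> [x' d'] /= [x'd d'd] y yI yx' x'I; apply: hd => //; first by lra.
by have := ler_distD x' y x; lra.
Qed.

Lemma ucont_within (f : R -> 'rV[R]_3) : {within J, continuous f} -> ucont f.
Proof.
move=> cf e e0; apply: heine_near => x xI.
have e4 : 0 < e / 4 by rewrite divr_gt0.
apply: filterS (cvg_within_eps xI cf e4) => d hd x' y x'I yI hx' hy.
have coord z : z \in I -> `|z - x| <= d -> enorm (f z - f x) <= e / 2.
  move=> zI hz; apply: (@le_trans _ _ (2 * (e / 4))); last by lra.
  apply: enorm_le_coord => i; apply: le_trans (hd z zI hz).
  by rewrite [X in _ <= X]mx_normrE; apply: (@le_bigmax _ _ _ 0 _ (0, i)).
have := edist_trans (f x) (f y) (f x'); have := coord _ x'I hx'; have := coord _ yI hy.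
by rewrite [enorm (f x - f x')]edistC; lra.
Qed.

Lemma sucont_within (f : R -> R) : sucont f -> {within J, continuous f}.
Proof.
move=> uf; apply: eps_within_cvg => x xI e e0.
by apply: filterS (uf e e0) => d hd y yI; apply: hd.
Qed.

Lemma sucont_eq (f g : R -> R) : {in I, f =1 g} -> sucont f -> sucont g.
Proof.
move=> fg uf e e0; apply: filterS (uf e e0) => d hd x y xI yI xy.
by rewrite -!fg//; apply: hd.
Qed.

Lemma itv_convex x y z : x \in I -> y \in I -> x <= z <= y -> z \in I.
Proof.
by rewrite !in_itv/= => /andP[? ?] /andP[? ?] /andP[? ?]; apply/andP; split; lra.
Qed.

Lemma sucont_enorm f : ucont f -> sucont (fun x => enorm (f x)).
Proof.
move=> uf e e0; apply: filterS (uf e e0) => d hd x y xI yI xy.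
exact: le_trans (norm_enormB _ _) (hd _ _ xI yI xy).
Qed.

Lemma ucont_bounded f : ucont f -> exists2 M, 0 < M & {in I, forall x, enorm (f x) <= M}.
Proof.
move=> uf; have [] := @EVT_max R (fun x => enorm (f x)) 0 L (ltW L_gt0).
  exact/sucont_within/sucont_enorm.
move=> c cI h; exists (enorm (f c) + 1); first by rewrite ltr_wpDl.
by move=> x xI; apply: le_trans (h x xI) _; rewrite lerDl.
Qed.

(** Adding the expansions at [x] and at [y] leaves the increment of the derivative. *)
Lemma udiff_ucont_deriv f f' : udiff f f' -> ucont f'.
Proof.
move=> df e e0; apply: filterS (df (e / 2) _); last by rewrite divr_gt0.
move=> d hd x y xI yI xy.
have [->|yx] := eqVneq y x; first by rewrite subrr enorm0 ltW.
have h1 := hd x y xI yI xy.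
have h2 := hd y x yI xI; rewrite distrC in h2; have {}h2 := h2 xy.
have : enorm ((y - x) *: (f' y - f' x)) <= e * `|y - x|.
  have -> : (y - x) *: (f' y - f' x) =
     (f y - f x - (y - x) *: f' x) + (f x - f y - (x - y) *: f' y).
    by apply: row3P; split; rewrite !mxE; ring.
  by have := enormD (f y - f x - (y - x) *: f' x) (f x - f y - (x - y) *: f' y); lra.
by rewrite enormZ mulrC ler_pM2r// normr_gt0 subr_eq0.
Qed.

Lemma udiff_ucont f f' : udiff f f' -> ucont f.
Proof.
move=> df; have [M M0 hM] := ucont_bounded (udiff_ucont_deriv df).
move=> e e0; have dM : 0 < e / (1 + M) by rewrite divr_gt0// addr_gt0.
near=> d => x y xI yI xy.
have h : enorm (f y - f x - (y - x) *: f' x) <= 1 * `|y - x|.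
  by move: x y xI yI xy; near: d; apply: df.
have de : d <= e / (1 + M) by near: d; exact: nbhs_right_le.
have := enorm_le_dist (f y - f x) ((y - x) *: f' x).
rewrite enormZ; have := hM x xI; have := normr_ge0 (y - x) => n0 fM h1.
have : `|y - x| * enorm (f' x) <= `|y - x| * M by rewrite ler_wpM2l.
have : `|y - x| * (1 + M) <= e by rewrite -ler_pdivlMr ?addr_gt0// (le_trans xy).
lra.
Unshelve. all: by end_near. Qed.

Lemma udiff_pdiff f f' : udiff f f' -> pdiff f f'.
Proof.
by move=> df e e0 x xI; apply: filterS (df e e0) => d hd y yI; apply: hd.
Qed.

Lemma udiff_cross f f' g g' : udiff f f' -> udiff g g' ->
  udiff (fun x => cross (f x) (g x)) (fun x => cross (f' x) (g x) + cross (f x) (g' x)).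
Proof.
move=> df dg e e0.
have [Mf Mf0 hMf] := ucont_bounded (udiff_ucont df).
have [Mg Mg0 hMg] := ucont_bounded (udiff_ucont dg).
have [Mf' Mf'0 hMf'] := ucont_bounded (udiff_ucont_deriv df).
pose M := Mf + Mg + Mf'; have M0 : 0 < M by rewrite !addr_gt0.
have e1 : 0 < e / (3 * M) by rewrite divr_gt0// mulr_gt0.
apply: filterS3 (df _ e1) (dg _ e1) (udiff_ucont dg e1) => d h1 h2 h3 x y xI yI xy.
have {}h1 := h1 _ _ xI yI xy; have {}h2 := h2 _ _ xI yI xy; have {}h3 := h3 _ _ xI yI xy.
set h := y - x in h1 h2 h3 *.
have -> : cross (f y) (g y) - cross (f x) (g x)
     - h *: (cross (f' x) (g x) + cross (f x) (g' x)) =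
   cross (f y - f x - h *: f' x) (g y) + cross (h *: f' x) (g y - g x)
     + cross (f x) (g y - g x - h *: g' x).
  by apply: row3P; split; rewrite !(crossE, mxE); ring.
have -> : e * `|h| = e / (3 * M) * `|h| * M + e / (3 * M) * `|h| * M + e / (3 * M) * `|h| * M.
  by field; rewrite gt_eqF.
apply: le_trans (enormD _ _) _; apply: lerD; first apply: le_trans (enormD _ _) (lerD _ _).
- apply: le_trans (enorm_cross _ _) (ler_pM _ _ h1 _) => //.
  by apply: le_trans (hMg y yI) _; rewrite /M; lra.
- apply: le_trans (enorm_cross _ _) _; rewrite enormZ.
  have -> : e / (3 * M) * `|h| * M = `|h| * (M * (e / (3 * M))) by ring.
  rewrite -mulrA ler_wpM2l// ler_pM//.
  by apply: le_trans (hMf' x xI) _; rewrite /M; lra.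
- apply: le_trans (enorm_cross _ _) _; rewrite [X in _ <= X]mulrC.
  by apply: ler_pM => //; apply: le_trans (hMf x xI) _; rewrite /M; lra.
Qed.

Lemma udiff_unitv f f' m : 0 < m -> {in I, forall x, m <= enorm (f x)} -> udiff f f' ->
  udiff (fun x => unitv (f x)) (fun x => (enorm (f x))^-1 *:
     (f' x - dot (f' x) (unitv (f x)) *: (unitv (f x) : 'rV[R]_3))).
Proof.
move=> m0 fm df e e0.
have [M M0 hM] := ucont_bounded (udiff_ucont_deriv df).
have e1 : 0 < e * m / 4 by rewrite divr_gt0// mulr_gt0.
pose q := e * m ^+ 2 / (8 * (1 + M) ^+ 2).
have q0 : 0 < q by rewrite divr_gt0 ?mulr_gt0 ?exprn_gt0 ?addr_gt0.
apply: filterS3 (df _ e1) (df _ ltr01) (nbhs_right_le q0) => d h1 h2 dq x y xI yI xy.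
have {}h1 := h1 _ _ xI yI xy; have {}h2 := h2 _ _ xI yI xy.
have fx0 : 0 < enorm (f x) by apply: lt_le_trans (fm x xI).
have nz z : z \in I -> f z != 0.
  by move=> zI; apply/eqP => fz; have := fm z zI; rewrite fz enorm0; lra.
set h := y - x in h1 h2 xy *.
have fyx : enorm (f y - f x) <= (1 + M) * `|h|.
  apply: le_trans (enorm_le_dist _ (h *: f' x)) _; rewrite enormZ.
  have : `|h| * enorm (f' x) <= `|h| * M by rewrite ler_wpM2l ?hM.
  by lra.
have T := unitv_taylor (nz x xI) (nz y yI).
set u : 'rV[R]_3 := unitv (f x) in T *; set w : 'rV[R]_3 := unitv (f y) in T *.
set a := enorm (f x) in fx0 T *.
have -> : w - u - h *: (a^-1 *: (f' x - dot (f' x) u *: u)) =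
   (w - u - a^-1 *: (f y - f x - dot (f y - f x) u *: u)) +
   a^-1 *: ((f y - f x - h *: f' x) - dot (f y - f x - h *: f' x) u *: u).
  by apply: row3P; split; rewrite !dotE !mxE; field; rewrite gt_eqF.
apply: le_trans (enormD _ _) _.
have -> : e * `|h| = e / 2 * `|h| + e / 2 * `|h| by field.
apply: lerD.
  apply: le_trans T _; rewrite ler_pdivrMr ?exprn_gt0//.
  apply: (@le_trans _ _ (4 * ((1 + M) * `|h|) ^+ 2)).
    rewrite ler_pM2l// ler_pXn2r// nnegrE// mulr_ge0//; lra.
  apply: (@le_trans _ _ (e / 2 * `|h| * m ^+ 2)); last first.
    apply: ler_wpM2l; first by rewrite mulr_ge0// divr_ge0// ltW.
    by rewrite ler_pXn2r ?fm// nnegrE ltW.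
  have -> : e / 2 * `|h| * m ^+ 2 = `|h| * (4 * (1 + M) ^+ 2 * q).
    by rewrite /q; field; lra.
  have -> : 4 * ((1 + M) * `|h|) ^+ 2 = `|h| * (4 * (1 + M) ^+ 2 * `|h|) by ring.
  rewrite ler_wpM2l// ler_wpM2l//; last exact: le_trans xy dq.
  by rewrite mulr_ge0// exprn_ge0//; lra.
rewrite enormZ gtr0_norm ?invr_gt0// ler_pdivrMl// [X in _ <= X]mulrC.
set r := f y - f x - h *: f' x in h1 *.
apply: (@le_trans _ _ (2 * enorm r)).
  apply: le_trans (enormB _ _) _; rewrite enormZ S2_enorm mulr1.
  by have := norm_dot_le r u; rewrite S2_enorm mulr1; lra.
apply: (@le_trans _ _ (e / 2 * `|h| * m)).
  by have -> : e / 2 * `|h| * m = 2 * (e * m / 4 * `|h|); [field|rewrite ler_pM2l].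
by apply: ler_wpM2l; rewrite ?fm// mulr_ge0// divr_ge0// ltW.
Qed.

End UniformCalculus.

(** * Taylor expansions *)

Section Taylor.
Context {R : realType}.
Variable L : R.
Hypothesis L_gt0 : 0 < L.
Local Notation I := `[0, L].
Local Notation J := `[0, L]%classic.

Lemma derivable_in_pdiff (f : R -> 'rV[R]_3) :
  {in I, forall x, derivable_in 0 L f x} -> pdiff L f (deriv_in 0 L f).
Proof.
move=> df e e0 x xI; have /cvgrPdist_le := df x xI.
have e2 : 0 < e / 2 by rewrite divr_gt0.
move=> /(_ _ e2) h.
have {h} : \forall y \near x, y != x -> y \in I ->
    `|deriv_in 0 L f x - diff_quot f x y| <= e / 2.
  by move: h; rewrite near_withinE => h; rewrite near_withinE in h;
    apply: filterS h => y hy yx yI; apply: hy.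
move=> /nbhs_ballP [d /= d0 h]; apply: (@near0_le _ (d / 2)); first by rewrite divr_gt0.
move=> d' d'0 d'd y yI yx.
have [->|yneq] := eqVneq y x; first by rewrite !subrr scale0r subr0 enorm0 normr0 mulr0.
have {h} : `|deriv_in 0 L f x - diff_quot f x y| <= e / 2.
  by apply: h => //; rewrite /ball /= distrC; lra.
move=> h.
have -> : f y - f x - (y - x) *: deriv_in 0 L f x =
    (y - x) *: (diff_quot f x y - deriv_in 0 L f x).
  by rewrite scalerBr /diff_quot scalerA mulfV ?scale1r// subr_eq0.
rewrite enormZ mulrC ler_wpM2r// edistC.
apply: (@le_trans _ _ (2 * (e / 2))); last by lra.
apply: enorm_le_coord => i; apply: le_trans h.
by rewrite [X in _ <= X]mx_normrE; apply: (@le_bigmax _ _ _ 0 _ (0, i)).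
Qed.

Lemma proper_within_dnbhs x : x \in I -> ProperFilter (within J x^').
Proof.
move=> xI; apply: Build_ProperFilter_ex => P.
rewrite /within /dnbhs /= => h.
have {h} : \forall y \near x, y != x -> y \in I -> P y.
  by move: h; rewrite near_withinE => h; apply: filterS h => y hy yx yI; apply: hy.
move=> /nbhs_ballP [d /= d0 h].
move: (xI); rewrite in_itv/= => /andP[x0 xL].
pose s := Num.min (d / 2) (L / 2).
have s0 : 0 < s by rewrite lt_min !divr_gt0.
have sd : s <= d / 2 by rewrite ge_min lexx.
have sL : s <= L / 2 by rewrite ge_min lexx orbT.
have [hx|hx] := leP x (L / 2).
  exists (x + s); apply: h.
  - by rewrite /ball /= opprD addNKr normrN gtr0_norm//; lra.
  - by rewrite -subr_eq0 addrAC subrr add0r gt_eqF.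
  - by rewrite in_itv/=; apply/andP; split; lra.
exists (x - s); apply: h.
- by rewrite /ball /= opprB addrC subrK gtr0_norm//; lra.
- by rewrite -subr_eq0 addrAC subrr add0r oppr_eq0 gt_eqF.
- by rewrite in_itv/=; apply/andP; split; lra.
Qed.

(** The segment has no isolated point, end points included. *)
Lemma near_point (x d : R) : x \in I -> 0 < d ->
  exists y, [/\ y \in I, 0 < `|y - x| & `|y - x| <= d].
Proof.
move=> xI d0; have PF := proper_within_dnbhs xI.
have : \forall y \near within J x^', [/\ y \in I, 0 < `|y - x| & `|y - x| <= d].
  rewrite near_withinE near_withinE.
  suff : \forall y \near x, y != x -> y \in I ->
      [/\ y \in I, 0 < `|y - x| & `|y - x| <= d] by [].
  apply/nbhs_ballP; exists d => //= y; rewrite /ball /= distrC => /ltW yx yneq yI.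
  by split; rewrite // normr_gt0 subr_eq0.
by move=> /filter_ex.
Qed.

Lemma pdiff_deriv_in f f' x : pdiff L f f' -> x \in I -> deriv_in 0 L f x = f' x.
Proof.
move=> df xI; have PF := proper_within_dnbhs xI.
apply: (@cvg_lim _ (@norm_hausdorff _ 'rV[R]_3)).
apply/cvgrPdist_le => e e0; have [d d0 hd] := near0_witness (df e e0 x xI).
rewrite /= near_withinE near_withinE.
suff : \forall y \near x, y != x -> y \in I -> `|f' x - diff_quot f x y| <= e by [].
apply/nbhs_ballP; exists d => //= y; rewrite /ball /= distrC => /ltW yx yneq yI.
have := hd y yI yx.
have -> : f y - f x - (y - x) *: f' x = (y - x) *: (diff_quot f x y - f' x).
  by rewrite scalerBr /diff_quot scalerA mulfV ?scale1r// subr_eq0.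
rewrite enormZ mulrC ler_pM2r ?normr_gt0 ?subr_eq0// => h.
rewrite distrC [X in X <= _]mx_normrE; apply/bigmax_leP; split; first exact: ltW.
by move=> [i j] _; rewrite (ord1 i) /=; apply: le_trans (enorm_coord _ _) h.
Qed.

Lemma pdiff_coord_cont f f' i : pdiff L f f' -> {within J, continuous (fun x => f x 0 i)}.
Proof.
move=> df; apply: eps_within_cvg => x xI e e0.
pose M := 1 + enorm (f' x); have M0 : 0 < M by rewrite ltr_pwDl.
have eM : 0 < e / M by rewrite divr_gt0.
near=> d => y yI yx.
have h : enorm (f y - f x - (y - x) *: f' x) <= 1 * `|y - x|.
  by move: y yI yx; near: d; apply: df.
have de : d <= e / M by near: d; exact: nbhs_right_le.
have -> : f y 0 i - f x 0 i = (f y - f x) 0 i by rewrite !mxE.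
apply: le_trans (enorm_coord _ _) _.
have := enorm_le_dist (f y - f x) ((y - x) *: f' x); rewrite enormZ => h2.
have : `|y - x| * M <= e by rewrite -ler_pdivlMr// (le_trans yx).
by rewrite /M; lra.
Unshelve. all: by end_near. Qed.

Lemma pdiff_coord_derive f f' i x : pdiff L f f' -> x \in `]0, L[ ->
  is_derive x 1 (fun y => f y 0 i) (f' x 0 i).
Proof.
move=> df xI; have xI' : x \in I by apply: subset_itv_oo_cc xI.
move: xI; rewrite in_itv/= => /andP[x0 xL].
suff H : (fun h : R => h^-1 *: (((fun y => f y 0 i) \o shift x) (h *: 1) - f x 0 i)) @ 0^'
    --> f' x 0 i.
  by apply: DeriveDef; [apply/cvg_ex; exists (f' x 0 i)|exact: cvg_lim].
apply/cvgrPdist_le => e e0; have [d d0 hd] := near0_witness (df e e0 x xI').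
rewrite /= near_withinE.
pose s := Num.min d (Num.min x (L - x)).
have s0 : 0 < s by rewrite !lt_min d0 x0 subr_gt0.
apply/nbhs_ballP; exists s => //= h; rewrite /ball /= sub0r normrN.
rewrite !lt_min => /and3P[hd' hx hL] h0.
have hxI : x + h \in I.
  by rewrite in_itv/=; move: hx hL; rewrite !ltr_norml => /andP[? ?] /andP[? ?]; apply/andP; split; lra.
have := hd (x + h) hxI; rewrite addrAC subrr add0r => /(_ (ltW hd')) H.
have := le_trans (enorm_coord _ i) H; rewrite !mxE => {}H.
have -> : (h%:A + x : R) = x + h by rewrite addrC [h%:A]mulr1.
have -> : f' x 0 i - h^-1 *: (f (x + h) 0 i - f x 0 i) =
   - (h^-1 * (f (x + h) 0 i - f x 0 i - h * f' x 0 i)).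
  by rewrite [_ *: _](_ : _ = h^-1 * (f (x + h) 0 i - f x 0 i))//; field.
by rewrite normrN normrM normfV mulrC ler_pdivrMr ?normr_gt0.
Qed.

(** A bound on the derivative of the remainder integrates to a bound on the
    remainder: one application per order of the expansion. *)
Lemma taylor_step f f' (x y : R) (a b c : 'rV[R]_3) (M : R) : pdiff L f f' ->
  x \in I -> y \in I ->
  {in I, forall z, `|z - x| <= `|y - x| ->
    enorm (f' z - (a + (z - x) *: b + ((z - x) ^+ 2 / 2) *: c)) <= M} ->
  enorm (f y - (f x + (y - x) *: a + ((y - x) ^+ 2 / 2) *: b + ((y - x) ^+ 3 / 6) *: c))
    <= 2 * (M * `|y - x|).
Proof.
move=> df xI yI hM; apply: enorm_le_coord => i.
pose p (z : R) : R := (z - x) * a 0 i + (z - x) ^+ 2 / 2 * b 0 i + (z - x) ^+ 3 / 6 * c 0 i.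
pose p' (z : R) : R := a 0 i + (z - x) * b 0 i + (z - x) ^+ 2 / 2 * c 0 i.
have dp (z : R) : is_derive z 1 p (p' z).
  by apply: is_derive_eq; rewrite /GRing.scale /= /p'; field.
have cp : continuous p.
  by move=> w; apply/differentiable_continuous/derivable1_diffP; case: (dp w).
pose g (z : R) : R := f z 0 i - p z; pose g' (z : R) : R := f' z 0 i - p' z.
have dg z : z \in `]0, L[ -> is_derive z 1 g (g' z).
  by move=> zI; have := pdiff_coord_derive i df zI => dfz; apply: is_deriveB.
have cg : {within J, continuous g}.
  apply: within_continuousB; first exact: pdiff_coord_cont df.
  exact: continuous_subspaceT.
have key u v : u \in I -> v \in I -> u <= v ->
   {in `[u, v], forall z, `|g' z| <= M} -> `|g v - g u| <= M * (v - u).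
  rewrite !in_itv/= => /andP[u0 uL] /andP[v0 vL] uv hg.
  have dg' z : z \in `]u, v[ -> is_derive z 1 g (g' z).
    by rewrite in_itv/= => /andP[uz zv]; apply: dg; rewrite in_itv/=; apply/andP; split; lra.
  have cg' : {within `[u, v], continuous g}.
    by apply: continuous_subspaceW cg => z /=; rewrite !in_itv/= => /andP[? ?]; apply/andP; split; lra.
  have [z zuv ->] := MVT_segment uv dg' cg'.
  by rewrite normrM [X in _ * X]ger0_norm ?subr_ge0// ler_wpM2r ?subr_ge0// hg.
have gM z : z \in I -> `|z - x| <= `|y - x| -> `|g' z| <= M.
  move=> zI zxy; have := le_trans (enorm_coord _ i) (hM z zI zxy).
  by rewrite !mxE /g' /p'.
have -> : (f y - (f x + (y - x) *: a + ((y - x) ^+ 2 / 2) *: b + ((y - x) ^+ 3 / 6) *: c)) 0 i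
   = g y - g x.
  by rewrite !mxE /g /p subrr; ring.
move: (xI) (yI); rewrite !in_itv/= => /andP[x0 xL] /andP[y0 yL].
have [xy|/ltW yx] := leP x y.
  rewrite [X in _ * X]ger0_norm ?subr_ge0//; apply: key => // z; rewrite in_itv/= => /andP[xz zy].
  apply: gM; first by rewrite in_itv/=; apply/andP; split; lra.
  by rewrite !ger0_norm ?subr_ge0// lerB.
rewrite distrC [X in _ * X]distrC [X in _ * X]ger0_norm ?subr_ge0//.
apply: key => // z; rewrite in_itv/= => /andP[yz zx].
apply: gM; first by rewrite in_itv/=; apply/andP; split; lra.
by rewrite distrC [X in _ <= X]distrC !ger0_norm ?subr_ge0// lerB.
Qed.

Definition udiff2 (f f' f'' : R -> 'rV[R]_3) := forall e : R, 0 < e ->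
  \forall d \near 0^'+, {in I &, forall x y, `|y - x| <= d ->
    enorm (f y - (f x + (y - x) *: f' x + ((y - x) ^+ 2 / 2) *: f'' x)) <= e * `|y - x| ^+ 2}.

Definition udiff3 (f f' f'' f''' : R -> 'rV[R]_3) := forall e : R, 0 < e ->
  \forall d \near 0^'+, {in I &, forall x y, `|y - x| <= d ->
    enorm (f y - (f x + (y - x) *: f' x + ((y - x) ^+ 2 / 2) *: f'' x
                  + ((y - x) ^+ 3 / 6) *: f''' x)) <= e * `|y - x| ^+ 3}.

Lemma pdiff_udiff f f' : pdiff L f f' -> ucont L f' -> udiff L f f'.
Proof.
move=> df uf' e e0; have e2 : 0 < e / 2 by rewrite divr_gt0.
apply: filterS (uf' _ e2) => d hd x y xI yI xy.
have := @taylor_step f f' x y (f' x) 0 0 (e / 2) df xI yI.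
rewrite !scaler0 !addr0 opprD addrA => h; apply: le_trans (h _) _; last by lra.
by move=> z zI zxy; rewrite !scaler0 !addr0; apply: hd => //; apply: le_trans xy.
Qed.

Lemma pdiff_udiff2 f f' f'' : pdiff L f f' -> udiff L f' f'' -> udiff2 f f' f''.
Proof.
move=> df uf' e e0; have e2 : 0 < e / 2 by rewrite divr_gt0.
apply: filterS (uf' _ e2) => d hd x y xI yI xy.
have := @taylor_step f f' x y (f' x) (f'' x) 0 (e / 2 * `|y - x|) df xI yI.
rewrite !scaler0 !addr0 => h; apply: le_trans (h _) _; last by rewrite expr2; lra.
move=> z zI zxy; rewrite !scaler0 !addr0 opprD addrA.
apply: le_trans (hd _ _ xI zI (le_trans zxy xy)) _.
by rewrite ler_wpM2l// ltW.
Qed.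

Lemma pdiff_udiff3 f f' f'' f''' : pdiff L f f' -> udiff2 f' f'' f''' -> udiff3 f f' f'' f'''.
Proof.
move=> df uf' e e0; have e2 : 0 < e / 2 by rewrite divr_gt0.
apply: filterS (uf' _ e2) => d hd x y xI yI xy.
have := @taylor_step f f' x y (f' x) (f'' x) (f''' x) (e / 2 * `|y - x| ^+ 2) df xI yI.
move=> h; apply: le_trans (h _) _; last by rewrite [X in _ <= _ * X]exprS expr2; lra.
move=> z zI zxy; apply: le_trans (hd _ _ xI zI (le_trans zxy xy)) _.
by rewrite ler_wpM2l ?ler_pXn2r ?nnegrE// ltW.
Qed.

End Taylor.

(** * Partitions and arc length *)

Section Partition.
Context {R : realType}.
Variables (a b : R) (lam : seq R).
Hypothesis lamP : itv_partition a b lam.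
Local Notation node := (nth b (a :: lam)).

Lemma node_size : node (size lam) = b.
Proof. by case: lamP => _ /eqP <-; rewrite -[X in nth _ _ X]/((size (a :: lam)).-1) nth_last. Qed.

Lemma node_over i : (size lam <= i)%N -> node i = b.
Proof.
rewrite leq_eqVlt => /orP[/eqP <-|h]; first exact: node_size.
by rewrite nth_default.
Qed.

Lemma node_lt i : (i < size lam)%N -> node i < node i.+1.
Proof. by case: lamP => /(pathP b) h _; exact: h. Qed.

Lemma node_homo : {homo node : i j / (i <= j)%N >-> i <= j}.
Proof.
apply: homo_leq => [//|y x z|i]; first exact: le_trans.
by have [/node_lt/ltW //|h] := ltnP i (size lam); rewrite !node_over// (leq_trans h).
Qed.

Lemma node_itv i : node i \in `[a, b].
Proof.
rewrite in_itv/= -{1}[a]/(node 0) node_homo//= -{2}node_size.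
have [h|/ltnW h] := leqP i (size lam); first exact: node_homo.
by rewrite (node_over h) node_size.
Qed.

End Partition.

Section ArcLength.
Context {R : realType}.
Variables (L : R) (c : R -> 'rV[R]_3).
Hypothesis harc : arclength_param 0 L c.
Local Notation I := `[0, L].

Lemma arclength_edist x y : x \in I -> y \in I -> enorm (c y - c x) <= `|y - x|.
Proof.
wlog xy : x y / x <= y => [H|].
  by move=> xI yI; have [h|/ltW h] := leP x y; [exact: H|rewrite edistC distrC; exact: H].
rewrite !in_itv/= => /andP[x0 xL] /andP[y0 yL].
move: xy; rewrite le_eqVlt => /orP[/eqP <-|xy]; first by rewrite !subrr enorm0 normr0.
rewrite ger0_norm ?subr_ge0 ?(ltW xy)// edistC -lee_fin -(harc x0 (ltW xy) yL).
apply: ereal_sup_ubound; exists [:: y]; first by split; rewrite /= ?xy ?eqxx.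
by rewrite big_ord_recl big_ord0 /= addr0.
Qed.

Lemma curve_length_le x y (M : R) : x <= y ->
  {in `[x, y] &, forall p q, p <= q -> enorm (c q - c p) <= M * (q - p)} ->
  (curve_length x y c <= (M * (y - x))%:E)%E.
Proof.
move=> xy h; apply: ge_ereal_sup => _ [lam lamP <-]; rewrite lee_fin.
have -> : M * (y - x) = \sum_(i < size lam) M * (nth y (x :: lam) i.+1 - nth y (x :: lam) i).
  rewrite -mulr_sumr -(big_mkord xpredT (fun i => nth y (x :: lam) i.+1 - nth y (x :: lam) i)).
  by rewrite telescope_sumr// (node_size lamP).
apply: ler_sum => i _; rewrite /edist edistC; apply: h; try exact: node_itv.
exact/ltW/node_lt.
Qed.

(** The chord of a short interval is bounded by its length, which gives speed at most
    1; were the speed less than 1 somewhere, all chords nearby, hence the length of a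
    short arc, would be too small. *)
Lemma unit_speed c' : 0 < L -> udiff L c c' -> {in I, forall x, enorm (c' x) = 1}.
Proof.
move=> L0 dc x xI; apply/eqP; rewrite eq_le; apply/andP; split; apply/ler_addgt0Pr => e e0.
  have [d d0 hd] := near0_witness (dc e e0).
  have [y [yI yx yd]] := near_point L0 xI d0.
  have h1 := hd _ _ xI yI yd; have h2 := arclength_edist xI yI.
  have : enorm ((y - x) *: c' x) <= (1 + e) * `|y - x|.
    have := enorm_le_dist ((y - x) *: c' x) (c y - c x); rewrite [enorm (_ - (c y - c x))]edistC; lra.
  by rewrite enormZ mulrC ler_pM2r.
have e2 : 0 < e / 2 by rewrite divr_gt0.
have [d d0 hd] := near0_witness (filterI (dc _ e2) (udiff_ucont_deriv dc e2)).
move: (xI); rewrite in_itv/= => /andP[x0 xL].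
pose p := Num.max 0 (x - d / 2); pose q := Num.min L (x + d / 2).
have p0 : 0 <= p by rewrite le_max lexx.
have qL : q <= L by rewrite ge_min lexx.
have pq : p < q by rewrite gt_max !lt_min L0; apply/andP; split; apply/andP; split; lra.
have px : x - d / 2 <= p by rewrite le_max lexx orbT.
have qx : q <= x + d / 2 by rewrite ge_min lexx orbT.
have px' : p <= x by rewrite ge_max x0; lra.
have qx' : x <= q by rewrite le_min xL; lra.
have inI z : z \in `[p, q] -> z \in I.
  by rewrite !in_itv/= => /andP[? ?]; apply/andP; split; lra.
have : (curve_length p q c <= ((enorm (c' x) + e) * (q - p))%:E)%E.
  apply: curve_length_le; first exact: ltW.
  move=> u v uI vI uv.
  have dvu : `|v - u| <= d.
    rewrite ger0_norm ?subr_ge0//; move: uI vI; rewrite !in_itv/= => /andP[? ?] /andP[? ?]; lra.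
  have dux : `|u - x| <= d.
    by rewrite ler_norml; move: uI; rewrite in_itv/= => /andP[? ?]; apply/andP; split; lra.
  have [h1 _] := hd; have [_ h2] := hd.
  have {}h1 := h1 _ _ (inI _ uI) (inI _ vI) dvu; have {}h2 := h2 _ _ xI (inI _ uI) dux.
  have := enorm_le_dist (c v - c u) ((v - u) *: c' u); rewrite enormZ.
  have := enorm_le_dist (c' u) (c' x).
  rewrite (ger0_norm (_ : 0 <= v - u)) ?subr_ge0// in h1 *.
  move=> a1 a2; have : (v - u) * enorm (c' u) <= (v - u) * (enorm (c' x) + e / 2).
    by rewrite ler_wpM2l ?subr_ge0//; lra.
  lra.
by rewrite (harc p0 (ltW pq) qL) lee_fin -[X in X <= _]mul1r ler_pM2r// subr_gt0.
Qed.

End ArcLength.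

(** * Primitives of continuous functions *)

Section Primitive.
Context {R : realType}.
Variable L : R.
Hypothesis L_gt0 : 0 < L.
Local Notation I := `[0, L].
Local Notation J := `[0, L]%classic.
Local Notation mu := (@lebesgue_measure R).

Lemma sucont_integrable f x : sucont L f -> x \in I -> mu.-integrable `[0, x] (EFin \o f).
Proof.
move=> uf; rewrite in_itv/= => /andP[x0 xL].
apply: continuous_compact_integrable; first exact: segment_compact.
apply: continuous_subspaceW (sucont_within uf) => z /=; rewrite !in_itv/= => /andP[? ?].
by apply/andP; split; lra.
Qed.

Lemma Rintegral_mean_value f x y : sucont L f -> x \in I -> y \in I -> x <= y ->
  exists2 z, z \in `[x, y] &
    \int[mu]_(l in `[0, y]) f l - \int[mu]_(l in `[0, x]) f l = f z * (y - x).
Proof.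
move=> uf; rewrite !in_itv/= => /andP[x0 xL] /andP[y0 yL] xy.
have LI : L \in I by rewrite in_itv/= lexx ltW.
have intL := sucont_integrable uf LI.
have := sucont_within uf; rewrite (continuous_within_itvP _ L_gt0) => -[cf _ _].
pose F (z : R) : R := \int[mu]_(l in `[0, z]) f l.
have dF z : z \in `]x, y[ -> is_derive z 1 F (f z).
  rewrite in_itv/= => /andP[xz zy]; have zI : z \in `]0, L[.
    by rewrite in_itv/=; apply/andP; split; lra.
  have zL : z < L by move: zI; rewrite in_itv/= => /andP[].
  have z0 : 0 < z by move: zI; rewrite in_itv/= => /andP[].
  have [dz ez] := continuous_FTC1_closed zL intL z0 (cf z zI).
  by split; [exact: dz|rewrite -derive1E; exact: ez].
have cF : {within `[x, y], continuous F}.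
  apply: continuous_subspaceW (parameterized_integral_continuous (ltW L_gt0) intL).
  by move=> z /=; rewrite !in_itv/= => /andP[? ?]; apply/andP; split; lra.
by have [z zxy zE] := MVT_segment xy dF cF; exists z.
Qed.

Lemma sudiff_Rintegral f : sucont L f -> sudiff L (fun x => \int[mu]_(l in `[0, x]) f l) f.
Proof.
move=> uf e e0; apply: filterS (uf e e0) => d hd x y xI yI xy.
have sub u v z : u \in I -> v \in I -> z \in `[u, v] -> z \in I.
  by rewrite !in_itv/= => /andP[? ?] /andP[? ?] /andP[? ?]; apply/andP; split; lra.
have [h|/ltW h] := leP x y.
  have [z zxy ->] := Rintegral_mean_value uf xI yI h.
  rewrite [f z * _]mulrC -mulrBr normrM mulrC ler_wpM2r//; apply: hd => //; first exact: sub zxy.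
  move: zxy xy; rewrite in_itv/= => /andP[xz zy]; rewrite !ger0_norm ?subr_ge0//; lra.
have [z zxy zE] := Rintegral_mean_value uf yI xI h.
move/(congr1 (@GRing.opp _)): zE; rewrite opprB => ->.
have -> : - (f z * (x - y)) - (y - x) * f x = (y - x) * (f z - f x) by ring.
rewrite normrM mulrC ler_wpM2r//; apply: hd => //; first exact: sub zxy.
move: zxy xy; rewrite in_itv/= => /andP[xz zy].
by rewrite distrC [`|z - x|]distrC !ger0_norm ?subr_ge0//; lra.
Qed.

Lemma Rintegral_sucont f : sucont L f ->
  sucont L (fun x => \int[@lebesgue_measure R]_(l in `[0, x]) f l).
Proof.
move=> uf.
have [M M0 hM] : exists2 M : R, 0 < M & {in I, forall x, `|f x| <= M}.
  have un : sucont L (fun x => `|f x|).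
    move=> e e0; apply: filterS (uf e e0) => d hd x y xI yI xy.
    exact: le_trans (ler_dist_dist _ _) (hd x y xI yI xy).
  have [z zI hz] := EVT_max (ltW L_gt0) (sucont_within un).
  exists (`|f z| + 1) => [|x xI]; first by rewrite ltr_wpDl.
  by apply: le_trans (hz x xI) _; rewrite lerDl.
have key x y : x \in I -> y \in I -> x <= y ->
    `|\int[@lebesgue_measure R]_(l in `[0, y]) f l - \int[@lebesgue_measure R]_(l in `[0, x]) f l|
       <= M * (y - x).
  move=> xI yI xy; have [z zxy ->] := Rintegral_mean_value uf xI yI xy.
  rewrite normrM (ger0_norm (_ : 0 <= y - x)) ?subr_ge0// ler_wpM2r ?subr_ge0//.
  by apply: hM; apply: itv_convex xI yI _; move: zxy; rewrite in_itv.
move=> e e0; apply: (@near0_le _ (e / M)); first by rewrite divr_gt0.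
move=> d d0; rewrite ler_pdivlMr// => dM x y xI yI.
have Md b : b <= d -> M * b <= e by move=> bd; rewrite mulrC (le_trans _ dM)// ler_pM2r.
have [h|/ltW h] := leP x y.
  rewrite ger0_norm ?subr_ge0// => xy; exact: le_trans (key _ _ xI yI h) (Md _ xy).
rewrite distrC ger0_norm ?subr_ge0// => xy.
rewrite distrC; exact: le_trans (key _ _ yI xI h) (Md _ xy).
Qed.

End Primitive.

(** * The Frenet frame *)

Section UnitField.
Context {R : realType}.
Variable L : R.
Hypothesis L_gt0 : 0 < L.
Local Notation I := `[0, L].

(** For unit vectors the increment is orthogonal to the sum of the two values, which
    tends to twice the value at [x]. *)
Lemma dot_unit_deriv g g' : udiff L g g' -> {in I, forall x, enorm (g x) = 1} ->
  {in I, forall x, dot (g x) (g' x) = 0}.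
Proof.
move=> dg g1 x xI; apply/eqP; rewrite -normr_le0; apply/ler_addgt0Pr => e e0; rewrite add0r.
pose M := 1 + enorm (g' x); have M0 : 0 < M by rewrite ltr_pwDl.
have e2 : 0 < e / 2 by rewrite divr_gt0.
have eM : 0 < e / M by rewrite divr_gt0.
have [d d0 [h1 h2]] := near0_witness (filterI (dg _ e2) (udiff_ucont L_gt0 dg eM)).
have [y [yI yx yd]] := near_point L_gt0 xI d0.
have {}h1 := h1 _ _ xI yI yd; have {}h2 := h2 _ _ xI yI yd.
set r := g y - g x - (y - x) *: g' x in h1.
have E : (y - x) * dot (g' x) (g x + g y) = - dot r (g x + g y).
  have := enorm1_dot (g1 y yI); have := enorm1_dot (g1 x xI).
  by rewrite /r !(dotBl, dotDr, dotZl) [dot (g y) (g x)]dotC; lra.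
have E1 : `|dot (g' x) (g x + g y)| <= e.
  rewrite -(ler_pM2l yx) -normrM E normrN (le_trans (norm_dot_le _ _))//.
  have : enorm r * enorm (g x + g y) <= enorm r * 2.
    by rewrite ler_wpM2l// (le_trans (enormD _ _))// !g1//; lra.
  lra.
have E2 : `|dot (g' x) (g y - g x)| <= e.
  rewrite (le_trans (norm_dot_le _ _))//.
  apply: (@le_trans _ _ (M * (e / M))); last by rewrite mulrC divfK ?gt_eqF.
  by apply: ler_pM => //; rewrite /M lerDr.
have -> : dot (g x) (g' x) = (dot (g' x) (g x + g y) - dot (g' x) (g y - g x)) / 2.
  by rewrite !(dotBr, dotDr) [dot (g x) _]dotC; field.
rewrite normrM [X in _ * X]ger0_norm ?invr_ge0// ler_pdivrMr//.
by apply: le_trans (ler_normB _ _) _; lra.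
Qed.

End UnitField.

Section Frenet.
Context {R : realType}.
Variables (L : R) (c : R -> 'rV[R]_3).
Hypothesis L_gt0 : 0 < L.
Hypothesis hC3 : class_C 0 L c 3.
Hypothesis harc : arclength_param 0 L c.
Local Notation I := `[0, L].
Local Notation J := `[0, L]%classic.
Hypothesis hcurv : {in I, forall x, derivn_in 0 L 2 c x != 0}.

Local Notation f k := (derivn_in 0 L k c).
Local Notation mu := (@lebesgue_measure R).
Local Notation n x := (S2val (principal_normal 0 L c x)).

Lemma curve_pdiff k : (k < 3)%N -> pdiff L (f k) (f k.+1).
Proof. by case: hC3 => hd _ _ k3; apply: derivable_in_pdiff; apply: hd. Qed.

Lemma curve_udiff23 : udiff L (f 2) (f 3).
Proof.
apply: pdiff_udiff => //; first exact: curve_pdiff.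
by case: hC3 => _ cf _; apply: ucont_within.
Qed.

Lemma curve_udiff12 : udiff L (f 1) (f 2).
Proof.
apply: pdiff_udiff => //; first exact: curve_pdiff.
exact: udiff_ucont curve_udiff23.
Qed.

Lemma curve_udiff01 : udiff L c (f 1).
Proof.
apply: pdiff_udiff => //; first exact: (@curve_pdiff 0).
exact: udiff_ucont curve_udiff12.
Qed.

Lemma curve_udiff2 : udiff2 L c (f 1) (f 2).
Proof. exact: pdiff_udiff2 (@curve_pdiff 0 isT) curve_udiff12. Qed.

Lemma curve_udiff3 : udiff3 L c (f 1) (f 2) (f 3).
Proof.
apply: pdiff_udiff3 (@curve_pdiff 0 isT) _ => //.
exact: pdiff_udiff2 (@curve_pdiff 1 isT) curve_udiff23.
Qed.

Lemma tangent_unit : {in I, forall x, enorm (f 1 x) = 1}.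
Proof. exact: unit_speed harc _ L_gt0 curve_udiff01. Qed.

Lemma dot_velocity_acceleration : {in I, forall x, dot (f 1 x) (f 2 x) = 0}.
Proof. exact: dot_unit_deriv L_gt0 _ _ curve_udiff12 tangent_unit. Qed.

Lemma curvature_sucont : sucont L (curvature 0 L c).
Proof. exact/sucont_enorm/(udiff_ucont L_gt0 curve_udiff23). Qed.

Lemma curvature_lower : exists2 m, 0 < m & {in I, forall x, m <= curvature 0 L c x}.
Proof.
have [x xI hx] := EVT_min (ltW L_gt0) (sucont_within curvature_sucont).
by exists (curvature 0 L c x) => //; exact/enorm_gt0/hcurv.
Qed.

Definition normal_deriv x := (enorm (f 2 x))^-1 *: (f 3 x - dot (f 3 x) (n x) *: n x).

Lemma normal_udiff : udiff L (fun x => n x) normal_deriv.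
Proof.
have [m m0 hm] := curvature_lower.
exact: (udiff_unitv L_gt0 m0 hm curve_udiff23).
Qed.

Lemma normal_unit x : enorm (n x) = 1. Proof. exact: S2_enorm. Qed.

Lemma accelerationE x : x \in I -> f 2 x = curvature 0 L c x *: n x.
Proof. by move=> xI; rewrite /curvature scale_unitv ?hcurv. Qed.

Lemma dot_tangent_normal x : x \in I -> dot (f 1 x) (n x) = 0.
Proof.
move=> xI; have := dot_velocity_acceleration xI; rewrite accelerationE// dotZr => /eqP.
by rewrite mulf_eq0 (gt_eqF (enorm_gt0 (hcurv xI))) => /eqP.
Qed.

Definition binormal_deriv x := cross (f 1 x) (normal_deriv x).

Lemma binormal_udiff : udiff L (binormal 0 L c) binormal_deriv.
Proof.
move=> e e0; apply: filterS (udiff_cross L_gt0 curve_udiff12 normal_udiff e0) => d hd x y xI yI xy.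
have := hd x y xI yI xy; rewrite /binormal_deriv [cross (f 2 x) _](_ : _ = 0) ?add0r//.
by rewrite accelerationE// crossZl crossvv scaler0.
Qed.

Lemma binormal_unit : {in I, forall x, enorm (binormal 0 L c x) = 1}.
Proof.
move=> x xI; apply/eqP; rewrite -(@eqrXn2 _ 2)// sqr_enorm binet_cauchy dot_tangent_normal//.
by rewrite (enorm1_dot (tangent_unit xI)) (enorm1_dot (normal_unit x)) expr1n; apply/eqP; ring.
Qed.

Lemma cross_binormal_tangent : {in I, forall x, cross (binormal 0 L c x) (f 1 x) = n x}.
Proof.
move=> x xI; rewrite crossC double_cross opprB (enorm1_dot (tangent_unit xI)).
by rewrite dot_tangent_normal// scale0r subr0 scale1r.
Qed.

(** The derivative is a cross product with the tangent, hence orthogonal to it; it is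
    orthogonal to the binormal because the latter has constant length. *)
Lemma binormal_deriv_normal : {in I, forall x,
  binormal_deriv x = dot (n x) (binormal_deriv x) *: n x}.
Proof.
move=> x xI; set v := binormal_deriv x.
have vb : dot (binormal 0 L c x) v = 0.
  exact: dot_unit_deriv L_gt0 _ _ binormal_udiff binormal_unit _ xI.
have vt : dot (f 1 x) v = 0 by rewrite dot_cross_l.
have nv : cross (n x) v = 0.
  rewrite -(cross_binormal_tangent xI) crossC double_cross [dot v _]dotC vt [dot v _]dotC vb.
  by rewrite !scale0r subr0 oppr0.
have := double_cross (n x) (n x) v; rewrite nv (enorm1_dot (normal_unit x)) scale1r.
have -> : cross (n x) (0 : 'rV[R]_3) = 0.
  by rewrite -(scale0r (0 : 'rV[R]_3)) crossZr !scale0r.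
by move/esym/eqP; rewrite subr_eq0 => /eqP ->.
Qed.

(** The set from which the torsion is chosen is nonempty by the previous lemma. *)
Lemma torsionE : {in I, forall x, binormal_deriv x = - torsion 0 L c x *: n x}.
Proof.
move=> x xI; rewrite -(pdiff_deriv_in L_gt0 (udiff_pdiff binormal_udiff) xI).
apply: (@getPex _ [set tau : R | deriv_in 0 L (binormal 0 L c) x
                     = - tau *: (principal_normal 0 L c x : 'rV[R]_3)]).
exists (- dot (n x) (binormal_deriv x)) => /=.
by rewrite opprK (pdiff_deriv_in L_gt0 (udiff_pdiff binormal_udiff) xI) -binormal_deriv_normal.
Qed.

Lemma norm_torsion : {in I, forall x, `|torsion 0 L c x| = enorm (binormal_deriv x)}.
Proof. by move=> x xI; rewrite torsionE// enormZ normrN normal_unit mulr1. Qed.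

Lemma torsion_sucont : sucont L (fun x => `|torsion 0 L c x|).
Proof.
apply: sucont_eq (sucont_enorm (udiff_ucont_deriv binormal_udiff)) => x xI.
exact: esym (norm_torsion xI).
Qed.

End Frenet.

(** * Discrete frames of short chords *)

Section Vertex.
Context {R : realType}.
Implicit Types T N J p q : 'rV[R]_3.

Lemma compare_expansions (w b t u : 'rV[R]_3) : w - b = w - (t + u) - (b - t - u).
Proof. by apply: row3P; split; rewrite !mxE; ring. Qed.

Lemma expansion_shift (w t u : 'rV[R]_3) : w - t = w - (t + u) + u.
Proof. by apply: row3P; split; rewrite !mxE; ring. Qed.

(** Here [T], [N], [J] are the first three derivatives at the vertex.  The term
    [(k - h) / 3] places the discrete binormal at the centroid of the three nodes, since
    [cross T J] is the derivative of [cross T N]. *)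
Lemma cross_vertex T N J p q (h k e M : R) :
  0 < h <= 1 -> 0 < k <= 1 -> 0 < e <= 1 -> enorm N <= M -> enorm J <= M ->
  enorm p <= h -> enorm q <= k ->
  enorm (p - (h *: T - (h ^+ 2 / 2) *: N + (h ^+ 3 / 6) *: J)) <= e * h ^+ 3 ->
  enorm (q - (k *: T + (k ^+ 2 / 2) *: N + (k ^+ 3 / 6) *: J)) <= e * k ^+ 3 ->
  enorm ((2 / (h * k * (h + k))) *: cross p q - (cross T N + ((k - h) / 3) *: cross T J))
    <= (M ^+ 2 * (h + k) + 4 * e) * (h + k).
Proof.
move=> /andP[h0 h1] /andP[k0 k1] /andP[e0 e1] NM JM ph qk.
set r := p - _; set s := q - _ => rh sk.
have M0 : 0 <= M by apply: le_trans NM.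
have hk0 : 0 < h + k by rewrite addr_gt0.
have -> : (2 / (h * k * (h + k))) *: cross p q - (cross T N + ((k - h) / 3) *: cross T J)
  = - ((h * k / 6) *: cross N J)
    + (2 / (h * k * (h + k))) *: (cross p s + cross r q - cross r s).
  rewrite /r /s; apply: row3P; split; rewrite !(crossE, mxE); field; lra.
apply: le_trans (enormD _ _) _; rewrite enormN !enormZ.
rewrite !ger0_norm; last 2 first.
- by rewrite divr_ge0 ?mulr_ge0 ?ltW.
- by rewrite divr_ge0 ?mulr_ge0 ?ltW.
have A1 : h * k / 6 * enorm (cross N J) <= M ^+ 2 * (h + k) * (h + k).
  apply: (@le_trans _ _ (h * k / 6 * M ^+ 2)).
    apply: ler_wpM2l; first by rewrite divr_ge0 ?mulr_ge0 ?ltW.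
    by apply: le_trans (enorm_cross _ _) _; rewrite expr2 ler_pM.
  have -> : h * k / 6 * M ^+ 2 = M ^+ 2 * (h * k / 6) by ring.
  rewrite -[X in _ <= X]mulrA ler_wpM2l ?exprn_ge0//; nra.
have A2 : enorm (cross p s + cross r q - cross r s) <= h * k * e * (2 * (h + k) ^+ 2).
  apply: le_trans (enormB _ _) _.
  have B1 : enorm (cross p s) <= h * (e * k ^+ 3).
    by apply: le_trans (enorm_cross _ _) _; apply: ler_pM.
  have B2 : enorm (cross r q) <= (e * h ^+ 3) * k.
    by apply: le_trans (enorm_cross _ _) _; apply: ler_pM.
  have B3 : enorm (cross r s) <= (e * h ^+ 3) * (e * k ^+ 3).
    by apply: le_trans (enorm_cross _ _) _; apply: ler_pM.
  have B4 : (e * h ^+ 3) * (e * k ^+ 3) <= h * k * e * (h + k) ^+ 2.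
    have -> : (e * h ^+ 3) * (e * k ^+ 3) = h * k * e * (e * (h * k) ^+ 2) by ring.
    rewrite ler_wpM2l ?mulr_ge0 ?(ltW h0) ?(ltW k0) ?(ltW e0)//.
    apply: (@le_trans _ _ ((h * k) ^+ 2)); first by rewrite ler_piMl// exprn_ge0 ?mulr_ge0 ?ltW.
    by rewrite ler_pXn2r ?nnegrE ?mulr_ge0 ?(ltW h0) ?(ltW k0) ?(ltW hk0)//; nra.
  have B5 : h * (e * k ^+ 3) + e * h ^+ 3 * k <= h * k * e * (h + k) ^+ 2.
    have -> : h * (e * k ^+ 3) + e * h ^+ 3 * k = h * k * e * (k ^+ 2 + h ^+ 2) by ring.
    rewrite ler_wpM2l ?mulr_ge0 ?(ltW h0) ?(ltW k0) ?(ltW e0)//; nra.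
  by have := enormD (cross p s) (cross r q); lra.
have A3 : 2 / (h * k * (h + k)) * enorm (cross p s + cross r q - cross r s) <= 4 * e * (h + k).
  have -> : 4 * e * (h + k) = 2 / (h * k * (h + k)) * (h * k * e * (2 * (h + k) ^+ 2)).
    by field; lra.
  by apply: ler_wpM2l A2; rewrite divr_ge0 ?mulr_ge0 ?ltW.
by rewrite [X in _ <= X]mulrDl lerD.
Qed.

End Vertex.

(* Frame vectors are never compared by unfolding the limits that define derivatives. *)
Local Opaque derivn_in.

Section ShortChords.
Context {R : realType}.
Variables (L : R) (c : R -> 'rV[R]_3).
Hypothesis L_gt0 : 0 < L.
Hypothesis hC3 : class_C 0 L c 3.
Hypothesis harc : arclength_param 0 L c.
Local Notation I := `[0, L].
Hypothesis hcurv : {in I, forall x, derivn_in 0 L 2 c x != 0}.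

Local Notation f k := (derivn_in 0 L k c).
Local Notation tS x := (unitv (f 1 x)).
Local Notation bS x := (unitv (binormal 0 L c x)).

Lemma binormal_unitvE x : x \in I -> S2val (bS x) = binormal 0 L c x.
Proof. by move=> xI; rewrite unitv_unit// (binormal_unit L_gt0 hC3 harc hcurv). Qed.

(** The expansions of the chord and of the tangent at the midpoint agree to first
    order, so the error is small compared with the length of the interval and can be
    summed over a partition. *)
Lemma chord_tangent (e : R) : 0 < e -> \forall d \near 0^'+,
  {in I &, forall x y, x < y -> y - x <= d -> c y - c x != 0 /\
    enorm (S2val (unitv (c y - c x)) - f 1 ((x + y) / 2)) <= e * (y - x)}.
Proof.
move=> e0; have e4 : 0 < e / 4 by rewrite divr_gt0.
have e1L : 0 < 1 / e by rewrite divr_gt0.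
apply: filterS3 (curve_udiff2 L_gt0 hC3 e4) (curve_udiff12 L_gt0 hC3 e4) (nbhs_right_lt e1L).
move=> d h2 h1 d1 x y xI yI xy yxd.
set m := (x + y) / 2; pose h := y - x; have h0 : 0 < h by rewrite subr_gt0.
have mI : m \in I by apply: (itv_convex xI yI); rewrite /m; apply/andP; split; lra.
have {}h2 := h2 x y xI yI; rewrite -/h gtr0_norm// in h2; have {}h2 := h2 yxd.
have mx : m - x = h / 2 by rewrite /m /h; field.
have {}h1 := h1 x m xI mI; rewrite mx gtr0_norm ?divr_gt0// in h1.
have {}h1 : enorm (f 1 m - f 1 x - (h / 2) *: f 2 x) <= e / 4 * (h / 2).
  by apply: h1; rewrite -/h in yxd; lra.
pose w := h^-1 *: (c y - c x).
have W : enorm (w - f 1 m) <= e / 2 * h.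
  have -> : w - f 1 m = h^-1 *: (c y - (c x + h *: f 1 x + (h ^+ 2 / 2) *: f 2 x))
       - (f 1 m - f 1 x - (h / 2) *: f 2 x).
    rewrite /w; move: (f 1 m) (f 1 x) (f 2 x) => t1 t0 n0.
    by apply: row3P; split; rewrite !mxE; field; rewrite gt_eqF.
  apply: le_trans (enormB _ _) _; rewrite enormZ gtr0_norm ?invr_gt0//.
  have : h^-1 * enorm (c y - (c x + h *: f 1 x + (h ^+ 2 / 2) *: f 2 x)) <= e / 4 * h.
    by rewrite ler_pdivrMl// mulrCA -expr2.
  have : 0 < e * h by rewrite mulr_gt0.
  lra.
have fm1 : enorm (f 1 m) = 1 by apply: (tangent_unit L_gt0 hC3 harc).
have w0 : w != 0.
  apply/eqP => w0; move: W; rewrite w0 sub0r enormN fm1.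
  have : e * h < 1 by rewrite mulrC -ltr_pdivlMr//; apply: le_lt_trans yxd d1.
  lra.
split; first by apply: contraNneq w0 => cyx; rewrite /w cyx scaler0.
rewrite -(@unitvZ _ h^-1) ?invr_gt0// -[_ *: _]/w -[f 1 m](unitv_unit fm1).
by apply: le_trans (unitv_lip (enorm1_neq0 fm1) w0) _; rewrite fm1 divr1 -/h; lra.
Qed.

Let B x := cross (f 1 x) (f 2 x).
Let B' x := cross (f 2 x) (f 2 x) + cross (f 1 x) (f 3 x).

Let dB : udiff L B B'.
Proof. exact: (udiff_cross L_gt0 (curve_udiff12 L_gt0 hC3) (curve_udiff23 hC3)). Qed.

Let BE x : x \in I -> B x = curvature 0 L c x *: binormal 0 L c x.
Proof. by move=> xI; rewrite /B {1}(accelerationE hcurv xI) crossZr. Qed.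

Let normB x : x \in I -> enorm (B x) = curvature 0 L c x.
Proof.
move=> xI; rewrite BE// enormZ (binormal_unit L_gt0 hC3 harc hcurv)// mulr1 ger0_norm//.
exact: enorm_ge0.
Qed.

Let unitvB x : x \in I -> unitv (B x) = bS x.
Proof. by move=> xI; rewrite BE// unitvZ// /curvature enorm_gt0 ?hcurv. Qed.

(** The end [y] of the first segment and the start [y'] of the second are the same
    parameter except at the closing vertex of a closed curve, where only the
    derivatives agree. *)
Let vertex_bound (e : R) : 0 < e -> \forall d \near 0^'+,
  forall x y y' z, x \in I -> y \in I -> y' \in I -> z \in I ->
    f 1 y = f 1 y' -> f 2 y = f 2 y' -> f 3 y = f 3 y' ->
    x < y -> y' < z -> y - x <= d -> z - y' <= d ->
    let h := y - x in let k := z - y' in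
    enorm ((2 / (h * k * (h + k))) *: cross (c y - c x) (c z - c y')
       - (B y + ((k - h) / 3) *: B' y)) <= e * (h + k).
Proof.
move=> e0.
have [M2 M20 hM2] := ucont_bounded L_gt0 (udiff_ucont_deriv (curve_udiff12 L_gt0 hC3)).
have [M3 M30 hM3] := ucont_bounded L_gt0 (udiff_ucont_deriv (curve_udiff23 hC3)).
pose M := M2 + M3; have M0 : 0 < M by rewrite addr_gt0.
pose a := Num.min 1 (e / 8); have a0 : 0 < a by rewrite lt_min ltr01 divr_gt0.
have a1 : a <= 1 by rewrite ge_min lexx.
have ae : a <= e / 8 by rewrite ge_min lexx orbT.
have q0 : 0 < e / (4 * M ^+ 2) by rewrite divr_gt0// mulr_gt0// exprn_gt0.
near=> d => x y y' z xI yI y'I zI e1 e2 e3 xy yz xyd yzd.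
set h := y - x; set k := z - y'.
have H3 : {in I &, forall x y, `|y - x| <= d ->
    enorm (c y - (c x + (y - x) *: f 1 x + ((y - x) ^+ 2 / 2) *: f 2 x
                  + ((y - x) ^+ 3 / 6) *: f 3 x)) <= a * `|y - x| ^+ 3}.
  by near: d; apply: (curve_udiff3 hC3).
have d1 : d <= 1 by near: d; apply: nbhs_right_le.
have dq : d <= e / (4 * M ^+ 2) by near: d; apply: nbhs_right_le.
have h0 : 0 < h by rewrite subr_gt0.
have k0 : 0 < k by rewrite subr_gt0.
have xyE : x - y = - h by rewrite opprB.
have Hx := H3 y x yI xI; rewrite xyE normrN (gtr0_norm h0) in Hx; have {}Hx := Hx xyd.
have Hz := H3 y' z y'I zI; rewrite -/k (gtr0_norm k0) -e1 -e2 -e3 in Hz; have {}Hz := Hz yzd.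
have -> : B' y = cross (f 1 y) (f 3 y) by rewrite /B' crossvv add0r.
apply: le_trans (@cross_vertex _ (f 1 y) (f 2 y) (f 3 y) _ _ h k a M _ _ _ _ _ _ _ _ _) _.
- by rewrite h0 (le_trans xyd).
- by rewrite k0 (le_trans yzd).
- by rewrite a0.
- by apply: le_trans (hM2 y yI) _; rewrite lerDl ltW.
- by apply: le_trans (hM3 y yI) _; rewrite lerDr ltW.
- by apply: le_trans (arclength_edist harc xI yI) _; rewrite gtr0_norm.
- by apply: le_trans (arclength_edist harc y'I zI) _; rewrite gtr0_norm.
- rewrite -enormN; apply: le_trans Hx; rewrite le_eqVlt; apply/orP; left; apply/eqP.
  congr enorm; move: (f 1 y) (f 2 y) (f 3 y) => T N J.
  by apply: row3P; split; rewrite !mxE; field.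
- apply: le_trans Hz; rewrite le_eqVlt; apply/orP; left; apply/eqP.
  congr enorm; move: (f 1 y) (f 2 y) (f 3 y) => T N J.
  by apply: row3P; split; rewrite !mxE; field.
apply: ler_wpM2r; first by rewrite addr_ge0 ?(ltW h0) ?(ltW k0).
have : M ^+ 2 * (h + k) <= e / 2.
  apply: (@le_trans _ _ (M ^+ 2 * (e / (4 * M ^+ 2) + e / (4 * M ^+ 2)))).
    apply: ler_wpM2l; first by rewrite exprn_ge0 ?(ltW M0).
    by apply: lerD; [exact: le_trans xyd dq|exact: le_trans yzd dq].
  by rewrite le_eqVlt; apply/orP; left; apply/eqP; field; lra.
lra.
Unshelve. all: by end_near. Qed.

(** Same principle as for tangents, with the centroid of the three nodes in place of
    the midpoint. *)
Lemma binormal_dir (e : R) : 0 < e -> \forall d \near 0^'+,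
  forall x y z, x \in I -> z \in I -> x < y -> y < z -> y - x <= d -> z - y <= d ->
    cross (c y - c x) (c z - c y) != 0 /\
    enorm (S2val (unitv (cross (c y - c x) (c z - c y))) - binormal 0 L c ((x + y + z) / 3))
      <= e * (z - x).
Proof.
move=> e0; have [m m0 hm] := curvature_lower L_gt0 hC3 hcurv.
pose a := e * m / 4; have a0 : 0 < a by rewrite divr_gt0// mulr_gt0.
near=> d => x y z xI zI xy yz xyd yzd.
have V : forall x y y' z, x \in I -> y \in I -> y' \in I -> z \in I ->
    f 1 y = f 1 y' -> f 2 y = f 2 y' -> f 3 y = f 3 y' ->
    x < y -> y' < z -> y - x <= d -> z - y' <= d ->
    let h := y - x in let k := z - y' in
    enorm ((2 / (h * k * (h + k))) *: cross (c y - c x) (c z - c y')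
       - (B y + ((k - h) / 3) *: B' y)) <= a * (h + k).
  by near: d; apply: vertex_bound.
have HB : {in I &, forall x y, `|y - x| <= d -> enorm (B y - B x - (y - x) *: B' x) <= a * `|y - x|}.
  by near: d; apply: dB.
have dme : d < m / (8 * a) by near: d; apply: nbhs_right_lt; rewrite divr_gt0// mulr_gt0.
have yI : y \in I by apply: (itv_convex xI zI); rewrite !ltW.
have {}V := V x y y z xI yI yI zI erefl erefl erefl xy yz xyd yzd; cbv zeta in V.
set h := y - x in xyd V; set k := z - y in yzd V.
have h0 : 0 < h by rewrite subr_gt0.
have k0 : 0 < k by rewrite subr_gt0.
have hkE : z - x = h + k by rewrite /h /k; ring.
set mu := (x + y + z) / 3; have muE : mu - y = (k - h) / 3 by rewrite /mu /h /k; field.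
have muI : mu \in I by apply: (itv_convex xI zI); rewrite /mu; apply/andP; split; lra.
have khb : `|(k - h) / 3| <= (h + k) / 3.
  by rewrite normrM [X in _ * X]gtr0_norm ?invr_gt0// ler_pM2r ?invr_gt0// ler_norml; apply/andP; split; lra.
have {}HB := HB y mu yI muI; rewrite muE in HB.
have {}HB : enorm (B mu - B y - ((k - h) / 3) *: B' y) <= a * `|(k - h) / 3|.
  by apply: HB; apply: le_trans khb _; lra.
set s := 2 / (h * k * (h + k)) in V.
have s0 : 0 < s by rewrite /s divr_gt0// ?mulr_gt0// addr_gt0.
set w := s *: cross _ _ in V.
have W : enorm (w - B mu) <= 2 * a * (h + k).
  rewrite (compare_expansions w (B mu) (B y) (((k - h) / 3) *: B' y)).
  apply: le_trans (enormB _ _) _.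
  have : a * `|(k - h) / 3| <= a * ((h + k) / 3) by rewrite ler_pM2l.
  have : 0 < a * (h + k) by rewrite mulr_gt0// addr_gt0.
  lra.
have Bmu : m <= enorm (B mu) by rewrite normB// hm.
have Bmu0 : B mu != 0 by apply/eqP => E; move: Bmu; rewrite E enorm0; lra.
have w0 : w != 0.
  apply/eqP => w0; move: W; rewrite w0 sub0r enormN => W.
  have : 8 * a * d < m by rewrite mulrC -ltr_pdivlMr// mulr_gt0.
  have : 2 * a * (h + k) <= 2 * a * (d + d).
    by apply: ler_wpM2l; [rewrite mulr_ge0 ?(ltW a0)|exact: lerD].
  have ad : 0 < a * d by rewrite mulr_gt0// (lt_le_trans h0).
  lra.
split; first by apply: contraNneq w0 => E; rewrite /w E scaler0.
rewrite -(@unitvZ _ s)// -/w -binormal_unitvE// -unitvB//.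
apply: le_trans (unitv_lip Bmu0 w0) _; rewrite ler_pdivrMr ?enorm_gt0// hkE.
apply: (@le_trans _ _ (e * (h + k) * m)); first by rewrite /a in W; lra.
apply: ler_wpM2l Bmu; rewrite mulr_ge0 ?(ltW e0)//.
by rewrite addr_ge0 ?(ltW h0) ?(ltW k0).
Unshelve. all: by end_near. Qed.

(** A closed polygonal has a single closing vertex, so there an error that is merely
    small suffices, without comparison to the length of the segments. *)
Lemma binormal_dir_closing (e : R) : c 0 = c L -> 0 < e -> \forall d \near 0^'+,
  forall x z, x \in I -> z \in I -> x < L -> 0 < z -> L - x <= d -> z <= d ->
    cross (c L - c x) (c z - c 0) != 0 /\
    enorm (S2val (unitv (cross (c L - c x) (c z - c 0))) - binormal 0 L c L) <= e.
Proof.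
move=> closed e0; have [m m0 hm] := curvature_lower L_gt0 hC3 hcurv.
have LI : L \in I by rewrite in_itv/= lexx ltW.
have OI : 0 \in I by rewrite in_itv/= lexx ltW.
have [_ _ /(_ closed) per] := hC3.
pose M := 1 + enorm (B' L); have M0 : 0 < M by rewrite ltr_pwDl.
pose b := Num.min (e * m / 2) (m / 2).
have b0 : 0 < b by rewrite lt_min !divr_gt0// mulr_gt0.
near=> d => x z xI zI xL z0 xd zd.
have V : forall x y y' z, x \in I -> y \in I -> y' \in I -> z \in I ->
    f 1 y = f 1 y' -> f 2 y = f 2 y' -> f 3 y = f 3 y' ->
    x < y -> y' < z -> y - x <= d -> z - y' <= d ->
    let h := y - x in let k := z - y' in
    enorm ((2 / (h * k * (h + k))) *: cross (c y - c x) (c z - c y')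
       - (B y + ((k - h) / 3) *: B' y)) <= 1 * (h + k).
  by near: d; apply: vertex_bound.
have dM : d <= b / (4 * M) by near: d; apply: nbhs_right_le; rewrite divr_gt0// mulr_gt0.
have {}V := V x L 0 z xI LI OI zI (esym (per 1%N isT)) (esym (per 2%N isT)) (esym (per 3%N isT)) xL z0 xd.
have {}V := V (eq_ind_r (fun t => t <= d) zd (subr0 z)).
cbv zeta in V; rewrite subr0 in V; set h := L - x in xd V.
have h0 : 0 < h by rewrite subr_gt0.
set s := 2 / (h * z * (h + z)) in V.
have s0 : 0 < s by rewrite /s divr_gt0// ?mulr_gt0// addr_gt0.
set w := s *: cross _ _ in V.
have W : enorm (w - B L) <= b.
  rewrite (expansion_shift w (B L) (((z - h) / 3) *: B' L)).
  apply: le_trans (enormD _ _) _; rewrite enormZ.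
  have hz : `|(z - h) / 3| <= h + z.
    rewrite ler_norml; apply/andP; split; lra.
  have : `|(z - h) / 3| * enorm (B' L) <= (h + z) * enorm (B' L) by rewrite ler_wpM2r.
  have : (h + z) * M <= b.
    apply: (@le_trans _ _ ((b / (4 * M) + b / (4 * M)) * M)).
      rewrite (ler_pM2r M0).
      by apply: lerD; [exact: le_trans xd dM|exact: le_trans zd dM].
    have -> : (b / (4 * M) + b / (4 * M)) * M = b / 2 by field; rewrite gt_eqF.
    by lra.
  by rewrite /M; lra.
have BL : m <= enorm (B L) by rewrite normB// hm.
have BL0 : B L != 0 by apply/eqP => E; move: BL; rewrite E enorm0; lra.
have bm : b <= m / 2 by rewrite ge_min lexx orbT.
have be : b <= e * m / 2 by rewrite ge_min lexx.
have w0 : w != 0.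
  by apply/eqP => w0; move: W; rewrite w0 sub0r enormN; lra.
split; first by apply: contraNneq w0 => E; rewrite /w E scaler0.
rewrite -(@unitvZ _ s)// -/w -binormal_unitvE// -unitvB//.
apply: le_trans (unitv_lip BL0 w0) _; rewrite ler_pdivrMr ?enorm_gt0//.
apply: (@le_trans _ _ (e * m)); first by lra.
by apply: ler_wpM2l BL; exact: ltW.
Unshelve. all: by end_near. Qed.

End ShortChords.

Section SphericalSpeed.
Context {R : realType}.
Variable L : R.
Hypothesis L_gt0 : 0 < L.
Local Notation I := `[0, L].

(** The chord is the speed times the increment of the parameter up to a small
    relative error, the primitive likewise, and arc and chord differ at third order. *)
Lemma spherical_speed g g' (Phi phi : R -> R) : udiff L g g' ->
  {in I, forall x, enorm (g x) = 1} -> {in I, forall x, phi x = enorm (g' x)} ->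
  sudiff L Phi phi -> forall e : R, 0 < e -> \forall d \near 0^'+,
  {in I &, forall x y, x <= y -> y - x <= d ->
    `|geodS2 (unitv (g x)) (unitv (g y)) - (Phi y - Phi x)| <= e * (y - x)}.
Proof.
move=> dg g1 phiE dPhi e e0.
have [M M0 hM] := ucont_bounded L_gt0 (udiff_ucont_deriv dg).
have e3 : 0 < e / 3 by rewrite divr_gt0.
pose q := e / (24 * (1 + M) ^+ 3).
have M1 : 0 < 1 + M by rewrite addr_gt0.
have q0 : 0 < q by rewrite divr_gt0// mulr_gt0// exprn_gt0.
near=> d => x y xI yI xy yxd.
have H1 : {in I &, forall x y, `|y - x| <= d -> enorm (g y - g x - (y - x) *: g' x) <= e / 3 * `|y - x|}.
  by near: d; apply: dg.
have H2 : {in I &, forall x y, `|y - x| <= d -> enorm (g y - g x - (y - x) *: g' x) <= 1 * `|y - x|}.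
  by near: d; apply: dg.
have H3 : {in I &, forall x y, `|y - x| <= d -> `|Phi y - Phi x - (y - x) * phi x| <= e / 3 * `|y - x|}.
  by near: d; apply: dPhi.
have d1 : d <= 1 by near: d; apply: nbhs_right_le.
have dq : d <= q by near: d; apply: nbhs_right_le.
pose h := y - x; have h0 : 0 <= h by rewrite subr_ge0.
have hE : `|y - x| = h by rewrite ger0_norm.
have {}H1 := H1 _ _ xI yI; have {}H2 := H2 _ _ xI yI; have {}H3 := H3 _ _ xI yI.
rewrite hE in H1 H2 H3; have {}H1 := H1 yxd; have {}H2 := H2 yxd; have {}H3 := H3 yxd.
rewrite -/h in H1 H2 H3 *; rewrite -/h in yxd.
set r := enorm (g y - g x).
have rE : enorm (S2val (unitv (g x)) - S2val (unitv (g y))) = r.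
  by rewrite edistC !unitv_unit ?g1.
have := chord_le_geodS2 (unitv (g x)) (unitv (g y)); rewrite rE => lo.
have := geodS2_le_chord_cube (unitv (g x)) (unitv (g y)); rewrite rE => hi.
have r1 : `|r - h * enorm (g' x)| <= e / 3 * h.
  have := norm_enormB (g y - g x) (h *: g' x); rewrite enormZ (ger0_norm h0) => A.
  exact: le_trans A H1.
have r2 : r <= (1 + M) * h.
  have := enorm_le_dist (g y - g x) (h *: g' x); rewrite enormZ (ger0_norm h0) -/r => A.
  have : h * enorm (g' x) <= h * M by rewrite ler_wpM2l ?hM.
  lra.
have r3 : 8 * r ^+ 3 <= e / 3 * h.
  have rc : r ^+ 3 <= ((1 + M) * h) ^+ 3.
    by rewrite ler_pXn2r ?nnegrE ?mulr_ge0 ?enorm_ge0 ?(ltW M1).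
  have : 8 * ((1 + M) * h) ^+ 3 <= e / 3 * h.
    have -> : e / 3 * h = h * (8 * (1 + M) ^+ 3 * q) by rewrite /q; field; lra.
    have -> : 8 * ((1 + M) * h) ^+ 3 = h * (8 * (1 + M) ^+ 3 * (h * h)) by ring.
    rewrite ler_wpM2l// ler_wpM2l ?mulr_ge0 ?exprn_ge0 ?(ltW M1)//.
    have : h * h <= 1 * h by rewrite ler_wpM2r// (le_trans yxd).
    lra.
  lra.
rewrite (phiE x xI) in H3.
move: r1 H3; rewrite !ler_norml => /andP[r1 r1'] /andP[H3 H3']; apply/andP; split; lra.
Unshelve. all: by end_near. Qed.

End SphericalSpeed.

Local Opaque unitv enorm dot cross.

(** * Fine inscribed polygonals *)

Section Chain.
Context {R : realType}.

Lemma window_sum (N : nat -> R) (L : R) (i0 i : nat) : (0 < i0 <= i)%N ->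
  (forall j, 0 <= N j <= L) ->
  \sum_(i0 <= j < i) (N j.+2 - N j.-1) <= 3 * L.
Proof.
move=> /andP[i00 i0i] hN.
have -> : \sum_(i0 <= j < i) (N j.+2 - N j.-1) =
    \sum_(i0 <= j < i) (N j.+2 - N j.+1) + \sum_(i0 <= j < i) (N j.+1 - N j)
    + \sum_(i0 <= j < i) (N j - N j.-1).
  by rewrite -!big_split /=; apply: eq_bigr => j _; ring.
rewrite (telescope_sumr (fun j => N j.+1))// (telescope_sumr N)//.
rewrite (telescope_sumr (fun j => N j.-1))//.
have := hN i.+1; have := hN i0.+1; have := hN i; have := hN i0; have := hN i.-1; have := hN i0.-1.
by lra.
Qed.

(** Errors proportional to the window [N j.+2 - N j.-1] add up to at most three
    times the length of the interval. *)
Lemma chain_sum (y : nat -> S2 R) (Phi : R -> R) (m N : nat -> R) (L e : R) (i0 i : nat) :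
  0 <= e -> (0 < i0 <= i)%N -> (forall j, 0 <= N j <= L) ->
  (forall j, (i0 <= j < i)%N ->
    `|geodS2 (y j) (y j.+1) - (Phi (m j.+1) - Phi (m j))| <= e * (N j.+2 - N j.-1)) ->
  `|\sum_(i0 <= j < i) geodS2 (y j) (y j.+1) - (Phi (m i) - Phi (m i0))| <= e * (3 * L).
Proof.
move=> e0 i0i hN h; have /andP[_ le0i] := i0i.
rewrite -(telescope_sumr (fun j => Phi (m j)) le0i) -sumrB.
apply: le_trans (ler_norm_sum _ _ _) _.
apply: (@le_trans _ _ (\sum_(i0 <= j < i) e * (N j.+2 - N j.-1))).
  by apply: ler_sum_nat.
by rewrite -mulr_sumr ler_wpM2l// window_sum.
Qed.

Lemma dist_geodS2 (y1 y2 z1 z2 : S2 R) (a e1 e2 e3 : R) :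
  geodS2 y1 z1 <= e1 -> geodS2 y2 z2 <= e2 -> `|geodS2 z1 z2 - a| <= e3 ->
  `|geodS2 y1 y2 - a| <= e1 + e2 + e3.
Proof.
move=> h1 h2; have := geodS2_triangle z1 y1 y2; have := geodS2_triangle z2 z1 y2.
have := geodS2_triangle y1 z1 z2; have := geodS2_triangle y2 y1 z2.
rewrite [geodS2 z2 y2]geodS2C [geodS2 z1 y1]geodS2C.
move=> a1 a2 a3 a4; rewrite !ler_norml => /andP[b1 b2]; apply/andP; split; lra.
Qed.

Lemma sum_error (s k0 k1 k e1 e2 e3 : R) : `|s - (k1 - k0)| <= e1 -> `|k1 - k| <= e2 ->
  `|k0| <= e3 -> `|s - k| <= e1 + e2 + e3.
Proof.
rewrite !ler_norml => /andP[? ?] /andP[? ?] /andP[? ?].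
by apply/andP; split; lra.
Qed.

End Chain.

Section FinePolygons.
Context {R : realType}.
Variables (L : R) (c : R -> 'rV[R]_3).
Hypothesis L_gt0 : 0 < L.
Hypothesis hC3 : class_C 0 L c 3.
Hypothesis harc : arclength_param 0 L c.
Local Notation I := `[0, L].
Hypothesis hcurv : {in I, forall x, derivn_in 0 L 2 c x != 0}.

Local Notation f k := (derivn_in 0 L k c).
Local Notation tS x := (unitv (f 1 x)).
Local Notation bS x := (unitv (binormal 0 L c x)).
Local Notation mu := (@lebesgue_measure R).

Definition total_curvature (x : R) : R := \int[mu]_(l in `[0, x]) curvature 0 L c l.
Definition total_torsion (x : R) : R := \int[mu]_(l in `[0, x]) `|torsion 0 L c l|.

Definition mesh_le (lam : seq R) (d : R) :=
  forall i, nth L (0 :: lam) i.+1 - nth L (0 :: lam) i <= d.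

Definition segment (lam : seq R) i := c (nth L (0 :: lam) i) - c (nth L (0 :: lam) i.-1).
Definition seg_dir lam i : S2 R := unitv (segment lam i).
Definition seg_binormal lam i : S2 R := unitv (cross (segment lam i) (segment lam i.+1)).

Lemma total_curvature_sucont : sucont L total_curvature.
Proof. exact (Rintegral_sucont L_gt0 (curvature_sucont L_gt0 hC3)). Qed.

Lemma total_torsion_sucont : sucont L total_torsion.
Proof. exact (Rintegral_sucont L_gt0 (torsion_sucont L_gt0 hC3 harc hcurv)). Qed.

Lemma Rintegral_start (g : R -> R) : \int[mu]_(l in `[0, 0]) g l = 0.
Proof. by rewrite set_itv1 Rintegral_set1. Qed.

Lemma tangent_speed (e : R) : 0 < e -> \forall d \near 0^'+,
  {in I &, forall x y, x <= y -> y - x <= d ->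
    `|geodS2 (tS x) (tS y) - (total_curvature y - total_curvature x)| <= e * (y - x)}.
Proof.
apply: (spherical_speed L_gt0 (curve_udiff12 L_gt0 hC3) (tangent_unit L_gt0 hC3 harc)
  (phi := curvature 0 L c)) => //.
exact (sudiff_Rintegral L_gt0 (curvature_sucont L_gt0 hC3)).
Qed.

Lemma binormal_speed (e : R) : 0 < e -> \forall d \near 0^'+,
  {in I &, forall x y, x <= y -> y - x <= d ->
    `|geodS2 (bS x) (bS y) - (total_torsion y - total_torsion x)| <= e * (y - x)}.
Proof.
apply: (spherical_speed L_gt0 (binormal_udiff L_gt0 hC3 hcurv) (binormal_unit L_gt0 hC3 harc hcurv)
  (phi := fun x => `|torsion 0 L c x|)).
  exact: norm_torsion L_gt0 hC3 harc hcurv.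
exact (sudiff_Rintegral L_gt0 (torsion_sucont L_gt0 hC3 harc hcurv)).
Qed.

Lemma tangent_cont (e : R) : 0 < e -> \forall d \near 0^'+,
  {in I &, forall x y, `|y - x| <= d -> geodS2 (tS x) (tS y) <= e}.
Proof.
move=> e0; have e4 : 0 < e / 4 by rewrite divr_gt0.
apply: filterS (udiff_ucont L_gt0 (curve_udiff12 L_gt0 hC3) e4) => d hd x y xI yI xy.
have tx := tangent_unit L_gt0 hC3 harc xI; have ty := tangent_unit L_gt0 hC3 harc yI.
apply: le_trans (geodS2_unitv2_le tx ty) _.
by rewrite edistC mulrC -ler_pdivlMr//; exact: hd x y xI yI xy.
Qed.

Lemma binormal_cont (e : R) : 0 < e -> \forall d \near 0^'+,
  {in I &, forall x y, `|y - x| <= d -> geodS2 (bS x) (bS y) <= e}.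
Proof.
move=> e0; have e4 : 0 < e / 4 by rewrite divr_gt0.
apply: filterS (udiff_ucont L_gt0 (binormal_udiff L_gt0 hC3 hcurv) e4) => d hd x y xI yI xy.
have bx := binormal_unit L_gt0 hC3 harc hcurv xI.
have b_y := binormal_unit L_gt0 hC3 harc hcurv yI.
apply: le_trans (geodS2_unitv2_le bx b_y) _.
by rewrite edistC mulrC -ler_pdivlMr//; exact: hd x y xI yI xy.
Qed.

Lemma mesh_size lam (d : R) : itv_partition 0 L lam -> mesh_le lam d -> 0 < d -> d < L / 4 ->
  (4 < size lam)%N.
Proof.
move=> lamP hm d0 dL.
have h i : nth L (0 :: lam) i <= i%:R * d.
  elim: i => [|i IH]; first by rewrite mul0r.
  by have := hm i; rewrite -addn1 natrD mulrDl mul1r; lra.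
have := h (size lam); rewrite (node_size lamP) => h1.
rewrite ltnNge; apply/negP => s4.
have : (size lam)%:R <= 4 :> R by rewrite ler_nat.
move=> s4'; have : (size lam)%:R * d <= 4 * d by rewrite ler_pM2r.
by lra.
Qed.

(** Each direction is close to the tangent at the midpoint of its interval, and the
    distances between the latter add up to the integral of the curvature. *)
Lemma fine_tangents (e : R) : 0 < e -> \forall d \near 0^'+, forall lam,
  itv_partition 0 L lam -> mesh_le lam d ->
  [/\ (4 < size lam)%N,
      forall i, (i < size lam)%N -> segment lam i.+1 != 0,
      forall i, (i < size lam)%N -> geodS2 (seg_dir lam i.+1) (tS (nth L (0 :: lam) i)) <= e,
      forall i, (i < size lam)%N -> geodS2 (seg_dir lam i.+1) (tS (nth L (0 :: lam) i.+1)) <= e &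
      forall i, (i < size lam)%N ->
        `|\sum_(1 <= j < i.+1) geodS2 (seg_dir lam j) (seg_dir lam j.+1)
            - total_curvature (nth L (0 :: lam) i)| <= e].
Proof.
(* 15 a L from the sum over windows and 2 a from moving the nodes to the midpoints. *)
move=> e0; pose a := e / (40 * (1 + L)).
have L1 : 0 < 1 + L by rewrite addr_gt0.
have a0 : 0 < a by rewrite divr_gt0// mulr_gt0.
have ae : a * (1 + L) = e / 40 by rewrite /a; field; rewrite gt_eqF.
have a1 : a <= e / 40 by rewrite -ae ler_pMr// lerDl ltW.
have aL : a * L <= e / 40 by rewrite -ae ler_pM2l// lerDr.
clear ae; clearbody a.
near=> d => lam lamP hm; set N := nth L (0 :: lam).
have d0 : 0 < d by near: d; apply: nbhs_right_gt.
have d1 : d <= 1 by near: d; apply: nbhs_right_le.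
have dL : d < L / 4 by near: d; apply: nbhs_right_lt; rewrite divr_gt0.
have H1 : {in I &, forall x y, x < y -> y - x <= d -> c y - c x != 0 /\
    enorm (S2val (unitv (c y - c x)) - f 1 ((x + y) / 2)) <= a * (y - x)}.
  by near: d; apply: (chord_tangent L_gt0 hC3 harc).
have H2 : {in I &, forall x y, x <= y -> y - x <= d ->
    `|geodS2 (tS x) (tS y) - (total_curvature y - total_curvature x)| <= a * (y - x)}.
  by near: d; apply: tangent_speed.
have H3 : {in I &, forall x y, `|y - x| <= d -> geodS2 (tS x) (tS y) <= a}.
  by near: d; apply: tangent_cont.
have H4 : {in I &, forall x y, `|y - x| <= d -> `|total_curvature y - total_curvature x| <= a}.
  by near: d; apply: total_curvature_sucont.
have NI i : N i \in I by exact: node_itv lamP i.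
have Nle i : N i <= N i.+1 by exact: (node_homo lamP (leqnSn i)).
have hm' i : N i.+1 - N i <= d by exact: hm.
pose m i := (N i.-1 + N i) / 2.
have mI i : m i \in I.
  apply: (itv_convex (NI i.-1) (NI i)); have : N i.-1 <= N i by exact: (node_homo lamP (leq_pred i)).
  by rewrite /m => ?; apply/andP; split; lra.
have sd i : (i < size lam)%N -> segment lam i.+1 != 0 /\
    geodS2 (seg_dir lam i.+1) (tS (m i.+1)) <= 4 * a * (N i.+1 - N i).
  move=> si; have [h1 h2] := H1 _ _ (NI i) (NI i.+1) (node_lt lamP si) (hm i).
  split => //; have t1 := tangent_unit L_gt0 hC3 harc (mI i.+1).
  by apply: le_trans (geodS2_unitv_le _ t1) _; rewrite -mulrA ler_pM2l.
have sd' i : (i < size lam)%N -> geodS2 (seg_dir lam i.+1) (tS (m i.+1)) <= 4 * a.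
  move=> si; have [_ h] := sd i si; apply: le_trans h _.
  by apply: ler_piMr; [rewrite mulr_ge0 ?(ltW a0)|exact: le_trans (hm i) d1].
have mN i : `|N i - m i.+1| <= d /\ `|N i.+1 - m i.+1| <= d.
  have := hm' i; have := Nle i; rewrite /m succnK => ? ?.
  by split; rewrite ler_norml; apply/andP; split; lra.
split.
- exact: mesh_size lamP hm d0 dL.
- by move=> i si; case: (sd i si).
- move=> i si; apply: le_trans (geodS2_triangle (tS (m i.+1)) _ _) _.
  by apply: le_trans (lerD (sd' i si) (H3 _ _ (mI i.+1) (NI i) (proj1 (mN i)))) _; lra.
- move=> i si; apply: le_trans (geodS2_triangle (tS (m i.+1)) _ _) _.
  by apply: le_trans (lerD (sd' i si) (H3 _ _ (mI i.+1) (NI i.+1) (proj2 (mN i)))) _; lra.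
move=> i si.
have C := @chain_sum _ (seg_dir lam) total_curvature m N L (5 * a) 1 i.+1.
have {}C : `|\sum_(1 <= j < i.+1) geodS2 (seg_dir lam j) (seg_dir lam j.+1)
     - (total_curvature (m i.+1) - total_curvature (m 1%N))| <= 5 * a * (3 * L).
  apply: C; [by rewrite mulr_ge0 ?(ltW a0)|by []|by move=> j; have := NI j; rewrite in_itv|].
  move=> [//|j] /andP[_ ji].
  have sj : (j < size lam)%N by apply: leq_trans si; rewrite ltnS in ji; exact: ltnW.
  have sj1 : (j.+1 < size lam)%N by apply: leq_trans si.
  have := Nle j; have := Nle j.+1; have := Nle j.+2.
  have : m j.+2 - m j.+1 = (N j.+2 - N j) / 2 by rewrite /m !succnK; field.
  have : m j.+1 <= m j.+2.
    by rewrite /m !succnK; have := Nle j; have := Nle j.+1; lra.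
  have : m j.+2 - m j.+1 <= d.
    by rewrite /m !succnK; have := hm' j; have := hm' j.+1; lra.
  move=> b1 b2 b3 b4 b5 b6.
  have := @dist_geodS2 _ _ _ _ _ _ _ _ _ (proj2 (sd j sj)) (proj2 (sd j.+1 sj1))
     (H2 _ _ (mI _) (mI _) b2 b1).
  move=> h; apply: le_trans h _; rewrite b3.
  have : 0 <= a * (N j.+3 - N j.+2) by rewrite mulr_ge0 ?(ltW a0)// subr_ge0.
  have : 0 <= a * (N j.+1 - N j) by rewrite mulr_ge0 ?(ltW a0)// subr_ge0.
  have : 0 <= a * (N j.+2 - N j.+1) by rewrite mulr_ge0 ?(ltW a0)// subr_ge0.
  rewrite succnK; lra.
have h1 := H4 _ _ (NI i) (mI i.+1); rewrite distrC in h1; have {}h1 := h1 (proj1 (mN i)).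
have h2 := H4 _ _ (NI 0%N) (mI 1%N); rewrite distrC in h2; have {}h2 := h2 (proj1 (mN 0%N)).
have K0 : total_curvature (N 0%N) = 0 by exact: Rintegral_start.
rewrite K0 subr0 in h2.
apply: le_trans (sum_error C h1 h2) _; clear -e0 a1 aL; lra.
Unshelve. all: by end_near. Qed.

(** As for tangents, with the centroids of three consecutive nodes as parameters. *)
Lemma fine_binormals (e : R) : 0 < e -> \forall d \near 0^'+, forall lam,
  itv_partition 0 L lam -> mesh_le lam d ->
  [/\ forall i, (i.+1 < size lam)%N -> cross (segment lam i.+1) (segment lam i.+2) != 0,
      forall i, (i.+1 < size lam)%N -> geodS2 (seg_binormal lam i.+1) (bS (nth L (0 :: lam) i.+1)) <= e &
      forall i, (i.+1 < size lam)%N ->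
        `|\sum_(1 <= j < i.+1) geodS2 (seg_binormal lam j) (seg_binormal lam j.+1)
            - total_torsion (nth L (0 :: lam) i.+1)| <= e].
Proof.
(* 27 a L from the sum over windows and 2 a from moving the nodes to the centroids. *)
move=> e0; pose a := e / (60 * (1 + L)).
have L1 : 0 < 1 + L by rewrite addr_gt0.
have a0 : 0 < a by rewrite divr_gt0// mulr_gt0.
have ae : a * (1 + L) = e / 60 by rewrite /a; field; rewrite gt_eqF.
have a1 : a <= e / 60 by rewrite -ae ler_pMr// lerDl ltW.
have aL : a * L <= e / 60 by rewrite -ae ler_pM2l// lerDr.
clear ae; clearbody a.
near (0 : R)^'+ => d0.
have d00 : 0 < d0 by near: d0; apply: nbhs_right_gt.
have d01 : d0 <= 1 by near: d0; apply: nbhs_right_le.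
have H1 : forall x y z, x \in I -> z \in I -> x < y -> y < z -> y - x <= d0 -> z - y <= d0 ->
    cross (c y - c x) (c z - c y) != 0 /\
    enorm (S2val (unitv (cross (c y - c x) (c z - c y))) - binormal 0 L c ((x + y + z) / 3))
      <= a * (z - x).
  by near: d0; apply: (binormal_dir L_gt0 hC3 harc hcurv).
have H2 : {in I &, forall x y, x <= y -> y - x <= d0 ->
    `|geodS2 (bS x) (bS y) - (total_torsion y - total_torsion x)| <= a * (y - x)}.
  by near: d0; apply: binormal_speed.
have H3 : {in I &, forall x y, `|y - x| <= d0 -> geodS2 (bS x) (bS y) <= a}.
  by near: d0; apply: binormal_cont.
have H4 : {in I &, forall x y, `|y - x| <= d0 -> `|total_torsion y - total_torsion x| <= a}.
  by near: d0; apply: total_torsion_sucont.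
apply: (@near0_le _ (d0 / 2)); first by rewrite divr_gt0.
move=> d dpos dd0 lam lamP hm; set N := nth L (0 :: lam).
have NI i : N i \in I by exact: node_itv lamP i.
have Nle i : N i <= N i.+1 by exact: (node_homo lamP (leqnSn i)).
have hm' i : N i.+1 - N i <= d by exact: hm.
pose m i := (N i.-1 + N i + N i.+1) / 3.
have mI i : m i \in I.
  apply: (itv_convex (NI i.-1) (NI i.+1)).
  have : N i.-1 <= N i by exact: (node_homo lamP (leq_pred i)).
  by have := Nle i; rewrite /m => ? ?; apply/andP; split; lra.
have sd i : (i.+1 < size lam)%N -> cross (segment lam i.+1) (segment lam i.+2) != 0 /\
    geodS2 (seg_binormal lam i.+1) (bS (m i.+1)) <= 4 * a * (N i.+2 - N i).
  move=> si.
  have le1 : N i.+1 - N i <= d0 by have := hm' i; lra.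
  have le2 : N i.+2 - N i.+1 <= d0 by have := hm' i.+1; lra.
  have [h1 h2] := H1 _ _ _ (NI i) (NI i.+2) (node_lt lamP (ltnW si)) (node_lt lamP si) le1 le2.
  split => //; have b1 := binormal_unit L_gt0 hC3 harc hcurv (mI i.+1).
  by apply: le_trans (geodS2_unitv_le _ b1) _; rewrite -mulrA ler_pM2l.
have mN i : `|N i.+1 - m i.+1| <= d0.
  have := hm' i; have := Nle i; have := hm' i.+1; have := Nle i.+1.
  rewrite /m succnK => ? ? ? ?.
  by rewrite ler_norml; apply/andP; split; lra.
split.
- by move=> i si; case: (sd i si).
- move=> i si; apply: le_trans (geodS2_triangle (bS (m i.+1)) _ _) _.
  have h3 := H3 _ _ (mI i.+1) (NI i.+1) (mN i).
  apply: le_trans (lerD (proj2 (sd i si)) h3) _.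
  have : 4 * a * (N i.+2 - N i) <= 4 * a * 1.
    by rewrite ler_pM2l ?mulr_gt0//; have := hm' i; have := hm' i.+1; lra.
  clear h3; lra.
move=> i si.
have C := @chain_sum _ (seg_binormal lam) total_torsion m N L (9 * a) 1 i.+1.
have {}C : `|\sum_(1 <= j < i.+1) geodS2 (seg_binormal lam j) (seg_binormal lam j.+1)
     - (total_torsion (m i.+1) - total_torsion (m 1%N))| <= 9 * a * (3 * L).
  apply: C; [by rewrite mulr_ge0 ?(ltW a0)|by []|by move=> j; have := NI j; rewrite in_itv|].
  move=> [//|j] /andP[_ ji].
  have sj1 : (j.+2 < size lam)%N by apply: leq_ltn_trans si.
  have sj : (j.+1 < size lam)%N by apply: ltnW.
  have := Nle j; have := Nle j.+1; have := Nle j.+2.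
  have : m j.+2 - m j.+1 = (N j.+3 - N j) / 3 by rewrite /m !succnK; field.
  move=> b3 b4 b5 b6.
  have b2 : m j.+1 <= m j.+2 by rewrite -subr_ge0 b3; lra.
  have b1 : m j.+2 - m j.+1 <= d0.
    by rewrite b3; have := hm' j; have := hm' j.+1; have := hm' j.+2; lra.
  have := @dist_geodS2 _ _ _ _ _ _ _ _ _ (proj2 (sd j sj)) (proj2 (sd j.+1 sj1))
     (H2 _ _ (mI _) (mI _) b2 b1).
  move=> h; apply: le_trans h _; rewrite b3.
  have : 0 <= a * (N j.+3 - N j.+2) by rewrite mulr_ge0 ?(ltW a0)// subr_ge0.
  have : 0 <= a * (N j.+1 - N j) by rewrite mulr_ge0 ?(ltW a0)// subr_ge0.
  have : 0 <= a * (N j.+2 - N j.+1) by rewrite mulr_ge0 ?(ltW a0)// subr_ge0.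
  rewrite succnK; lra.
have h1 := H4 _ _ (NI i.+1) (mI i.+1); rewrite distrC in h1; have {}h1 := h1 (mN i).
have h2 := H4 _ _ (NI 0%N) (mI 1%N).
have {}h2 : `|total_torsion (m 1%N) - total_torsion (N 0%N)| <= a.
  apply: h2; rewrite ler_norml; have := hm' 0%N; have := hm' 1%N; have := Nle 0%N; have := Nle 1%N.
  by rewrite /m succnK => ? ? ? ?; apply/andP; split; lra.
have K0 : total_torsion (N 0%N) = 0 by exact: Rintegral_start.
rewrite K0 subr0 in h2.
apply: le_trans (sum_error C h1 h2) _; clear -e0 a1 aL; lra.
Unshelve. all: by end_near. Qed.

End FinePolygons.

(** * Total curvature of inscribed polygonals *)

Section Tilt.
Context {R : realType}.
Implicit Types (a b d : S2 R) (p q : 'rV[R]_3).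

Lemma real_upper (u k b : R) : `|u - k| <= b -> u <= k + b.
Proof. by move=> /ler_normlW; lra. Qed.

Lemma telescoping_bound (u v k0 k1 k2 e s h : R) :
  u <= k1 - k0 + e * s -> v <= k2 - k1 + e * h -> u + v <= k2 - k0 + e * (s + h).
Proof. by lra. Qed.

(** Turning of a path that leaves in the direction [a], runs along [p] and arrives in
    the direction [b]; a vanishing [p] has no direction to pass through. *)
Definition tilt a p b : R :=
  if p == 0 then geodS2 a b else geodS2 a (unitv p) + geodS2 (unitv p) b.

Lemma geodS2_le_tilt a p b : geodS2 a b <= tilt a p b.
Proof. by rewrite /tilt; case: ifP => // _; exact: geodS2_triangle. Qed.

(** The direction of [p + q] lies on the arc between those of [p] and [q]. *)
Lemma tiltD a b d p q : tilt a (p + q) d <= tilt a p b + tilt b q d.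
Proof.
rewrite /tilt; have [->|p0] := eqVneq p 0.
  rewrite add0r; case: ifP => _; first exact: geodS2_triangle.
  by have := geodS2_triangle b a (unitv q); lra.
have [->|q0] := eqVneq q 0.
  rewrite addr0 (negbTE p0); by have := geodS2_triangle b (unitv p) d; lra.
have T := geodS2_triangle b (unitv p) (unitv q).
case: ifPn => [_|pq0].
  by have := geodS2_triangle (unitv p) a d; have := geodS2_triangle (unitv q) (unitv p) d; lra.
have := geodS2_unitvD p0 q0 pq0.
by have := geodS2_triangle (unitv p) a (unitv (p + q));
  have := geodS2_triangle (unitv q) (unitv (p + q)) d; lra.
Qed.

Lemma detour_bound a b d e (k1 k2 k3 eps h : R) : 0 <= eps * h ->
  geodS2 a d <= k2 - k1 + eps * (h / 2) -> geodS2 d b <= k3 - k2 + eps * (h / 2) ->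
  geodS2 e d <= 4 * (eps * h) -> geodS2 a e + geodS2 e b <= k3 - k1 + 9 * eps * h.
Proof.
have := geodS2_triangle d a e; have := geodS2_triangle d e b.
by rewrite [geodS2 d e]geodS2C; lra.
Qed.

End Tilt.

Section Vertices.
Context {R : realType}.
Implicit Types v : seq 'rV[R]_3.

Lemma vtx_le v i : (i <= nseg v)%N -> vtx v i = nth 0 v i.
Proof.
rewrite /vtx; case: ifP => // cl; rewrite leq_eqVlt => /orP[/eqP ->|h]; last by rewrite modn_small.
by rewrite modnn (eqP cl) -nth_last.
Qed.

Lemma vtx_period v i : closed_poly v -> vtx v (nseg v + i) = vtx v i.
Proof. by rewrite /vtx => ->; rewrite modnDl. Qed.

Lemma sg_le v i : (0 < i <= nseg v)%N -> sg v i = nth 0 v i - nth 0 v i.-1.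
Proof. by move=> /andP[_ h]; rewrite /sg !vtx_le// (leq_trans (leq_pred i)). Qed.

Lemma sg_period v i : closed_poly v -> (0 < i)%N -> sg v (nseg v + i) = sg v i.
Proof.
by case: i => // i cl _; rewrite /sg addnS -addnS !vtx_period// addnS /= vtx_period.
Qed.

Lemma tg_period v i : closed_poly v -> (0 < i)%N -> tg v (nseg v + i) = tg v i.
Proof. by move=> cl i0; rewrite /tg sg_period. Qed.

Lemma discard_id v :
  (forall i, (i.+1 < size v)%N -> nth 0 v i != nth 0 v i.+1) -> discard v = v.
Proof.
elim: v => // x [//|y v] IH h /=.
rewrite (negbTE (h 0%N isT)); congr cons; apply: IH => i; exact: (h i.+1).
Qed.

End Vertices.

Section Discard.
Context {R : realType} (c : R -> 'rV[R]_3).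

(** Every inscribed polygonal is thus inscribed at fewer nodes, with consecutive
    vertices distinct.  The last node of a run of equal vertices is kept, so the first
    kept node may be positive. *)
Lemma discard_subseq (x : R) (s : seq R) : exists s', [/\ subseq s' (x :: s),
  discard [seq c z | z <- x :: s] = [seq c z | z <- s'],
  s' <> [::] /\ last x s' = last x s,
  c (head x s') = c x &
  forall i, (i.+1 < size s')%N -> c (nth x s' i) != c (nth x s' i.+1)].
Proof.
elim: s x => [|y s IH] x.
  by exists [:: x]; split => //=; rewrite eqxx.
have [s' [sub eq [ne lst] hd nxt]] := IH y.
have [s1 [s2 s'E]] : exists s1 s2, s' = s1 :: s2 by case: s' ne {sub eq lst hd nxt} => // a b; exists a, b.
subst s'; rewrite /= in lst hd *.
have e j : (j < size (s1 :: s2))%N -> nth x (s1 :: s2) j = nth y (s1 :: s2) j.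
  exact: set_nth_default.
case: (eqVneq (c x) (c y)) => [cxy|cxy].
  exists (s1 :: s2); split => //.
  - by apply: subseq_trans sub (subseq_cons _ _).
  - by rewrite hd.
  - by move=> i hi; rewrite !e ?(ltnW hi)//; exact: nxt.
exists (x :: s1 :: s2); split => //.
- by rewrite /= eqxx.
- by congr cons.
- move=> [_|i hi] /=; first by rewrite hd.
  by have := nxt i hi; rewrite -!e// ltnW.
Qed.

End Discard.

Section TotalCurvature.
Context {R : realType}.
Variables (L : R) (c : R -> 'rV[R]_3).
Hypothesis L_gt0 : 0 < L.
Hypothesis hC3 : class_C 0 L c 3.
Hypothesis harc : arclength_param 0 L c.
Local Notation I := `[0, L].

Local Notation f k := (derivn_in 0 L k c).
Local Notation tS x := (unitv (f 1 x)).
Local Notation K := (total_curvature L c).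

Let turning x y := tilt (tS x) (c y - c x) (tS y).

Let turningD x y z : turning x z <= turning x y + turning y z.
Proof.
rewrite /turning (_ : c z - c x = (c y - c x) + (c z - c y)); first exact: tiltD.
by rewrite [RHS]addrC addrA subrK.
Qed.

Let turning_local (e : R) : 0 < e -> \forall d \near 0^'+,
  {in I &, forall x y, x < y -> y - x <= d -> turning x y <= K y - K x + 9 * e * (y - x)}.
Proof.
move=> e0.
apply: filterS2 (chord_tangent L_gt0 hC3 harc e0) (tangent_speed L_gt0 hC3 harc e0).
move=> d h1 h2 x y xI yI xy yxd.
have [p0 hm] := h1 x y xI yI xy yxd; rewrite /turning /tilt (negbTE p0).
set m := (x + y) / 2 in hm; have mI : m \in I.
  by apply: (itv_convex xI yI); rewrite /m; apply/andP; split; lra.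
have xm : x <= m by rewrite /m; lra.
have my : m <= y by rewrite /m; lra.
have mx : m - x = (y - x) / 2 by rewrite /m; field.
have ym : y - m = (y - x) / 2 by rewrite /m; field.
have A1 := h2 x m xI mI xm; rewrite mx in A1.
have A2 := h2 m y mI yI my; rewrite ym in A2.
have dm : (y - x) / 2 <= d by lra.
have {}A1 := A1 dm; have {}A2 := A2 dm.
have t1 := tangent_unit L_gt0 hC3 harc mI.
have D : geodS2 (unitv (c y - c x)) (tS m) <= 4 * (e * (y - x)).
  by apply: le_trans (geodS2_unitv_le _ t1) _; rewrite ler_pM2l.
apply: (detour_bound _ (real_upper A1) (real_upper A2) D).
by rewrite mulr_ge0 ?(ltW e0)// subr_ge0 ltW.
Qed.

(** Cut the interval into short equal pieces: by subadditivity the local estimate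
    propagates with an error proportional to the length, hence arbitrarily small. *)
Lemma turning_le_curvature x y : x \in I -> y \in I -> x <= y ->
  tilt (tS x) (c y - c x) (tS y) <= K y - K x.
Proof.
move=> xI yI xy; rewrite -/(turning x y).
have [->|yx] := eqVneq y x.
  by rewrite /turning /tilt subrr eqxx geodS2xx subrr.
have {yx}xy : x < y by rewrite lt_neqAle eq_sym yx.
apply/ler_addgt0Pr => e e0.
have e1 : 0 < e / (9 * (y - x)) by rewrite divr_gt0// mulr_gt0// subr_gt0.
have [d d0 hd] := near0_witness (turning_local e1).
(* Pieces of length [h <= d]. *)
pose n := Num.truncn ((y - x) / d); pose h := (y - x) / n.+1%:R.
have h0 : 0 < h by rewrite divr_gt0 ?subr_gt0.
have hd' : h <= d.
  rewrite ler_pdivrMr// mulrC -ler_pdivrMr//; apply/ltW/truncnS_gt.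
have xiE i : (i <= n.+1)%N -> x + i%:R * h <= y.
  move=> hi; rewrite -lerBrDl /h mulrCA -{2}[y - x]mulr1 ler_pM2l ?subr_gt0//.
  by rewrite ler_pdivrMr// mul1r ler_nat.
have xiI i : (i <= n.+1)%N -> x + i%:R * h \in I.
  move=> hi; apply: itv_convex xI yI _; rewrite (xiE i hi) andbT lerDl mulr_ge0// ltW//.
have step i : (i <= n.+1)%N ->
    turning x (x + i%:R * h) <= K (x + i%:R * h) - K x + 9 * (e / (9 * (y - x))) * (i%:R * h).
  elim: i => [_|i IH hi].
    by rewrite mul0r addr0 mulr0 /turning /tilt subrr eqxx geodS2xx subrr addr0.
  apply: le_trans (turningD x (x + i%:R * h) _) _.
  have dE : x + i.+1%:R * h - (x + i%:R * h) = h by rewrite -addn1 natrD; ring.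
  have lt1 : x + i%:R * h < x + i.+1%:R * h by rewrite -subr_gt0 dE.
  have := hd _ _ (xiI i (ltnW hi)) (xiI i.+1 hi) lt1; rewrite dE => /(_ hd') H.
  have -> : i.+1%:R * h = i%:R * h + h by rewrite -addn1 natrD mulrDl mul1r.
  have -> : x + (i%:R * h + h) = x + i.+1%:R * h by rewrite -addn1 natrD mulrDl mul1r.
  exact: telescoping_bound (IH (ltnW hi)) H.
have := step n.+1 (leqnn _).
have -> : n.+1%:R * h = y - x by rewrite /h mulrC divfK// pnatr_eq0.
have -> : 9 * (e / (9 * (y - x))) * (y - x) = e by field; rewrite gt_eqF// subr_gt0.
by rewrite addrC subrK.
Qed.

Lemma total_curvature0 : K 0 = 0. Proof. exact: Rintegral_start. Qed.

(** Insert the tangent of the curve at each vertex between the directions of the two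
    segments, and regroup the angles by segments.  For a closed polygonal the angle at
    the closing vertex passes through the common tangent at both ends of the curve and
    through the tangent at the first kept node. *)
Lemma TC_le_total_curvature lam : itv_partition 0 L lam ->
  TC (inscribed 0 c lam) <= K L.
Proof.
move=> lamP.
have LI : L \in I by rewrite in_itv/= lexx ltW.
have OI : 0 \in I by rewrite in_itv/= lexx ltW.
have [s' [sub vE [ne lst] hd nxt]] := discard_subseq c 0 lam.
set v := inscribed 0 c lam; have {}vE : v = [seq c z | z <- s'] by [].
pose kap i := nth 0 s' i.
have sE : size s' = (nseg v).+1 by rewrite /nseg vE size_map prednK// lt0n size_eq0; apply/eqP.
have s'lt : sorted <%O s' by apply: (subseq_sorted lt_trans sub); case: lamP.
have kapI i : (i <= nseg v)%N -> kap i \in I.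
  move=> hi; have : kap i \in 0 :: lam by apply: (mem_subseq sub); rewrite mem_nth// sE.
  by move=> /(nthP L)[j _ <-]; exact: node_itv.
have kaple i : (i < nseg v)%N -> kap i <= kap i.+1.
  move=> hi; rewrite ltW// (sorted_ltn_nth lt_trans)// inE sE ltnS//; exact: ltnW.
have kaplast : kap (nseg v) = L.
  have -> : nseg v = (size s').-1 by rewrite sE.
  rewrite /kap nth_last; case: lamP => _ /eqP <-; rewrite -lst.
  by case: s' ne {sub vE lst hd nxt kap sE s'lt kapI kaple}.
have nthv i : (i <= nseg v)%N -> nth 0 v i = c (kap i).
  by move=> hi; rewrite vE (nth_map 0)// sE.
have sgE i : (i < nseg v)%N -> sg v i.+1 = c (kap i.+1) - c (kap i).
  by move=> hi; rewrite sg_le// !nthv// ltnW.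
have sg0 i : (i < nseg v)%N -> c (kap i.+1) - c (kap i) != 0.
  by move=> hi; rewrite subr_eq0 eq_sym nxt// sE.
pose A i := geodS2 (tS (kap i)) (tg v i.+1).
pose B i := geodS2 (tg v i.+1) (tS (kap i.+1)).
have AB i : (i < nseg v)%N -> A i + B i <= K (kap i.+1) - K (kap i).
  move=> hi; have := turning_le_curvature (kapI i (ltnW hi)) (kapI i.+1 hi) (kaple i hi).
  by rewrite /tilt (negbTE (sg0 i hi)) -sgE.
pose D j := geodS2 (tg v j) (tg v j.+1).
have TD i : D i.+1 <= B i + A i.+1 by exact: geodS2_triangle.
have [A0 B0] : (forall i, 0 <= A i) /\ (forall i, 0 <= B i).
  by split=> i; exact: geodS2_ge0.
pose K0 := geodS2 (tS 0) (tS (kap 0%N)).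
have K0le : 0 <= K0 <= K (kap 0%N).
  have k0I : kap 0%N \in I by apply: kapI.
  have k0 : 0 <= kap 0%N by move: k0I; rewrite in_itv/= => /andP[].
  have := turning_le_curvature OI k0I k0; rewrite total_curvature0 subr0 => h.
  by rewrite geodS2_ge0 /=; apply: le_trans (geodS2_le_tilt _ _ _) h.
have KL0 : 0 <= K L.
  have := turning_le_curvature OI LI (ltW L_gt0); rewrite total_curvature0 subr0.
  by apply: le_trans; apply: le_trans (geodS2_ge0 _ _) (geodS2_le_tilt _ _ _).
have DL : closed_poly v -> (0 < nseg v)%N -> D (nseg v) <= B (nseg v).-1 + (K0 + A 0%N).
  move=> cl m0.
  have tgE : tg v (nseg v).+1 = tg v 1 by rewrite -addn1 tg_period.
  have c0L : c 0 = c L.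
    move: cl; rewrite /closed_poly -nth_last -/(nseg v) !nthv// kaplast => /eqP <-.
    by rewrite -hd /kap -nth0.
  have [_ _ /(_ c0L 1%N isT) per] := hC3.
  have BE : B (nseg v).-1 = geodS2 (tg v (nseg v)) (tS L) by rewrite /B (prednK m0) kaplast.
  have T1 := geodS2_triangle (tS L) (tg v (nseg v)) (tg v 1).
  have T2 : geodS2 (tS L) (tg v 1) <= K0 + A 0%N by rewrite -per; exact: geodS2_triangle.
  by rewrite BE /D tgE; exact: le_trans T1 (lerD (lexx _) T2).
rewrite /TC /turn_sum /nturn -/D.
have -> : \sum_(1 <= j < (if closed_poly v then nseg v else (nseg v).-1).+1)
    geodS2 (tg v j) (tg v j.+1) =
  \sum_(1 <= j < (if closed_poly v then nseg v else (nseg v).-1).+1) D j by [].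
clearbody A B D K0.
have sum i : (i < nseg v)%N ->
    A 0%N + \sum_(1 <= j < i.+1) D j + B i <= K (kap i.+1) - K (kap 0%N).
  elim: i => [hi|i IH hi].
    by rewrite big_geq// addr0; exact: AB.
  have {}IH := IH (ltnW hi); have AB' := AB i.+1 hi.
  by rewrite big_nat_recr//=; have := TD i; lra.
have [m0|m0] := posnP (nseg v); first by rewrite m0 if_same big_geq.
have := sum (nseg v).-1; rewrite prednK// kaplast => /(_ (leqnn _)).
have := A0 0%N; have := B0 (nseg v).-1.
case: ifP => cl; last by rewrite prednK//; lra.
by rewrite big_nat_recr//=; have := DL cl m0; lra.
Qed.

End TotalCurvature.

Section FineFrames.
Context {R : realType}.
Variables (L : R) (c : R -> 'rV[R]_3).
Hypothesis L_gt0 : 0 < L.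
Hypothesis hC3 : class_C 0 L c 3.
Hypothesis harc : arclength_param 0 L c.
Local Notation I := `[0, L].
Hypothesis hcurv : {in I, forall x, derivn_in 0 L 2 c x != 0}.

Local Notation f k := (derivn_in 0 L k c).
Local Notation tS x := (unitv (f 1 x)).
Local Notation bS x := (unitv (binormal 0 L c x)).
Local Notation K := (total_curvature L c).
Local Notation Th := (total_torsion L c).

(** Indices beyond the number of segments, used by closed polygonals, refer to the end
    point [L], which is the default value of [nth]. *)
Record frame_close (lam : seq R) (e : R) : Prop := FrameClose {
  close_nturn : (0 < nturn (inscribed 0 c lam))%N;
  close_tg : forall i, (1 <= i <= (nturn (inscribed 0 c lam)).+1)%N ->
    geodS2 (tg (inscribed 0 c lam) i) (tS (nth L (0 :: lam) i)) <= e;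
  close_bin : forall i, (1 <= i <= ntwist (inscribed 0 c lam))%N ->
    geodS2 (bin (inscribed 0 c lam) i) (bS (nth L (0 :: lam) i)) <= e;
  close_turn : forall i, (i <= nturn (inscribed 0 c lam))%N ->
    `|turn_sum (inscribed 0 c lam) i - K (nth L (0 :: lam) i)| <= e;
  close_twist : forall i, (1 <= i <= ntwist (inscribed 0 c lam))%N ->
    `|twist_sum (inscribed 0 c lam) i - Th (nth L (0 :: lam) i)| <= e;
  close_tg_step : forall i, (1 <= i <= nturn (inscribed 0 c lam))%N ->
    geodS2 (tg (inscribed 0 c lam) i) (tg (inscribed 0 c lam) i.+1) <= e;
  close_bin_step : forall i, (2 <= i <= ntwist (inscribed 0 c lam))%N ->
    geodS2 (bin (inscribed 0 c lam) i.-1) (bin (inscribed 0 c lam) i) <= e;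
  close_TC : `|TC (inscribed 0 c lam) - K L| <= e;
  close_TAT : `|TAT (inscribed 0 c lam) - Th L| <= e }.

Lemma geodS2_chain (y1 y2 z1 z2 : S2 R) (e : R) : geodS2 y1 z1 <= e -> geodS2 z1 z2 <= e ->
  geodS2 y2 z2 <= e -> geodS2 y1 y2 <= 3 * e.
Proof.
have := geodS2_triangle z1 y1 y2; have := geodS2_triangle z2 z1 y2.
by rewrite [geodS2 z2 y2]geodS2C; lra.
Qed.

Lemma add_small_step (s g k1 k2 e1 e2 e3 : R) : `|s - k1| <= e1 -> 0 <= g <= e2 ->
  `|k2 - k1| <= e3 -> `|s + g - k2| <= e1 + e2 + e3.
Proof. by rewrite !ler_norml => /andP[? ?] /andP[? ?] /andP[? ?]; apply/andP; split; lra. Qed.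

Lemma twist_sumS (v : seq 'rV[R]_3) i : (0 < i)%N ->
  twist_sum v i.+1 = twist_sum v i + geodRP2 (cls (bin v i)) (cls (bin v i.+1)).
Proof. by move=> i0; rewrite /twist_sum big_nat_recr. Qed.

Lemma turn_sumS (v : seq 'rV[R]_3) i :
  turn_sum v i.+1 = turn_sum v i + geodS2 (tg v i.+1) (tg v i.+2).
Proof. by rewrite /turn_sum big_nat_recr. Qed.

(** An open polygonal consists of the terms controlled so far.  A closed one has
    at most two more binormals and one more angle, each of them small because the frame
    of a closed curve closes up. *)
Lemma frame_close_fine (e : R) : 0 < e -> \forall d \near 0^'+, forall lam,
  itv_partition 0 L lam -> mesh_le L lam d -> frame_close lam e.
Proof.
(* [9 * a <= 1 <= pi / 2] makes the distance of consecutive binormals the same in the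
   sphere and in the projective plane. *)
move=> e0; pose a := Num.min (e / 40) (1 / 9).
have a0 : 0 < a by rewrite lt_min !divr_gt0.
have ae : a <= e / 40 by rewrite ge_min lexx.
have a9 : a <= 1 / 9 by rewrite ge_min lexx orbT.
clearbody a.
have [la3 la5 la21 l1121] : [/\ a <= 3 * a, a <= 5 * a, a <= 21 * a & 11 * a <= 21 * a].
  by split; lra.
have [l3e l5e l9e l21e] : [/\ 3 * a <= e, 5 * a <= e, 9 * a <= e & 21 * a <= e] by split; lra.
have [lae l5ae l21ae] : [/\ a <= e, 5 * a + a <= e & 21 * a + a <= e] by split; lra.
have pi1 : 9 * a <= pi / 2 by apply: (@le_trans _ _ 1); [lra|exact: pihalf_ge1].
have [E5 E11 E21 E9] : [/\ a + 3 * a + a = 5 * a, a + (9 * a + a) = 11 * a,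
    11 * a + (9 * a + a) = 21 * a & 3 * (3 * a) = 9 * a].
  by split; ring.
have a4 : 0 < a / 4 by rewrite divr_gt0.
have CL : \forall d \near 0^'+, c 0 = c L ->
  forall x z, x \in I -> z \in I -> x < L -> 0 < z -> L - x <= d -> z <= d ->
    cross (c L - c x) (c z - c 0) != 0 /\
    enorm (S2val (unitv (cross (c L - c x) (c z - c 0))) - binormal 0 L c L) <= a / 4.
  have [cl|ncl] := pselect (c 0 = c L).
    by apply: filterS (binormal_dir_closing L_gt0 hC3 harc hcurv cl a4) => d.
  by apply: filterE => d /ncl.
apply: filterS3 (filterI (fine_tangents L_gt0 hC3 harc a0) (fine_binormals L_gt0 hC3 harc hcurv a0))
   (filterI (tangent_cont L_gt0 hC3 harc a0) (binormal_cont L_gt0 hC3 harc hcurv a0))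
   (filterI CL (filterI (total_curvature_sucont L_gt0 hC3 a0)
                        (total_torsion_sucont L_gt0 hC3 harc hcurv a0))).
move=> d [H1 H2] [H3 H4] [H5 [H6 H7]] lam lamP hm {CL}.
have [n4 seg0 dirl dirr turn] := H1 lam lamP hm.
have [cr0 bdir twist] := H2 lam lamP hm.
set N := nth L (0 :: lam) in dirl dirr turn bdir twist; set n := size lam in n4 seg0 dirl dirr turn cr0 bdir twist.
have NI i : N i \in I by exact: node_itv lamP i.
have Nle i : N i <= N i.+1 by exact: (node_homo lamP (leqnSn i)).
have Nd i : `|N i.+1 - N i| <= d by rewrite ger0_norm ?subr_ge0//; exact: hm.
have N0 : N 0%N = 0 by [].
have NL i : (n <= i)%N -> N i = L by exact: node_over lamP i.
have n0 : (0 < n)%N by apply: leq_trans n4.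
pose v := inscribed 0 c lam.
have vE : v = [seq c z | z <- 0 :: lam].
  apply: discard_id => i; rewrite size_map => hi.
  have hi' : (i < size (0%R :: lam))%N by exact: ltnW hi.
  by rewrite (nth_map L)// (nth_map L)// eq_sym -subr_eq0; exact: (seg0 i).
have nE : nseg v = n by rewrite /nseg vE size_map.
have nthv i : (i <= n)%N -> nth 0 v i = c (N i) by move=> hi; rewrite vE (nth_map L).
have sgv i : (i < n)%N -> sg v i.+1 = segment L c lam i.+1.
  by move=> hi; rewrite sg_le ?nE// !nthv// ltnW.
have tgv i : (i < n)%N -> tg v i.+1 = seg_dir L c lam i.+1.
  by move=> hi; rewrite /tg sgv.
have binE i : cross (sg v i.+1) (sg v i.+2) != 0 ->
    bin v i.+1 = unitv (cross (sg v i.+1) (sg v i.+2)).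
  by move=> h; rewrite /= h.
have binv i : (i.+1 < n)%N -> bin v i.+1 = seg_binormal L c lam i.+1.
  by move=> hi; rewrite binE !sgv// ?(ltnW hi)//; exact: cr0.
have clE : closed_poly v -> c 0 = c L.
  by rewrite /closed_poly -nth_last -/(nseg v) nE !nthv// (NL n (leqnn n)) => /eqP.
have sgper i : closed_poly v -> (0 < i)%N -> sg v (n + i) = sg v i.
  by move=> cl i0; rewrite -nE sg_period.
have prn : n.-1.+1 = n by rewrite prednK.
have n1 : (1 < n)%N by apply: leq_trans n4.
(* The binormal at the closing vertex compares the chords at the two ends of the
   curve; the next one is the first binormal again. *)
have binn : closed_poly v -> geodS2 (bin v n) (bS L) <= a /\ bin v n.+1 = bin v 1.
  move=> cl; have s1 : sg v n.+1 = sg v 1 by have := sgper 1%N cl isT; rewrite addn1.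
  have s2 : sg v n.+2 = sg v 2 by have := sgper 2 cl isT; rewrite addn2.
  have cr1 : cross (sg v 1) (sg v 2) != 0 by rewrite (sgv 0%N)// (sgv 1%N)//; exact: cr0.
  split; last by rewrite binE s1 s2// (binE 0%N cr1).
  have xL : N n.-1 < L by have := node_lt lamP (_ : (n.-1 < n)%N); rewrite prn -/n leqnn node_size// => /(_ isT).
  have z0 : 0 < N 1%N by have := node_lt lamP n0.
  have xd : L - N n.-1 <= d by have := hm n.-1; rewrite prn -/n (node_size lamP).
  have zd : N 1%N <= d by have := hm 0%N; rewrite /= subr0.
  have [h1 h2] := H5 (clE cl) _ _ (NI _) (NI _) xL z0 xd zd.
  have E1 : sg v n = c L - c (N n.-1).
    have := sgv n.-1; rewrite prn leqnn => /(_ isT) ->.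
    by rewrite /segment -/N (NL n (leqnn n)).
  have E2 : sg v n.+1 = c (N 1%N) - c 0 by rewrite s1 (sgv 0%N n0).
  have -> : bin v n = unitv (cross (c L - c (N n.-1)) (c (N 1%N) - c 0)).
    have := binE n.-1; rewrite prn E1 E2; exact.
  have bL := binormal_unit L_gt0 hC3 harc hcurv (NI n); rewrite NL// in bL.
  by apply: le_trans (geodS2_unitv_le _ bL) _; rewrite mulrC -ler_pdivlMr.
have bS0 : closed_poly v -> bS L = bS 0 /\ tS L = tS 0.
  move=> /clE cl; have [_ _ /(_ cl) per] := hC3.
  split; last by rewrite (per 1%N isT).
  by rewrite /binormal /tangent /principal_normal (per 1%N isT) (per 2%N isT).
have tg_close i : (1 <= i <= (nturn v).+1)%N -> geodS2 (tg v i) (tS (N i)) <= a.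
  case: i => // i; rewrite /nturn nE; case: ifP => cl /=; rewrite ltnS; last first.
    by rewrite -ltnS prn => hi; rewrite tgv//; exact: dirr.
  rewrite leq_eqVlt => /orP[/eqP ->|hi]; last by rewrite tgv//; exact: dirr.
  have := tg_period cl (ltn0Sn 0); rewrite nE addn1 => ->.
  rewrite NL// (proj2 (bS0 cl)) tgv//; exact: (dirl 0%N).
have bin_close i : (1 <= i <= ntwist v)%N -> geodS2 (bin v i) (bS (N i)) <= 3 * a.
  have h3 (u : R) : u <= a -> u <= 3 * a by move=> h; exact: le_trans h la3.
  case: i => // i; rewrite /ntwist /nturn nE; case: ifP => cl /andP[_].
    rewrite addn1 ltnS leq_eqVlt => /orP[/eqP ->|hi].
      rewrite (proj2 (binn cl)) NL// (proj1 (bS0 cl)) binv//.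
      apply: (geodS2_chain (z1 := bS (N 1%N)) (z2 := bS 0)); first exact: (bdir 0%N n1).
        by rewrite geodS2C; exact: (H4 _ _ (NI 0%N) (NI 1%N) (Nd 0%N)).
      by rewrite geodS2xx ltW.
    have [hi'|hi'] := ltnP i.+1 n; first by rewrite binv//; apply/h3/bdir.
    have -> : i.+1 = n by apply/eqP; rewrite eqn_leq hi hi'.
    by rewrite NL//; apply/h3/(proj1 (binn cl)).
  rewrite addn0 => hi; have {}hi : (i.+1 < n)%N by rewrite -prn ltnS.
  by rewrite binv//; apply/h3/bdir.
have tg_step i : (1 <= i <= nturn v)%N -> geodS2 (tg v i) (tg v i.+1) <= 3 * a.
  move=> /andP[i1 hi]; apply: (geodS2_chain (z1 := tS (N i)) (z2 := tS (N i.+1))).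
  - by apply: tg_close; rewrite i1 ltnW.
  - exact: (H3 _ _ (NI i) (NI i.+1) (Nd i)).
  - by apply: tg_close; rewrite ltnS.
have bin_step i : (2 <= i <= ntwist v)%N -> geodS2 (bin v i.-1) (bin v i) <= 9 * a.
  case: i => [//|i] /andP[i1 hi]; rewrite -E9 succnK.
  apply: (geodS2_chain (z1 := bS (N i)) (z2 := bS (N i.+1))).
  - by apply: bin_close; rewrite -ltnS i1 (ltnW hi).
  - exact: le_trans (H4 _ _ (NI i) (NI i.+1) (Nd i)) la3.
  - by apply: bin_close; exact: hi.
have twE i : (2 <= i <= ntwist v)%N ->
    geodRP2 (cls (bin v i.-1)) (cls (bin v i)) = geodS2 (bin v i.-1) (bin v i).
  by move=> hi; apply: geodRP2_small; apply: le_trans (bin_step i hi) pi1.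
have ntw : (n.-1 <= ntwist v)%N.
  by rewrite /ntwist /nturn nE; case: ifP => _; rewrite ?addn0// (leq_trans (leq_pred n))// leq_addr.
have turn_open i : (i < n)%N -> `|turn_sum v i - K (N i)| <= a.
  move=> hi; rewrite /turn_sum.
  have -> : \sum_(1 <= j < i.+1) geodS2 (tg v j) (tg v j.+1) =
      \sum_(1 <= j < i.+1) geodS2 (seg_dir L c lam j) (seg_dir L c lam j.+1).
    apply: eq_big_nat => -[//|j] /andP[_ ji]; rewrite !tgv//.
      by apply: leq_ltn_trans hi; rewrite -ltnS.
    by apply: leq_ltn_trans hi; rewrite -ltnS ltnW.
  exact: turn.
have twist_open i : (i.+1 < n)%N -> `|twist_sum v i.+1 - Th (N i.+1)| <= a.
  move=> hi; rewrite /twist_sum big_add1 /=.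
  have -> : \sum_(1 <= j < i.+1) geodRP2 (cls (bin v j)) (cls (bin v j.+1)) =
      \sum_(1 <= j < i.+1) geodS2 (seg_binormal L c lam j) (seg_binormal L c lam j.+1).
    apply: eq_big_nat => -[//|j] /andP[_ ji].
    have j2 : (j.+2 < n)%N by apply: leq_ltn_trans hi.
    rewrite (twE j.+2); first by rewrite !binv// ltnW.
    by rewrite /=; apply: leq_trans ntw; rewrite -ltnS prn.
  exact: twist.
have turn_all i : (i <= nturn v)%N -> `|turn_sum v i - K (N i)| <= 5 * a.
  rewrite leq_eqVlt => /orP[/eqP ->|hi]; last first.
    have {}hi : (i < n)%N by apply: leq_trans hi _; rewrite /nturn nE; case: ifP => // _; exact: leq_pred.
    exact: le_trans (turn_open i hi) la5.
  have : (n.-1 < n)%N by rewrite prn.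
  move=> hn; have := turn_open _ hn; rewrite /nturn nE; case: ifP => cl to; last first.
    exact: le_trans to la5.
  have hs := tg_step n; rewrite /nturn cl nE leqnn n0 in hs.
  rewrite -{1}prn turn_sumS prn.
  have Nn : `|N n - N n.-1| <= d by have := Nd n.-1; rewrite prn.
  rewrite -E5; apply: (add_small_step to _ (H6 _ _ (NI n.-1) (NI n) Nn)).
  by rewrite geodS2_ge0 hs.
have twist_step i (b : R) : (0 < i)%N -> (i.+1 <= ntwist v)%N ->
    `|twist_sum v i - Th (N i)| <= b -> `|twist_sum v i.+1 - Th (N i.+1)| <= b + (9 * a + a).
  move=> i0 hi hb; rewrite twist_sumS//.
  have hi2 : (2 <= i.+1 <= ntwist v)%N by rewrite ltnS i0.
  rewrite (twE i.+1 hi2).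
  have := add_small_step hb (_ : 0 <= geodS2 (bin v i.+1.-1) (bin v i.+1) <= 9 * a)
     (H7 _ _ (NI i) (NI i.+1) (Nd i)).
  by rewrite geodS2_ge0 bin_step// addrA; apply.
have twist_all i : (1 <= i <= ntwist v)%N -> `|twist_sum v i - Th (N i)| <= 21 * a.
  case: i => // i /andP[_ hi].
  have [hi'|hi'] := ltnP i.+1 n; first exact: le_trans (twist_open i hi') la21.
  have n2 : exists k, n = k.+2 by case: (n) n1 => [|[|k]] // _; exists k.
  have [k nk] := n2.
  have tk : `|twist_sum v k.+1 - Th (N k.+1)| <= a by apply: twist_open; rewrite nk.
  have tn : (n <= ntwist v)%N by apply: leq_trans hi' hi.
  have tk2 : `|twist_sum v n - Th (N n)| <= 11 * a.
    have := twist_step k.+1 a isT; rewrite -nk E11; exact.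
  move: hi'; rewrite leq_eqVlt => /orP[/eqP <-|hi']; first exact: le_trans tk2 l1121.
  have -> : i.+1 = n.+1.
    apply/eqP; rewrite eqn_leq hi' andbT; apply: leq_trans hi _.
    by rewrite /ntwist /nturn nE; case: ifP => _; rewrite ?addn1// addn0 (leq_trans (leq_pred n)).
  by rewrite -E21; apply: twist_step => //; exact: leq_trans hi' hi.
have nturn0 : (0 < nturn v)%N by rewrite /nturn nE; case: ifP => // _; rewrite -ltnS prn.
have ntwist0 : (0 < ntwist v)%N by rewrite /ntwist ltn_addr.
have Nturn : N (nturn v) = L \/ nturn v = n.-1.
  by rewrite /nturn nE; case: ifP => _; [left; exact: NL|right].
have Nlast : `|L - N n.-1| <= d by have := Nd n.-1; rewrite prn (NL n (leqnn n)).
have LI : L \in I by rewrite in_itv/= lexx ltW.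
split.
- exact: nturn0.
- by move=> i hi; exact: le_trans (tg_close i hi) lae.
- by move=> i hi; exact: le_trans (bin_close i hi) l3e.
- by move=> i hi; exact: le_trans (turn_all i hi) l5e.
- by move=> i hi; exact: le_trans (twist_all i hi) l21e.
- by move=> i hi; exact: le_trans (tg_step i hi) l3e.
- by move=> i hi; exact: le_trans (bin_step i hi) l9e.
- have h1 := turn_all _ (leqnn (nturn v)).
  have h2 : `|K L - K (N (nturn v))| <= a.
    case: Nturn => ->; first by rewrite subrr normr0 ltW.
    by rewrite -/N; exact: (H6 _ _ (NI n.-1) LI Nlast).
  apply: le_trans (ler_distD (K (N (nturn v))) _ _) _; rewrite [X in _ + X]distrC.
  exact: le_trans (lerD h1 h2) l5ae.
- have h1 : `|twist_sum v (ntwist v) - Th (N (ntwist v))| <= 21 * a by apply: twist_all; rewrite ntwist0 leqnn.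
  have h2 : `|Th L - Th (N (ntwist v))| <= a.
    rewrite /ntwist /nturn nE; case: ifP => _.
      by rewrite NL ?subrr ?normr0 ?(ltW a0)// leq_addr.
    by rewrite addn0; exact: (H7 _ _ (NI n.-1) LI Nlast).
  apply: le_trans (ler_distD (Th (N (ntwist v))) _ _) _; rewrite [X in _ + X]distrC.
  exact: le_trans (lerD h1 h2) l21ae.
Qed.

End FineFrames.

(** * Normal indicatrices *)

Section MinimalArcs.
Context {R : realType}.
Implicit Types y z : S2 R.

(** The great circle through [y] with unit velocity [e] towards [z]. *)
Lemma S2_min_geodesic y z : geodS2 y z < pi -> exists g, min_geodesic (@geodS2 R) y z g.
Proof.
move=> dpi; set d := geodS2 y z; have d0 : 0 <= d by exact: geodS2_ge0.
have [dz|dn0] := eqVneq d 0.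
  exists (fun=> y); split => //; first exact: geodS2_eq0.
  move=> u w; rewrite -/d dz !in_itv/= => /andP[u0 u1] /andP[w0 w1].
  have -> : u = 0 by apply/eqP; rewrite eq_le u0 u1.
  have -> : w = 0 by apply/eqP; rewrite eq_le w0 w1.
  by rewrite geodS2xx subrr normr0.
have s0 : 0 < sin d by apply: sin_gt0_pi; rewrite lt_neqAle eq_sym dn0 d0.
have yz : dot y z = cos d by rewrite cos_geodS2.
pose e : 'rV[R]_3 := (sin d)^-1 *: (S2val z - cos d *: S2val y).
have ye : dot (S2val y) e = 0 by rewrite /e dotZr dotBr dotZr S2_dot yz mulr1 subrr mulr0.
have ee : dot e e = 1.
  rewrite /e dotZl dotZr dotBl !dotBr !dotZl !dotZr !S2_dot [dot z y]dotC yz.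
  have := cos2Dsin2 d => cs.
  have -> : 1 - cos d * cos d - (cos d * cos d - cos d * (cos d * 1)) = sin d ^+ 2.
    by rewrite sin2cos2; ring.
  by field; rewrite gt_eqF.
have zE : cos d *: S2val y + sin d *: e = z.
  by rewrite /e scalerA mulfV ?gt_eqF// scale1r addrC subrK.
clearbody e.
pose G (u : R) : 'rV[R]_3 := cos u *: S2val y + sin u *: e.
have GG u w : dot (G u) (G w) = cos (u - w).
  rewrite /G !(dotDl, dotDr, dotZl, dotZr) S2_dot ee ye [dot e y]dotC ye cosB; ring.
have G1 u : enorm (G u) = 1.
  by apply/eqP; rewrite -(@eqrXn2 _ 2) ?enorm_ge0// sqr_enorm GG subrr cos0 expr1n.
have Gv u : S2val (unitv (G u)) = G u by rewrite unitv_unit.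
exists (fun u => unitv (G u)); split.
- by apply: val_inj; rewrite /= Gv /G cos0 sin0 scale1r scale0r addr0.
- by apply: val_inj; rewrite /= Gv /G zE.
- move=> u w; rewrite !in_itv/= => /andP[u0 ud] /andP[w0 wd].
  rewrite /geodS2 !Gv GG.
  have [uw|/ltW wu] := leP w u.
    by rewrite ger0_norm ?subr_ge0// cosK// in_itv/=; apply/andP; split; lra.
  rewrite distrC ger0_norm ?subr_ge0// -cosN opprB cosK// in_itv/=.
  by apply/andP; split; lra.
Qed.

Lemma RP2_min_geodesic (p q : RP2 R) : exists G, min_geodesic (@geodRP2 R) p q G.
Proof.
have [y ->] := RP2P p; have [z -> dE] := geodRP2_lift y q.
have dpi : geodS2 y z <= pi / 2 by rewrite -dE geodRP2_le_pihalf.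
have [|g [g0 gd gg]] := @S2_min_geodesic y z; first by have := @pi_gt0 R; lra.
exists (fun x => cls (g x)); split; rewrite ?dE ?g0 ?gd//.
move=> u w uI wI; rewrite geodRP2_small gg//.
move: uI wI; rewrite !in_itv/= => /andP[? ?] /andP[? ?].
by rewrite ler_norml; apply/andP; split; lra.
Qed.

Lemma glue_pieces (X : Type) (p : nat -> R) (F : nat -> R -> X) (m : nat) :
  (forall j, p j <= p j.+1) ->
  (forall j, (j.+1 < m)%N -> F j (p j.+1) = F j.+1 (p j.+1)) ->
  exists G : R -> X, forall j, (j < m)%N -> {in `[p j, p j.+1], forall s, G s = F j s}.
Proof.
move=> pm; case: m => [|m agree]; first by exists (F 0%N).
have pmono : {homo p : i j / (i <= j)%N >-> i <= j}.
  by apply: homo_leq => // x y z; exact: le_trans.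
elim: m agree => [agree|m IH agree].
  by exists (F 0%N) => -[|//] _ s.
have [|G hG] := IH; first by move=> j jm; apply: agree; exact: ltnW.
exists (fun s => if s <= p m.+1 then G s else F m.+1 s) => j; rewrite ltnS leq_eqVlt.
move=> /orP[/eqP -> s|jm s]; rewrite in_itv/= => /andP[s1 s2].
  case: ifP => // s3; have -> : s = p m.+1 by apply/eqP; rewrite eq_le s1 s3.
  have pI : p m.+1 \in `[p m, p m.+1] by rewrite in_itv/= pm lexx.
  by rewrite (hG m (ltnSn m) _ pI); exact: agree.
have sI : s \in `[p j, p j.+1] by rewrite in_itv/= s1.
by rewrite (le_trans s2 (pmono _ _ jm)) (hG j jm s sI).
Qed.

End MinimalArcs.

Section Indicatrix.
Context {R : realType}.
Implicit Types v : seq 'rV[R]_3.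

Let C v := turn_sum v.
Let T v := twist_sum v.

Lemma turn_sum0 v : turn_sum v 0 = 0. Proof. by rewrite /turn_sum big_geq. Qed.
Lemma twist_sum1 v : twist_sum v 1 = 0. Proof. by rewrite /twist_sum big_geq. Qed.

Lemma turn_sum_leS v i : turn_sum v i <= turn_sum v i.+1.
Proof. by rewrite (turn_sumS v i) lerDl geodS2_ge0. Qed.

Lemma twist_sum_leS v i : twist_sum v i.+1 <= twist_sum v i.+2.
Proof. by rewrite (twist_sumS v (ltn0Sn i)) lerDl geodRP2_ge0. Qed.

Lemma ntwist_le v : (nturn v <= ntwist v <= (nturn v).+1)%N.
Proof. by rewrite /ntwist leq_addr -addn1 leq_add2l; case: closed_poly. Qed.

(** A turning arc and the twisting arc after it form one piece of the curve; minimal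
    arcs in the projective plane always exist, so even the last piece may be given
    its twisting arc. *)
Lemma normal_indicatrix_exists v :
  (forall i, (1 <= i <= nturn v)%N -> geodS2 (tg v i) (tg v i.+1) < pi) ->
  exists n, normal_indicatrix v n.
Proof.
move=> hpi.
have /choice[g hg] : forall i, exists g, (1 <= i <= nturn v)%N ->
    min_geodesic (@geodS2 R) (tg v i) (tg v i.+1) g.
  move=> i; have [hi|_] := boolP (1 <= i <= nturn v)%N; last by exists (fun=> pole).
  by have [g hg] := S2_min_geodesic (hpi i hi); exists g.
have /choice[G hG] : forall i, exists G,
    min_geodesic (@geodRP2 R) (cls (bin v i.-1)) (cls (bin v i)) G.
  by move=> i; exact: RP2_min_geodesic.
pose A i := C v i + T v i.+1; pose B i := C v i.+1 + T v i.+1.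
have AB i : A i <= B i by rewrite lerD2r turn_sum_leS.
have BA i : B i <= A i.+1 by rewrite lerD2l twist_sum_leS.
have ABE i : B i - A i = geodS2 (tg v i.+1) (tg v i.+2).
  by rewrite /A /B /C (turn_sumS v i); ring.
have BAE i : A i.+1 - B i = geodRP2 (cls (bin v i.+1)) (cls (bin v i.+2)).
  by rewrite /A /B /T (twist_sumS v (ltn0Sn i)); ring.
pose F i (s : R) : RP2 R * RP2 R := if s <= B i then (cls (g i.+1 (s - A i)), cls (bin v i.+1))
  else (cls (tg v i.+2), G i.+2 (s - B i)).
have gB i : (i < nturn v)%N -> g i.+1 (B i - A i) = tg v i.+2.
  by move=> hi; have [] := hg i.+1 hi; rewrite ABE.
have g0 i : (i < nturn v)%N -> g i.+1 0 = tg v i.+1.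
  by move=> hi; have [] := hg i.+1 hi.
have [|i hi|H hH] := @glue_pieces _ _ A F (nturn v); first by move=> i; exact: le_trans (AB i) (BA i).
  rewrite [RHS]/F AB subrr g0// /F; case: ifP => h.
    have E : A i.+1 = B i by apply/eqP; rewrite eq_le h BA.
    have bE : cls (bin v i.+1) = cls (bin v i.+2).
      by apply: geodRP2_eq0; rewrite -BAE E subrr.
    by rewrite E (gB i (ltnW hi)) bE.
  by congr (_, _); have [_] := hG i.+2; rewrite /= -BAE.
exists (fun s => crossRP2 (H s).2 (H s).1), (fun s => (H s).1), (fun s => (H s).2).
split => //.
- case=> [//|i] hi; exists (g i.+1); split.
  + exact: hg.
  + by move=> anti; have := hpi i.+1 hi; rewrite anti geodS2_antipode geodS2xx subr0 ltxx.
  + move=> s sI; have hs : H s = F i s.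
      apply: hH => //; move: sI; rewrite !in_itv/= -/(A i) -/(B i) => /andP[-> sB] /=.
      exact: le_trans sB (BA i).
    by rewrite hs /F ifT//; move: sI; rewrite in_itv/= => /andP[].
- case=> [|[|i]] // hi; exists (G i.+2); split; first exact: (hG i.+2).
  move=> s sI; have hi' : (i < nturn v)%N.
    by have /andP[_ h] := ntwist_le v; move: hi => /andP[_ h']; rewrite -ltnS; exact: leq_trans h' h.
  move: sI; rewrite in_itv/= -/(B i) -/(A i.+1) => /andP[Bs sA].
  have hs : H s = F i s.
    by apply: hH => //; rewrite in_itv/= sA andbT; exact: le_trans (AB i) Bs.
  rewrite hs /F; case: ifP => h//=.
  have -> : s = B i by apply/eqP; rewrite eq_le h Bs.
  by rewrite gB// subrr; have [-> _ _] := hG i.+2.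
Qed.

(** Along each arc only one component of the frame moves, and by at most the length
    of the arc. *)
Lemma indicatrix_stage v n (e : R) (s : R) : (0 < nturn v)%N ->
  (forall i, (1 <= i <= nturn v)%N -> geodS2 (tg v i) (tg v i.+1) <= e) ->
  (forall i, (2 <= i <= ntwist v)%N -> geodRP2 (cls (bin v i.-1)) (cls (bin v i)) <= e) ->
  normal_indicatrix v n -> s \in `[0, TC v + TAT v] ->
  exists i (p q : RP2 R), [/\ (1 <= i <= nturn v)%N,
    `|s - (turn_sum v i + twist_sum v i)| <= e,
    geodRP2 (cls (bin v i)) p <= e, geodRP2 (cls (tg v i)) q <= e & n s = crossRP2 p q].
Proof.
move=> nt0 ht hb [tt [bb [hturn htwist hn]]] sI.
have e0 : 0 <= e by apply: le_trans (geodS2_ge0 _ _) (ht 1%N _); rewrite nt0.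
move: (sI); rewrite in_itv/= => /andP[s0 s1].
pose A i := C v i + T v i.+1.
have /andP[nt1 nt2] := ntwist_le v.
have cover k : s <= A k -> (0 < k)%N -> exists2 i, (i < k)%N & A i <= s <= A i.+1.
  elim: k => // k IH sk _; have [h|/ltW h] := leP s (A k); last by exists k; rewrite ?ltnSn ?h.
  case: k IH sk h => [IH sk h|k IH sk h].
    exists 0%N => //; rewrite sk andbT; apply: le_trans s0.
    by rewrite /A /C /T turn_sum0 twist_sum1 addr0.
  by have [i ik hi] := IH h isT; exists i => //; exact: ltnW.
have sA : s <= A (nturn v).
  apply: le_trans s1 _; rewrite /A /TC /TAT lerD2l /T; move: nt2; rewrite leq_eqVlt.
  move=> /orP[/eqP -> //|]; rewrite ltnS => h.
  have -> : ntwist v = nturn v by apply/eqP; rewrite eqn_leq h nt1.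
  by case: (nturn v) nt0 => // k _; exact: twist_sum_leS.
have [i ik /andP[As sA1]] := cover _ sA nt0.
have sn := hn s sI.
have [sB|Bs] := leP s (C v i.+1 + T v i.+1).
  exists i.+1, (bb s), (tt s); have hi : (1 <= i.+1 <= nturn v)%N by [].
  have [g [[g0 gd gg] _ hs]] := hturn i.+1 hi.
  have sJ : s \in `[turn_sum v i.+1.-1 + twist_sum v i.+1, turn_sum v i.+1 + twist_sum v i.+1].
    by rewrite in_itv/=; apply/andP; split; [exact: As|exact: sB].
  have [ts bs] := hs s sJ.
  have dE : C v i.+1 + T v i.+1 - A i = geodS2 (tg v i.+1) (tg v i.+2).
    by rewrite /A /C (turn_sumS v i); ring.
  have {}ts : tt s = cls (g (s - A i)) by exact: ts.
  have x0 : 0 <= s - A i by rewrite subr_ge0.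
  have x1 : s - A i <= geodS2 (tg v i.+1) (tg v i.+2) by rewrite -dE lerD2r.
  have {}de := ht i.+1 hi.
  split => //.
  + rewrite distrC ger0_norm ?subr_ge0//; apply: le_trans de.
    by rewrite -dE /C /T lerD2l lerN2.
  + by rewrite bs geodRP2xx.
  + rewrite ts; apply: le_trans (geodRP2_le _ _) _.
    have m0 : 0 \in `[0, geodS2 (tg v i.+1) (tg v i.+2)] by rewrite in_itv/= lexx geodS2_ge0.
    have m1 : s - A i \in `[0, geodS2 (tg v i.+1) (tg v i.+2)] by rewrite in_itv/= x0 x1.
    by rewrite -g0 (gg _ _ m0 m1) sub0r normrN ger0_norm//; exact: le_trans x1 de.
have i2 : (i.+2 <= ntwist v)%N.
  rewrite ltnNge; apply/negP => h.
  have E1 : i.+1 = nturn v by apply/eqP; rewrite eqn_leq ik (leq_trans nt1 h).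
  have E2 : ntwist v = nturn v by apply/eqP; rewrite eqn_leq nt1 -E1 h.
  by move: s1; rewrite /TC /TAT E2 -E1 leNgt Bs.
have hi : (2 <= i.+2 <= ntwist v)%N by [].
have [G [[G0 Gd GG] hs]] := htwist i.+2 hi.
have dE : C v i.+1 + T v i.+2 - (C v i.+1 + T v i.+1) =
    geodRP2 (cls (bin v i.+1)) (cls (bin v i.+2)).
  by rewrite /T (twist_sumS v (ltn0Sn i)); ring.
have sJ : s \in `[turn_sum v i.+2.-1 + twist_sum v i.+2.-1, turn_sum v i.+2.-1 + twist_sum v i.+2].
  by rewrite in_itv/=; apply/andP; split; [exact: ltW Bs|exact: sA1].
have [ts bs] := hs s sJ.
have {}ts : tt s = cls (tg v i.+2) by exact: ts.
set B := C v i.+1 + T v i.+1 in Bs dE.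
have {}bs : bb s = G (s - B) by exact: bs.
have x0 : 0 <= s - B by rewrite subr_ge0 ltW.
have x1 : s - B <= geodRP2 (cls (bin v i.+1)) (cls (bin v i.+2)) by rewrite -dE lerD2r.
have de : geodRP2 (cls (bin v i.+1)) (cls (bin v i.+2)) <= e by exact: (hb i.+2 hi).
exists i.+1, (bb s), (tt s); split => //.
+ by rewrite ger0_norm//; exact: le_trans x1 de.
+ rewrite bs.
  have m0 : 0 \in `[0, geodRP2 (cls (bin v i.+1)) (cls (bin v i.+2))].
    by rewrite in_itv/= lexx geodRP2_ge0.
  have m1 : s - B \in `[0, geodRP2 (cls (bin v i.+1)) (cls (bin v i.+2))].
    by rewrite in_itv/= x0 x1.
  have := GG _ _ m0 m1; rewrite G0 sub0r normrN (ger0_norm x0) succnK => ->.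
  exact: le_trans x1 de.
+ rewrite ts; apply: le_trans (geodRP2_le _ _) _; exact: ht.
Qed.

End Indicatrix.

Section IndicatrixLimit.
Context {R : realType}.
Variables (L : R) (c : R -> 'rV[R]_3).
Hypothesis L_gt0 : 0 < L.
Hypothesis hC3 : class_C 0 L c 3.
Hypothesis harc : arclength_param 0 L c.
Local Notation I := `[0, L].
Hypothesis hcurv : {in I, forall x, derivn_in 0 L 2 c x != 0}.

Local Notation f k := (derivn_in 0 L k c).
Local Notation tS x := (unitv (f 1 x)).
Local Notation bS x := (unitv (binormal 0 L c x)).
Local Notation K := (total_curvature L c).
Local Notation Th := (total_torsion L c).

Lemma frame_close_indicatrix lam (e : R) : e <= 1 -> frame_close L c lam e ->
  exists n, normal_indicatrix (inscribed 0 c lam) n.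
Proof.
move=> e1 fc; apply: normal_indicatrix_exists => i hi.
apply: le_lt_trans (close_tg_step fc hi) _; apply: le_lt_trans e1 _.
by have := @pihalf_ge1 R; have := @pi_gt0 R; lra.
Qed.

Lemma unitv_cross_frame x : x \in I ->
  unitv (cross (bS x) (tS x)) = principal_normal 0 L c x.
Proof.
move=> xI; have bx := binormal_unit L_gt0 hC3 harc hcurv xI.
have tx := tangent_unit L_gt0 hC3 harc xI.
by rewrite (unitv_unit bx) (unitv_unit tx) (cross_binormal_tangent L_gt0 hC3 harc hcurv xI) unitv_S2.
Qed.

Lemma dot_binormal_tangent x : x \in I -> dot (bS x) (tS x) = 0.
Proof.
move=> xI; have bx := binormal_unit L_gt0 hC3 harc hcurv xI.
have tx := tangent_unit L_gt0 hC3 harc xI.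
by rewrite (unitv_unit bx) (unitv_unit tx) dotC dot_cross_l.
Qed.

Lemma indicatrix_near_normal lam n (e s : R) : itv_partition 0 L lam -> e <= 1 / 32 ->
  frame_close L c lam e -> normal_indicatrix (inscribed 0 c lam) n ->
  s \in `[0, TC (inscribed 0 c lam) + TAT (inscribed 0 c lam)] ->
  exists x, [/\ x \in I, `|s - (K x + Th x)| <= 3 * e &
    geodRP2 (cls (principal_normal 0 L c x)) (n s) <= 32 * e].
Proof.
move=> lamP e32 fc hn sI; set v := inscribed 0 c lam in hn sI *.
have hb i : (2 <= i <= ntwist v)%N -> geodRP2 (cls (bin v i.-1)) (cls (bin v i)) <= e.
  by move=> hi; apply: le_trans (geodRP2_le _ _) (close_bin_step fc hi).
have [i [p [q [hi hs hp hq nE]]]] :=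
  indicatrix_stage (close_nturn fc) (@close_tg_step _ _ _ _ _ fc) hb hn sI.
have /andP[i1 i2] := hi.
have itw : (1 <= i <= ntwist v)%N.
  by rewrite i1; apply: leq_trans i2 _; have /andP[] := ntwist_le v.
have itg : (1 <= i <= (nturn v).+1)%N by rewrite i1 ltnW.
have xI := node_itv lamP i; exists (nth L (0 :: lam) i); split => //.
  have := close_turn fc i2; have := close_twist fc itw; rewrite -/v.
  move: hs; rewrite !ler_norml => /andP[? ?] /andP[? ?] /andP[? ?]; apply/andP; split; lra.
rewrite nE -(unitv_cross_frame xI).
have -> : 32 * e = 16 * (2 * e) by ring.
apply: crossRP2_near; [exact: dot_binormal_tangent|lra| |].
- apply: le_trans (geodRP2_triangle (cls (bin v i)) _ _) _.
  have h1 : geodRP2 (cls (bS (nth L (0 :: lam) i))) (cls (bin v i)) <= e.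
    by apply: le_trans (geodRP2_le _ _) _; rewrite geodS2C; exact: close_bin fc _ itw.
  by apply: le_trans (lerD h1 hp) _; lra.
- apply: le_trans (geodRP2_triangle (cls (tg v i)) _ _) _.
  have h1 : geodRP2 (cls (tS (nth L (0 :: lam) i))) (cls (tg v i)) <= e.
    by apply: le_trans (geodRP2_le _ _) _; rewrite geodS2C; exact: close_tg fc _ itg.
  by apply: le_trans (lerD h1 hq) _; lra.
Qed.

End IndicatrixLimit.

(** * Modulus and mesh *)

Section UniformPartition.
Context {R : realType}.
Variable L : R.
Hypothesis L_gt0 : 0 < L.

Definition uniform_partition (k : nat) : seq R :=
  mkseq (fun i => i.+1%:R * (L / k.+1%:R)) k.+1.

Lemma uniform_node k i : (i <= k.+1)%N ->
  nth L (0 :: uniform_partition k) i = i%:R * (L / k.+1%:R).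
Proof. by case: i => [|i] hi; [rewrite mul0r|rewrite /= nth_mkseq]. Qed.

Lemma uniform_partitionP k : itv_partition 0 L (uniform_partition k).
Proof.
have h0 : 0 < L / k.+1%:R by rewrite divr_gt0.
split.
  apply/(pathP L) => i; rewrite size_mkseq => hi.
  rewrite uniform_node ?(ltnW hi)// nth_mkseq// ltr_pM2r// ltr_nat//.
rewrite (last_nth L) size_mkseq uniform_node//.
by rewrite mulrC divfK// pnatr_eq0.
Qed.

Lemma uniform_mesh k : mesh_le L (uniform_partition k) (L / k.+1%:R).
Proof.
move=> i; have [hi|hi] := ltnP i k.+1.
  by rewrite !uniform_node ?(ltnW hi)// -mulrBl -natrB// subSnn mul1r.
have sz : size (uniform_partition k) = k.+1 by rewrite size_mkseq.
rewrite !(node_over (uniform_partitionP k)) ?sz// ?subrr ?(leq_trans hi)//.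
by rewrite divr_ge0// ltW.
Qed.

End UniformPartition.

Section Modulus.
Context {R : realType}.
Variables (L : R) (c : R -> 'rV[R]_3).
Hypothesis L_gt0 : 0 < L.
Hypothesis hC3 : class_C 0 L c 3.
Hypothesis harc : arclength_param 0 L c.
Local Notation I := `[0, L].

Lemma arc_diam_le x y : x \in I -> y \in I -> x <= y -> diam (c @` `[x, y]) <= y - x.
Proof.
move=> xI yI xy; apply: ge_sup.
  by exists (edist (c x) (c x)); exists (c x); [|exists (c x) => //]; exists x => //=; rewrite in_itv/= lexx.
move=> _ [_ [p /= + <-] [_ [q /= + <-] <-]]; rewrite !in_itv/= => /andP[p1 p2] /andP[q1 q2].
have pI : p \in I by apply: (itv_convex xI yI); rewrite p1.
have qI : q \in I by apply: (itv_convex xI yI); rewrite q1.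
rewrite /edist edistC; apply: le_trans (arclength_edist harc pI qI) _.
by rewrite ler_norml; apply/andP; split; lra.
Qed.

Lemma arc_diam_ge x y p q : x \in I -> y \in I -> p \in `[x, y] -> q \in `[x, y] ->
  enorm (c q - c p) <= diam (c @` `[x, y]).
Proof.
move=> xI yI pxy qxy; rewrite edistC; apply: ub_le_sup.
  exists (y - x) => _ [_ [u /= + <-] [_ [w /= + <-] <-]]; rewrite !in_itv/= => /andP[u1 u2] /andP[w1 w2].
  have uI : u \in I by apply: (itv_convex xI yI); rewrite u1.
  have wI : w \in I by apply: (itv_convex xI yI); rewrite w1.
  rewrite /edist edistC; apply: le_trans (arclength_edist harc uI wI) _.
  by rewrite ler_norml; apply/andP; split; lra.
by exists (c p); [exists p|exists (c q) => //; exists q].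
Qed.


Lemma modulus_le_mesh lam (d : R) : itv_partition 0 L lam -> 0 <= d -> mesh_le L lam d ->
  0 <= modulus 0 L c lam <= d.
Proof.
move=> lamP d0 hm; apply/andP; split; first exact: bigmax_ge_id.
apply: bigmax_le => // i _.
have le1 := node_homo lamP (leqnSn i).
exact: le_trans (arc_diam_le (node_itv lamP i) (node_itv lamP i.+1) le1) (hm i).
Qed.

(** An arc of a unit-speed curve has diameter at least half its length as long as
    the latter is small, even when the end points of the arc are close. *)
Lemma mesh_le_modulus (d : R) : 0 < d -> \forall e \near 0^'+, forall lam,
  itv_partition 0 L lam -> modulus 0 L c lam < e -> mesh_le L lam d.
Proof.
move=> d0; have h2 : 0 < 1 / 2 :> R by rewrite divr_gt0.
have [b b0 hb] := near0_witness (curve_udiff01 L_gt0 hC3 h2).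
pose s := Num.min b d; have s0 : 0 < s by rewrite lt_min b0 d0.
have sb : s <= b by rewrite ge_min lexx.
have sd : s <= d by rewrite ge_min lexx orbT.
clearbody s; apply: (@near0_le _ (s / 2)); first by rewrite divr_gt0.
move=> e _ es lam lamP hmod i.
have [hi|hi] := ltnP i (size lam); last first.
  by rewrite !(node_over lamP) ?subrr ?(ltW d0)// leqW.
rewrite leNgt; apply/negP => hd.
set x := nth L (0 :: lam) i in hd; set y := nth L (0 :: lam) i.+1 in hd.
have xI : x \in I by exact: node_itv lamP i.
have yI : y \in I by exact: node_itv lamP i.+1.
have qI : x + s \in I by apply: (itv_convex xI yI); apply/andP; split; lra.
have pxy : x \in `[x, y] by rewrite in_itv/= lexx; lra.
have qxy : x + s \in `[x, y] by rewrite in_itv/=; apply/andP; split; lra.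
have lo := arc_diam_ge xI yI pxy qxy.
have hi' : diam (c @` `[x, y]) <= modulus 0 L c lam.
  rewrite /modulus; apply: le_trans (le_bigmax _ _ (Ordinal hi)); exact: lexx.
have ch : s / 2 <= enorm (c (x + s) - c x).
  have xs : x + s - x = s by rewrite addrAC subrr add0r.
  have := hb _ _ xI qI; rewrite xs (gtr0_norm s0) => /(_ sb) A.
  have := enorm_le_dist (s *: derivn_in 0 L 1 c x) (c (x + s) - c x).
  rewrite enormZ (gtr0_norm s0) (tangent_unit L_gt0 hC3 harc xI) mulr1 [enorm (_ - (_ - _))]edistC => B.
  by have := le_trans B (lerD (lexx _) A); lra.
have := le_lt_trans (le_trans ch (le_trans lo hi')) hmod.
by rewrite ltNge es.
Qed.

End Modulus.

Section Totals.
Context {R : realType}.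
Variables (L : R) (c : R -> 'rV[R]_3).
Hypothesis L_gt0 : 0 < L.
Hypothesis hC3 : class_C 0 L c 3.
Hypothesis harc : arclength_param 0 L c.
Local Notation I := `[0, L].
Hypothesis hcurv : {in I, forall x, derivn_in 0 L 2 c x != 0}.
Local Notation K := (total_curvature L c).
Local Notation Th := (total_torsion L c).

(** * Total curvature, total torsion and the weak principal normal of a curve *)

Lemma uniform_fine (d : R) : 0 < d -> exists k0, forall k, (k0 <= k)%N ->
  mesh_le L (uniform_partition L k) d.
Proof.
move=> d0; exists (Num.truncn (L / d)) => k hk i.
apply: le_trans (uniform_mesh L_gt0 k i) _.
rewrite ler_pdivrMr// mulrC -ler_pdivrMr//.
apply: le_trans (ltW (truncnS_gt _)) _.
by rewrite ler_nat.
Qed.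

(** The supremum is bounded by the integral of the curvature, and fine polygonals
    approach it. *)
Lemma curve_TCE : curve_TC 0 L c = (K L)%:E.
Proof.
apply/eqP; rewrite eq_le; apply/andP; split.
  by apply: ge_ereal_sup => _ [lam lamP <-]; rewrite lee_fin TC_le_total_curvature.
apply/lee_addgt0Pr => e e0.
have [d d0 hd] := near0_witness (frame_close_fine L_gt0 hC3 harc hcurv e0).
have [k hk] := uniform_fine d0.
have P := uniform_partitionP L_gt0 k.
have := close_TC (hd _ P (hk k (leqnn k))).
set T := TC _ => h.
apply: (@le_trans _ _ (T%:E + e%:E)%E).
  by rewrite -EFinD lee_fin; move: h; rewrite ler_norml => /andP[]; lra.
rewrite leeD2r//; apply: ereal_sup_ubound.
by exists (uniform_partition L k).
Qed.

(** A small modulus forces a fine partition, on which the total absolute torsion is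
    close to the integral; uniform partitions keep the suprema from being empty. *)
Lemma curve_TATE : curve_TAT 0 L c = (Th L)%:E.
Proof.
apply: (@cvg_lim _ (@ereal_hausdorff R)).
pose TATs (d : R) := [set (TAT (inscribed 0 c lam))%:E
  | lam in [set lam | itv_partition 0 L lam /\ modulus 0 L c lam < d]].
have main (e : R) : 0 < e -> \forall d \near 0^'+,
    ((Th L - e)%:E <= ereal_sup (TATs d) <= (Th L + e)%:E)%E.
  move=> e0; have [b b0 hb] := near0_witness (frame_close_fine L_gt0 hC3 harc hcurv e0).
  apply: filterS2 (mesh_le_modulus L_gt0 hC3 harc b0) (nbhs_right_gt (0 : R)) => d hd d0.
  have close lam : itv_partition 0 L lam -> modulus 0 L c lam < d ->
      `|TAT (inscribed 0 c lam) - Th L| <= e.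
    by move=> P M; exact: close_TAT (hb _ P (hd _ P M)).
  apply/andP; split.
    have d2 : 0 < d / 2 by rewrite divr_gt0.
    have [k hk] := uniform_fine d2; have P := uniform_partitionP L_gt0 k.
    have M : modulus 0 L c (uniform_partition L k) < d.
      have /andP[_ h] := modulus_le_mesh harc P (ltW d2) (hk k (leqnn k)).
      by apply: le_lt_trans h _; lra.
    apply: (@le_trans _ _ (TAT (inscribed 0 c (uniform_partition L k)))%:E).
      by rewrite lee_fin; have := close _ P M; rewrite ler_norml => /andP[]; lra.
    by apply: ereal_sup_ubound; exists (uniform_partition L k).
  apply: ge_ereal_sup => _ [lam [P M] <-]; rewrite lee_fin.
  by have := close _ P M; rewrite ler_norml => /andP[]; lra.
apply/fine_cvgP; split.
  apply: filterS (main 1 ltr01) => d /andP[h1 h2].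
  by rewrite fin_numE -ltNye -ltey (lt_le_trans _ h1) ?ltNyr// (le_lt_trans h2) ?ltry.
apply/cvgrPdist_le => e e0; apply: filterS (main e e0) => d /=.
case: ereal_sup => [r| |] /=; rewrite ?lee_fin.
- by move=> /andP[? ?]; rewrite ler_norml; apply/andP; split; lra.
- by rewrite leye_eq andbF.
- by [].
Qed.

Definition arc_parameter (x : R) : R :=
  \int[@lebesgue_measure R]_(l in `[0, x]) (curvature 0 L c l + `|torsion 0 L c l|).

Lemma arc_parameterE x : x \in I -> arc_parameter x = K x + Th x.
Proof.
move=> xI; rewrite /arc_parameter RintegralD//.
- exact: sucont_integrable (curvature_sucont L_gt0 hC3) xI.
- exact: sucont_integrable (torsion_sucont L_gt0 hC3 harc hcurv) xI.
Qed.

Lemma arc_parameter_lower : exists2 m : R, 0 < m & {in I &, forall x y, x <= y ->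
  m * (y - x) <= arc_parameter y - arc_parameter x}.
Proof.
have [m m0 hm] := curvature_lower L_gt0 hC3 hcurv; exists m => // x y xI yI xy.
rewrite !arc_parameterE//.
have [z zxy Kz] := Rintegral_mean_value L_gt0 (curvature_sucont L_gt0 hC3) xI yI xy.
have [w wxy Tw] := Rintegral_mean_value L_gt0 (torsion_sucont L_gt0 hC3 harc hcurv) xI yI xy.
rewrite -/(K y) -/(K x) in Kz; rewrite -/(Th y) -/(Th x) in Tw.
have zI : z \in I by apply: (itv_convex xI yI); move: zxy; rewrite in_itv.
have -> : K y + Th y - (K x + Th x) = (K y - K x) + (Th y - Th x) by ring.
rewrite Kz Tw -[X in X <= _]addr0 lerD//.
  by rewrite ler_wpM2r ?subr_ge0// hm.
by rewrite mulr_ge0// subr_ge0.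
Qed.

Lemma arc_parameter_cont : {within `[0, L], continuous arc_parameter}.
Proof.
apply: sucont_within => e e0; have e2 : 0 < e / 2 by rewrite divr_gt0.
apply: filterS2 (total_curvature_sucont L_gt0 hC3 e2)
  (total_torsion_sucont L_gt0 hC3 harc hcurv e2) => d h1 h2 x y xI yI xy.
rewrite !arc_parameterE//.
have -> : K y + Th y - (K x + Th x) = (K y - K x) + (Th y - Th x) by ring.
apply: le_trans (ler_normD _ _) _.
by apply: le_trans (lerD (h1 x y xI yI xy) (h2 x y xI yI xy)) _; lra.
Qed.

End Totals.

Section WeakNormal.
Context {R : realType}.
Variables (L : R) (c : R -> 'rV[R]_3).
Hypothesis L_gt0 : 0 < L.
Hypothesis hC3 : class_C 0 L c 3.
Hypothesis harc : arclength_param 0 L c.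
Local Notation I := `[0, L].
Hypothesis hcurv : {in I, forall x, derivn_in 0 L 2 c x != 0}.
Local Notation K := (total_curvature L c).
Local Notation Th := (total_torsion L c).
Local Notation pn x := (principal_normal 0 L c x).
Local Notation phi := (arc_parameter L c).

Lemma arc_parameter0 : phi 0 = 0. Proof. exact: Rintegral_start. Qed.

Lemma arc_parameterL : phi L = K L + Th L.
Proof. by apply: (arc_parameterE L_gt0 hC3 harc hcurv); rewrite in_itv/= lexx ltW. Qed.

Lemma arc_parameter_mono : {in I &, {homo phi : x y / x < y}}.
Proof.
have [m m0 hm] := arc_parameter_lower L_gt0 hC3 harc hcurv.
move=> x y xI yI xy; rewrite -subr_gt0; apply: lt_le_trans (hm x y xI yI (ltW xy)).
by rewrite mulr_gt0// subr_gt0.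
Qed.

Lemma total_gt0 : 0 < K L + Th L.
Proof.
rewrite -arc_parameterL -arc_parameter0; apply: arc_parameter_mono => //.
all: by rewrite in_itv/= lexx ltW.
Qed.

Lemma arc_parameter_bij : set_bij `[0, L]%classic `[0, K L + Th L]%classic phi.
Proof.
have OI : 0 \in I by rewrite in_itv/= lexx ltW.
have LI : L \in I by rewrite in_itv/= lexx ltW.
have mono x y : x \in I -> y \in I -> x <= y -> phi x <= phi y.
  move=> xI yI; rewrite le_eqVlt => /orP[/eqP -> //|xy].
  exact/ltW/arc_parameter_mono.
split.
- move=> x /= xI; move: (xI); rewrite !in_itv/= => /andP[x0 xL].
  by rewrite -arc_parameterL -{1}arc_parameter0 !mono.
- move=> x y; rewrite !inE /= => xI yI xy.
  have [h|h|//] := ltgtP x y.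
    by have := arc_parameter_mono xI yI h; rewrite xy ltxx.
  by have := arc_parameter_mono yI xI h; rewrite xy ltxx.
- move=> u /=; rewrite in_itv/= => /andP[u0 u1].
  have [||x xI xu] := @IVT R phi 0 L u (ltW L_gt0).
  + exact: arc_parameter_cont L_gt0 hC3 harc hcurv.
  + by rewrite arc_parameter0 arc_parameterL ge_min u0 /= le_max u1 orbT.
  by exists x.
Qed.

Lemma modulus_uniform_cvg0 k1 :
  modulus 0 L c (uniform_partition L (k1 + h)) @[h --> \oo] --> (0 : R).
Proof.
apply/cvgrPdist_le => e e0; have [k hk] := uniform_fine L_gt0 e0.
apply: filterS (nbhs_infty_ge k) => h /= kh.
have m := hk (k1 + h)%N (leq_trans kh (leq_addl _ _)).
have /andP[m0 m1] := modulus_le_mesh harc (uniform_partitionP L_gt0 _) (ltW e0) m.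
by rewrite sub0r normrN ger0_norm.
Qed.

Lemma rescale_close (a b u e : R) : 0 < b -> 0 <= u <= b -> `|a - b| <= e ->
  `|a * u / b - u| <= e.
Proof.
move=> b0 /andP[u0 ub] ab.
have -> : a * u / b - u = (a - b) * (u / b) by field; rewrite gt_eqF.
rewrite normrM (ger0_norm (_ : 0 <= u / b)) ?divr_ge0 ?(ltW b0)//.
apply: le_trans ab; rewrite ler_piMr// ler_pdivrMr// mul1r//.
Qed.

(** Along fine uniform partitions the normal indicatrix at the rescaled parameter is
    close to the principal normal at a point [y] with [phi y] close to [u]; as [phi]
    grows at least linearly, [y] is close to the point [x] with [phi x = u]. *)
Lemma weak_normal_eq (nc : R -> RP2 R) x : is_weak_principal_normal 0 L c nc -> x \in I ->
  cls (pn x) = nc (phi x).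
Proof.
move=> [_ _ _ hnc] xI; rewrite curve_TCE// curve_TATE// /= in hnc.
have CT0 := total_gt0.
have uI : phi x \in `[0, K L + Th L].
  by have [h _ _] := arc_parameter_bij; exact: h.
set u := phi x in uI *.
apply/geodRP2_eq0/eqP; rewrite eq_le geodRP2_ge0 andbT.
apply/ler_addgt0Pr => e e0; rewrite add0r.
have [m m0 hm] := arc_parameter_lower L_gt0 hC3 harc hcurv.
have e16 : 0 < e / 16 by rewrite divr_gt0.
have [d d0 hd] := near0_witness (udiff_ucont L_gt0 (normal_udiff L_gt0 hC3 hcurv) e16).
pose a := Num.min (1 / 32) (Num.min (e / 128) (m * d / 5)).
have a0 : 0 < a by rewrite !lt_min !divr_gt0// mulr_gt0.
have a32 : a <= 1 / 32 by rewrite ge_min lexx.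
have ae : a <= e / 128 by rewrite !ge_min lexx orbT.
have ad : a <= m * d / 5 by rewrite !ge_min lexx !orbT.
clearbody a.
have [b b0 hb] := near0_witness (frame_close_fine L_gt0 hC3 harc hcurv a0).
have [k1 hk1] := uniform_fine L_gt0 b0.
pose lam h := uniform_partition L (k1 + h).
have lamP h : itv_partition 0 L (lam h) by exact: uniform_partitionP.
have fc h : frame_close L c (lam h) a by apply: hb => //; apply: hk1; exact: leq_addr.
have a1 : a <= 1 by lra.
have /choice[n hn] : forall h, exists n, normal_indicatrix (inscribed 0 c (lam h)) n.
  by move=> h; exact: frame_close_indicatrix a1 (fc h).
have e4 : 0 < e / 4 by rewrite divr_gt0.
have [h hh] := filter_ex (hnc lam n lamP (modulus_uniform_cvg0 k1) hn _ e4).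
have {hh} := hh u uI.
set S := TC _ + TAT _; set w := S * u / _ => nw.
have S0 : `|S - (K L + Th L)| <= 2 * a.
  have -> : S - (K L + Th L) = (TC (inscribed 0 c (lam h)) - K L)
      + (TAT (inscribed 0 c (lam h)) - Th L) by rewrite /S; ring.
  apply: le_trans (ler_normD _ _) _; apply: le_trans (lerD (close_TC (fc h)) (close_TAT (fc h))) _.
  by rewrite mulr_natl mulr2n.
move: (uI); rewrite in_itv/= => u01; have /andP[u0 u1] := u01.
have Sge0 : 0 <= S.
  rewrite addr_ge0// sumr_ge0// => j _; [exact: geodS2_ge0|exact: geodRP2_ge0].
have wS : w \in `[0, S].
  rewrite in_itv/= /w divr_ge0 ?mulr_ge0 ?(ltW CT0)//= ler_pdivrMr//.
  by rewrite ler_wpM2l.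
have wu : `|w - u| <= 2 * a by exact: rescale_close.
have [y [yI yw ny]] := indicatrix_near_normal L_gt0 hC3 harc hcurv (lamP h) a32 (fc h) (hn h) wS.
rewrite -(arc_parameterE L_gt0 hC3 harc hcurv yI) in yw.
have yu : `|phi y - phi x| <= 5 * a.
  rewrite -/u; apply: le_trans (ler_distD w _ _) _; rewrite distrC.
  by apply: le_trans (lerD yw wu) _; lra.
have yx : `|y - x| <= d.
  have key p q : p \in I -> q \in I -> p <= q -> `|phi q - phi p| <= 5 * a -> q - p <= d.
    move=> pI qI pq hpq; rewrite -(ler_pM2l m0); apply: le_trans (hm p q pI qI pq) _.
    by apply: le_trans (ler_norm _) _; apply: le_trans hpq _; lra.
  have [h1|/ltW h1] := leP x y; first by rewrite ger0_norm ?subr_ge0//; exact: key.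
  by rewrite distrC ger0_norm ?subr_ge0//; apply: key => //; rewrite distrC.
have nxy : geodRP2 (cls (pn x)) (cls (pn y)) <= e / 4.
  apply: le_trans (geodRP2_le _ _) _; apply: le_trans (geodS2_le_chord _ _) _.
  rewrite edistC; have := hd x y xI yI yx; rewrite /=.
  by move: (enorm _) => z; lra.
have T1 := geodRP2_triangle (cls (pn y)) (cls (pn x)) (nc u).
have T2 := geodRP2_triangle (n h w) (cls (pn y)) (nc u).
apply: le_trans T1 _; apply: le_trans (lerD nxy (le_trans T2 (lerD ny (ltW nw)))) _.
lra.
Qed.

End WeakNormal.

Theorem proposition5p7 (R : realType) (L : R) (c : R -> 'rV[R]_3)
  (hL : 0 < L)
  (hC3 : class_C 0 L c 3)
  (harc : arclength_param 0 L c)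
  (hcurv : {in `[0, L], forall x, derivn_in 0 L 2 c x != 0}) :
  let C := fine (curve_TC 0 L c) in
  let T := fine (curve_TAT 0 L c) in
  let t := fun x : R => \int[lebesgue_measure]_(l in `[0, x])
             (curvature 0 L c l + `|torsion 0 L c l|) in
  [/\ curve_length 0 L c = L%:E,
      curve_TC 0 L c \is a fin_num,
      curve_TAT 0 L c \is a fin_num,
      {in `[0, L] &, {homo t : x y / x < y}} /\
        set_bij `[0, L] `[0, C + T] t &
      forall s : R -> R,
        {in `[0, C + T], forall u, s u \in `[0, L]} ->
        {in `[0, L], cancel t s} ->
        {in `[0, C + T], cancel s t} ->
        forall nc : R -> RP2 R, is_weak_principal_normal 0 L c nc ->
        {in `[0, C + T], forall u,
          cls (principal_normal 0 L c (s u)) = nc u}].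
Proof.
have TCE := curve_TCE hL hC3 harc hcurv; have TATE := curve_TATE hL hC3 harc hcurv.
move=> C T t.
have CE : C = total_curvature L c L by rewrite /C TCE.
have TE : T = total_torsion L c L by rewrite /T TATE.
split.
- by rewrite harc ?subr0 ?(ltW hL).
- by rewrite TCE.
- by rewrite TATE.
- rewrite CE TE; split; [exact: arc_parameter_mono hL hC3 harc hcurv|].
  exact: arc_parameter_bij hL hC3 harc hcurv.
- move=> s sI _ sK nc hnc u uI; rewrite -[in RHS](sK u uI).
  exact: (weak_normal_eq hL hC3 harc hcurv hnc (sI u uI)).
Qed.
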